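(* Let $C$ be a complete, irreducible, non-singular curve with a rational point over a finite field $k$ that contains the $m$-th roots of unity, with function field $\Sigma_C$, and let $B$ be an artinian local finite $k$-algebra. If $f,g\in(\Sigma_C\otimes_kB)^*$, then $$\prod_{p\in C}\widetilde{(f,g)}_{p,B}^{\phi_N}=1,$$ the product running over the closed points of $C$, where only finitely many of the factors differ from $1$ in $\mu_m^{\bullet}(\operatorname{Spec}B)$.
   Context: ''$k$ contains the $m$-th roots of unity'' means that $m$ divides $q-1$, where $q=\#k$. $\mu_m$ is the $k$-scheme of $m$-th roots of unity, so $\mu_m^{\bullet}(\operatorname{Spec}B)=\{b\in B^*: b^m=1\}$. For an integer $N$, $\phi_N\colon\mathbb G_m\to\mathbb G_m$ is the character $\lambda\mapsto\lambda^N$. For a closed point $p\in C$ with residue field $k(p)$, $\deg(p)=[k(p):k]$, put $R=B\otimes_kk(p)$. $\tilde\Gamma_p^{\bullet}(\operatorname{Spec}B)$ is the multiplicative group of Laurent series $$u=\lambda z^n\prod_{i=1}^l(1-a_{-i}z^{-i})\prod_{i=1}^\infty(1-a_iz^i)$$ with $n\in\mathbb Z$, $\lambda\in R^*$, $a_i\in R$, $a_{-i}\in R$ nilpotent. For such $u$ and $w=\mu z^s\prod_{j=1}^h(1-b_{-j}z^{-j})\prod_{j=1}^\infty(1-b_jz^j)$, the symbol $(u,w)_p^{\phi_N}\in B^*$ is the $N$-th power of $$(-1)^{ns\deg(p)}N_{k(p)/k}\left(\frac{\lambda^s\prod_{i=1}^\infty\prod_{j=1}^h\big(1-a_i^{j/(i,j)}b_{-j}^{i/(i,j)}\big)^{(i,j)}}{\mu^n\prod_{j=1}^\infty\prod_{i=1}^l\big(1-b_j^{i/(i,j)}a_{-i}^{j/(i,j)}\big)^{(i,j)}}\right),$$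 where $(i,j)$ is the greatest common divisor and $N_{k(p)/k}\colon R^*\to B^*$ is the norm. $N$ is a positive integer such that for every closed point $p$ the map $(\ ,\ )_p^{\phi_N}$ on $\tilde\Gamma_p^{\bullet}(\operatorname{Spec}B)\times\tilde\Gamma_p^{\bullet}(\operatorname{Spec}B)$ takes values in $\mu_m^{\bullet}(\operatorname{Spec}B)$ (for instance $N=\#B^*/m$); $\widetilde{(\ ,\ )}_{p,B}^{\phi_N}$ denotes the resulting map to $\mu_m^{\bullet}(\operatorname{Spec}B)$. For $f,g\in(\Sigma_C\otimes_kB)^*$ it is computed through the natural immersion $(\Sigma_C\otimes_kB)^*\hookrightarrow\tilde\Gamma_p^{\bullet}(\operatorname{Spec}B)$ induced by Laurent expansion at $p$: $\Sigma_C\hookrightarrow(\hat{\mathcal O}_p)_{(0)}\simeq k(p)((z))$, where $\hat{\mathcal O}_p$ is the completed local ring at $p$ and $(\cdot)_{(0)}$ denotes the field of fractions.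
   Formalization: If the residue field of B is larger than k, B⊗k(p) need not be local and f may have no single integer order at p (e.g. x−α on the projective line, B=F_{q²}, deg p=2); the order n is taken locally constant, the symbol being computed on each component of B⊗k(p) before the norm. *)

(* Defs.v *)
From HB Require Import structures.
From mathcomp Require Import all_boot all_order all_algebra all_field.
From mathcomp Require Import all_classical.
From mathcomp Require Import zify.
Set Implicit Arguments.
Unset Strict Implicit.
Unset Printing Implicit Defensive.
Import Order.TTheory GRing.Theory Num.Theory.
Local Open Scope classical_set_scope.
Local Open Scope ring_scope.

(* Formal Laurent series: sequences of coefficients indexed by the integers    *)
(* that vanish below some bound. Their product is lmul_coef.                  *)
Record laurent (R : comNzRingType) := Laurent {
  lcoef :> int -> R;
  lcoef_bounded : exists a : int, forall i, i < a -> lcoef i = 0 }.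

Section LaurentRing.
Variable R : comNzRingType.
Implicit Types f g h : laurent R.

Lemma laurentP f g : (forall i, f i = g i) -> f = g.
Proof.
case: f g => [f hf] [g hg] /= /funext fg; rewrite -fg in hg *.
by congr Laurent; exact: Prop_irrelevance.
Qed.

HB.instance Definition _ := gen_eqMixin (laurent R).
HB.instance Definition _ := gen_choiceMixin (laurent R).

Definition vanishes_below (a : int) (f : int -> R) := forall i, i < a -> f i = 0.

Lemma vanishes_below_le a b (f : int -> R) :
  a <= b -> vanishes_below b f -> vanishes_below a f.
Proof. by move=> ab fb i ia; apply: fb; apply: lt_le_trans ia ab. Qed.

Fact lzero_bounded : exists a, vanishes_below a (fun=> 0).
Proof. by exists 0. Qed.
Fact ladd_bounded f g : exists a, vanishes_below a (fun i => f i + g i).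
Proof.
have [[a fa] [b gb]] := (lcoef_bounded f, lcoef_bounded g).
by exists (Num.min a b) => i; rewrite lt_min => /andP[ia ib]; rewrite fa ?gb ?addr0.
Qed.
Fact lopp_bounded f : exists a, vanishes_below a (fun i => - f i).
Proof. by have [a fa] := lcoef_bounded f; exists a => i /fa ->; rewrite oppr0. Qed.

Definition lzero := Laurent lzero_bounded.
Definition ladd f g := Laurent (ladd_bounded f g).
Definition lopp f := Laurent (lopp_bounded f).

Fact laddA : associative ladd.
Proof. by move=> f g h; apply: laurentP => i /=; rewrite addrA. Qed.
Fact laddC : commutative ladd.
Proof. by move=> f g; apply: laurentP => i /=; rewrite addrC. Qed.
Fact ladd0 : left_id lzero ladd.
Proof. by move=> f; apply: laurentP => i /=; rewrite add0r. Qed.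
Fact laddN : left_inverse lzero lopp ladd.
Proof. by move=> f; apply: laurentP => i /=; rewrite addNr. Qed.

HB.instance Definition _ := GRing.isZmodule.Build (laurent R) laddA laddC ladd0 laddN.

Definition lmul_coef (f g : int -> R) (n : int) : R :=
  \sum_(i \in [set: int]) f i * g (n - i).

Definition ltrunc (f : int -> R) (a : int) (D : nat) : {poly R} :=
  \poly_(i < D) f (a + i%:Z).

Lemma lmul_coef0 a b (f g : int -> R) : vanishes_below a f -> vanishes_below b g ->
  vanishes_below (a + b) (lmul_coef f g).
Proof.
move=> fa gb n nab; apply: fsbig1 => i _; have [ia|ai] := ltP i a.
  by rewrite fa ?mul0r.
by rewrite gb ?mulr0//; lia.
Qed.

Lemma lmul_coefE a b (f g : int -> R) D d : vanishes_below a f -> vanishes_below b g ->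
  (d < D)%N -> lmul_coef f g (a + b + d%:Z) = (ltrunc f a D * ltrunc g b D)`_d.
Proof.
move=> fa gb dD; rewrite /lmul_coef.
rewrite (fsbigE (map (fun j : nat => a + j%:Z) (iota 0 d.+1))) //; last first.
- move=> i _ ni; have [ia|ai] := ltP i a; first by rewrite fa ?mul0r.
  rewrite gb ?mulr0//; rewrite ltNge; apply/negP => le; move/negP: ni; apply.
  apply/mapP; exists `|(i - a)%R|%N; last by lia.
  by rewrite mem_iota; lia.
- by rewrite map_inj_uniq ?iota_uniq// => i j /addrI [].
rewrite coefM big_mkcond big_map -val_enum_ord big_map big_enum /=.
apply: eq_bigr => j _; rewrite !coef_poly.
have jd := ltn_ord j; rewrite !ifT; [|lia|lia|by rewrite mem_set].
by congr (_ * g _); lia.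
Qed.

Fact lmul_bounded f g : exists a, vanishes_below a (lmul_coef f g).
Proof.
have [[a fa] [b gb]] := (lcoef_bounded f, lcoef_bounded g).
by exists (a + b); apply: lmul_coef0.
Qed.

Definition lmul f g := Laurent (lmul_bounded f g).

Lemma laurent_ext c f g : vanishes_below c f -> vanishes_below c g ->
  (forall d : nat, f (c + d%:Z) = g (c + d%:Z)) -> f = g.
Proof.
move=> fc gc fg; apply: laurentP => i; have [ic|ci] := ltP i c.
  by rewrite fc ?gc.
by have -> : i = c + `|(i - c)%R|%N%:Z by lia.
Qed.

Lemma ltrunc_mul a b (f g : int -> R) D i : vanishes_below a f -> vanishes_below b g ->
  (i < D)%N -> (ltrunc (lmul_coef f g) (a + b) D)`_i = (ltrunc f a D * ltrunc g b D)`_i.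
Proof. by move=> fa gb iD; rewrite coef_poly iD; apply: lmul_coefE. Qed.

Fact lmulC : commutative lmul.
Proof.
move=> f g; have [[a fa] [b gb]] := (lcoef_bounded f, lcoef_bounded g).
apply: (@laurent_ext (a + b)).
- exact: lmul_coef0.
- by rewrite addrC; exact: lmul_coef0.
move=> d /=; rewrite (lmul_coefE fa gb (ltnSn d)).
by rewrite [a + b]addrC (lmul_coefE gb fa (ltnSn d)) mulrC.
Qed.

Fact lmulA : associative lmul.
Proof.
move=> f g h; have [[[a fa] [b gb]] [c hc]] :=
  (lcoef_bounded f, lcoef_bounded g, lcoef_bounded h).
apply: (@laurent_ext (a + b + c)).
- by rewrite -addrA; apply: lmul_coef0 => //; apply: lmul_coef0.
- by apply: lmul_coef0 => //; apply: lmul_coef0.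
move=> d /=; rewrite (lmul_coefE (lmul_coef0 fa gb) hc (ltnSn d)).
rewrite -[a + b + c]addrA (lmul_coefE fa (lmul_coef0 gb hc) (ltnSn d)).
set Tf := ltrunc f a _; set Tg := ltrunc g b d.+1; set Th := ltrunc h c _.
transitivity (Tf * (Tg * Th))`_d; last rewrite mulrA.
  rewrite !coefM; apply: eq_bigr => j _; congr (_ * _).
  by rewrite ltrunc_mul // ltnS leq_subr.
rewrite !coefM; apply: eq_bigr => j _; congr (_ * _).
by rewrite ltrunc_mul.
Qed.

Fact lone_bounded : exists a, vanishes_below a (fun i => (i == 0)%:R).
Proof. by exists 0 => i i0; rewrite lt_eqF. Qed.
Definition lone := Laurent lone_bounded.

Fact lmul1 : left_id lone lmul.
Proof.
move=> f; have [a fa] := lcoef_bounded f.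
have l0 : vanishes_below 0 lone by move=> i i0 /=; rewrite lt_eqF.
apply: (@laurent_ext (0 + a)); first exact: lmul_coef0.
  by rewrite add0r.
move=> d; rewrite [LHS](lmul_coefE l0 fa (ltnSn d)).
have -> : ltrunc lone 0 d.+1 = 1.
  apply/polyP => i; rewrite coef_poly coef1 add0r /=.
  by case: i => [|i] //=; case: ifP.
by rewrite mul1r coef_poly ltnSn add0r.
Qed.

Fact lmulD : left_distributive lmul ladd.
Proof.
move=> f g h; have [[[a fa] [b gb]] [c hc]] :=
  (lcoef_bounded f, lcoef_bounded g, lcoef_bounded h).
pose e := Num.min a b.
have fe : vanishes_below e f by apply: vanishes_below_le fa; rewrite ge_min lexx.
have ge : vanishes_below e g by apply: vanishes_below_le gb; rewrite ge_min lexx orbT.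
have fge : vanishes_below e (ladd f g) by move=> i ie /=; rewrite fe ?ge ?addr0.
apply: (@laurent_ext (e + c)); first exact: lmul_coef0.
  by move=> i ie /=; rewrite !(lmul_coef0 _ hc ie) ?addr0.
move=> d; rewrite [LHS](lmul_coefE fge hc (ltnSn d)) /=.
rewrite (lmul_coefE fe hc (ltnSn d)) (lmul_coefE ge hc (ltnSn d)).
rewrite -coefD -mulrDl; congr (_ * _ : {poly R})`_d.
by apply/polyP => i; rewrite coefD !coef_poly; case: ifP; rewrite ?addr0.
Qed.

Fact lone_neq0 : lone != 0.
Proof.
apply/eqP => /(congr1 (fun f : laurent R => f 0)) /= /eqP.
by rewrite oner_eq0.
Qed.

HB.instance Definition _ := GRing.Zmodule_isComNzRing.Build (laurent R)
  lmulA lmulC lmul1 lmulD lone_neq0.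

End LaurentRing.

Definition finite_alg (k : fieldType) (F : comUnitAlgType k) : Prop :=
  exists (n : nat) (b : 'I_n -> F), forall y : F,
    exists! c : {ffun 'I_n -> k}, y = \sum_i c i *: b i.

Section FiniteAlgebra.
Variables (k : fieldType) (F : comUnitAlgType k) (hF : finite_alg F).

Definition fdim : nat := projT1 (cid hF).
Definition fbasis : 'I_fdim -> F := projT1 (cid (projT2 (cid hF))).

Lemma fbasisP y : exists! c : {ffun 'I_fdim -> k}, y = \sum_i c i *: fbasis i.
Proof. exact: (projT2 (cid (projT2 (cid hF))) y). Qed.

Definition fcoord (y : F) : {ffun 'I_fdim -> k} := projT1 (cid (fbasisP y)).

Lemma fcoordE y : y = \sum_i fcoord y i *: fbasis i.
Proof. by rewrite /fcoord; case: cid => c []. Qed.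

Lemma fcoord_uniq y (c : 'I_fdim -> k) :
  y = \sum_i c i *: fbasis i -> fcoord y =1 c.
Proof.
rewrite /fcoord; case: cid => d [_ u] /= yE i; rewrite (u [ffun j => c j]) ?ffunE //.
by rewrite [LHS]yE; apply: eq_bigr => j _; rewrite ffunE.
Qed.

Lemma fcoord_sum (I : Type) (r : seq I) (a : I -> k) (y : I -> F) i :
  fcoord (\sum_(j <- r) a j *: y j) i = \sum_(j <- r) a j * fcoord (y j) i.
Proof.
move: i; apply: fcoord_uniq; under [RHS]eq_bigr do rewrite scaler_suml.
rewrite exchange_big; apply: eq_bigr => j _ /=; rewrite [in LHS](fcoordE (y j)).
by rewrite scaler_sumr; apply: eq_bigr => i _; rewrite scalerA.
Qed.

Lemma fcoordD y z i : fcoord (y + z) i = fcoord y i + fcoord z i.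
Proof.
move: i; apply: fcoord_uniq; rewrite [in LHS](fcoordE y) [in LHS](fcoordE z).
by rewrite -big_split; apply: eq_bigr => i _ /=; rewrite scalerDl.
Qed.

Lemma fcoord_basis i j : fcoord (fbasis i) j = (i == j)%:R.
Proof.
move: j; apply: fcoord_uniq; rewrite (bigD1 i) //= eqxx scale1r big1 ?addr0 //.
by move=> j /negPf; rewrite eq_sym => ->; rewrite scale0r.
Qed.

End FiniteAlgebra.

Arguments fbasis {k F} hF i.

(* The tensor product over k of A (a k-algebra through s) and F, as the free  *)
(* A-module on a k-basis of F.                                                *)
Definition tens (k : fieldType) (A : comNzRingType) (s : {rmorphism k -> A})
  (F : comUnitAlgType k) (hF : finite_alg F) : Type := {ffun 'I_(fdim hF) -> A}.

Section TensorProduct.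
Variables (k : fieldType) (A : comNzRingType) (s : {rmorphism k -> A}).
Variables (F : comUnitAlgType k) (hF : finite_alg F).
Local Notation fbasis := (fbasis hF).
Local Notation fcoord := (fcoord hF).
Local Notation fdim := (fdim hF).
Local Notation tens := (tens s hF).

HB.instance Definition _ := GRing.Zmodule.on tens.

Definition tstruct i j l : A := s (fcoord (fbasis i * fbasis j) l).
Definition tmul (x y : tens) : tens :=
  [ffun l => \sum_i \sum_j x i * y j * tstruct i j l].
Definition tinl (a : A) : tens := [ffun l => a * s (fcoord 1 l)].
Definition tinr (y : F) : tens := [ffun l => s (fcoord y l)].

Fact tstructA i j m t :
  \sum_l tstruct i j l * tstruct l m t = \sum_l tstruct j m l * tstruct i l t.
Proof.
rewrite /tstruct; under eq_bigr do rewrite -rmorphM.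
under [RHS]eq_bigr do rewrite -rmorphM.
rewrite -!rmorph_sum -!fcoord_sum; congr (s (fcoord _ _)).
under eq_bigr do rewrite scalerAl; rewrite -mulr_suml -(fcoordE hF).
under [RHS]eq_bigr do rewrite scalerAr; rewrite -mulr_sumr -(fcoordE hF).
by rewrite mulrA.
Qed.

Fact tmulC : commutative tmul.
Proof.
move=> x y; apply/ffunP => l; rewrite !ffunE exchange_big.
apply: eq_bigr => i _; apply: eq_bigr => j _.
by rewrite [x _ * _]mulrC /tstruct [fbasis _ * _]mulrC.
Qed.

Fact tmulA : associative tmul.
Proof.
move=> x y z; apply/ffunP => t; rewrite !ffunE.
transitivity (\sum_i \sum_j \sum_m x i * y j * z m * \sum_l tstruct j m l * tstruct i l t).
  apply: eq_bigr => i _.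
  under eq_bigr => l _ do rewrite ffunE mulr_sumr mulr_suml.
  rewrite exchange_big; apply: eq_bigr => j _ /=.
  under eq_bigr => l _ do rewrite mulr_sumr mulr_suml.
  rewrite exchange_big; apply: eq_bigr => m _ /=.
  by rewrite mulr_sumr; apply: eq_bigr => l _; rewrite !mulrA.
under eq_bigr => i _ do under eq_bigr => j _ do
  under eq_bigr => m _ do rewrite -tstructA mulr_sumr.
transitivity (\sum_i \sum_j \sum_l \sum_m x i * y j * tstruct i j l * z m * tstruct l m t).
  apply: eq_bigr => i _; apply: eq_bigr => j _; rewrite exchange_big.
  apply: eq_bigr => l _; apply: eq_bigr => m _ /=.
  by rewrite -!mulrA; congr (_ * (_ * _)); rewrite !mulrA [tstruct _ _ _ * _]mulrC.
under eq_bigr => i _ do rewrite exchange_big.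
rewrite exchange_big; apply: eq_bigr => l _ /=.
under [RHS]eq_bigr => m _ do rewrite ffunE -mulrA mulr_suml.
rewrite [RHS]exchange_big; apply: eq_bigr => i _ /=.
under [RHS]eq_bigr => m _ do rewrite mulr_suml.
rewrite [RHS]exchange_big; apply: eq_bigr => j _ /=.
by apply: eq_bigr => m _; rewrite !mulrA.
Qed.

Fact tmul1 : left_id (tinl 1) tmul.
Proof.
move=> y; apply/ffunP => l; rewrite ffunE exchange_big /= (bigD1 l) //=.
have E j : \sum_i tinl 1 i * y j * tstruct i j l = y j * (j == l)%:R.
  under eq_bigr => i _ do
    rewrite ffunE mul1r [s _ * _]mulrC -mulrA /tstruct -rmorphM.
  rewrite -mulr_sumr -rmorph_sum -fcoord_sum.
  under eq_bigr => i _ do rewrite scalerAl.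
  by rewrite -mulr_suml -(fcoordE hF) mul1r fcoord_basis rmorph_nat.
rewrite E eqxx mulr1 big1 ?addr0 // => j /negPf jl.
by rewrite E jl mulr0.
Qed.

Fact tmulD : left_distributive tmul +%R.
Proof.
move=> x y z; apply/ffunP => l; rewrite !ffunE -big_split; apply: eq_bigr => i _.
by rewrite -big_split; apply: eq_bigr => j _ /=; rewrite ffunE !mulrDl.
Qed.

Fact tone_neq0 : tinl 1 != 0.
Proof.
apply/eqP => /ffunP t0; have /eqP[] := oner_neq0 F.
rewrite (fcoordE hF 1) big1 // => i _; have := t0 i; rewrite !ffunE mul1r => /eqP.
by rewrite fmorph_eq0 => /eqP ->; rewrite scale0r.
Qed.

HB.instance Definition _ := GRing.Zmodule_isComNzRing.Build tens
  tmulA tmulC tmul1 tmulD tone_neq0.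

Definition tunit : pred tens := fun x => `[< exists y : tens, y * x = 1 >].
Definition tinv (x : tens) : tens := xget x [set y | y * x = 1].

Fact tmulV : {in tunit, left_inverse 1 tinv *%R}.
Proof. by move=> x /asboolP xu; apply: xgetPex xu. Qed.
Fact tunitP (x y : tens) : y * x = 1 -> tunit x.
Proof. by move=> yx; apply/asboolP; exists y. Qed.
Fact tinv_out : {in [predC tunit], tinv =1 id}.
Proof.
move=> x /negP xu; apply: xgetPN => y yx; apply: xu.
by apply/asboolP; exists y.
Qed.

HB.instance Definition _ :=
  GRing.ComNzRing_hasMulInverse.Build tens tmulV tunitP tinv_out.

Fact tinl_nmod : nmod_morphism tinl.
Proof.
split; first by apply/ffunP => l; rewrite !ffunE mul0r.
by move=> x y; apply/ffunP => l; rewrite !ffunE mulrDl.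
Qed.

Lemma tinlM_coef a x l : (tinl a * x) l = a * x l.
Proof.
have -> : tinl a * x = [ffun i => a * x i] :> tens.
  rewrite -[in RHS](mul1r x); apply/ffunP => i; rewrite !ffunE mulr_sumr.
  apply: eq_bigr => j _; rewrite mulr_sumr; apply: eq_bigr => m _.
  by rewrite !ffunE mul1r !mulrA.
by rewrite ffunE.
Qed.

Fact tinl_monoid : monoid_morphism tinl.
Proof.
split=> // x y; apply/ffunP => l; rewrite tinlM_coef !ffunE.
by rewrite mulrA.
Qed.
HB.instance Definition _ := GRing.isNmodMorphism.Build A tens tinl tinl_nmod.
HB.instance Definition _ := GRing.isMonoidMorphism.Build A tens tinl tinl_monoid.

Fact tinr_nmod : nmod_morphism tinr.
Proof.
split; last by move=> x y; apply/ffunP => l; rewrite !ffunE fcoordD rmorphD.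
apply/ffunP => l; rewrite !ffunE -[RHS](rmorph0 s); congr (s _).
by apply: (@fcoord_uniq _ _ hF 0 (fun=> 0)); rewrite big1 // => i _; rewrite scale0r.
Qed.
Fact tinr_monoid : monoid_morphism tinr.
Proof.
split; first by apply/ffunP => l; rewrite !ffunE mul1r.
move=> x y; apply/ffunP => l; rewrite !ffunE.
rewrite [in LHS](fcoordE hF x) mulr_suml.
under eq_bigr => i _ do rewrite -scalerAl.
rewrite fcoord_sum rmorph_sum; apply: eq_bigr => i _.
rewrite [in LHS](fcoordE hF y) mulr_sumr.
under eq_bigr => j _ do rewrite -scalerAr.
rewrite fcoord_sum rmorphM rmorph_sum mulr_sumr; apply: eq_bigr => j _.
by rewrite !ffunE rmorphM !mulrA.
Qed.
HB.instance Definition _ := GRing.isNmodMorphism.Build F tens tinr tinr_nmod.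
HB.instance Definition _ := GRing.isMonoidMorphism.Build F tens tinr tinr_monoid.

Lemma tens_sum (x : tens) : x = \sum_i tinl (x i) * tinr (fbasis i).
Proof.
apply/ffunP => l; rewrite sum_ffunE (bigD1 l) //= tinlM_coef ffunE fcoord_basis.
rewrite eqxx rmorph1 mulr1 big1 ?addr0 // => i /negPf il.
by rewrite tinlM_coef ffunE fcoord_basis il rmorph0 mulr0.
Qed.

Definition tmulmx (x : tens) : 'M[A]_fdim :=
  \matrix_(i, j) (x * tinr (fbasis i)) j.
Definition tnorm (x : tens) : A := \det (tmulmx x).

End TensorProduct.

Section LaurentOps.
Variable R : comNzRingType.

Fact lconst_bounded (c : R) : exists a : int, vanishes_below a (fun i => if i == 0 then c else 0).
Proof. by exists 0 => i i0; rewrite lt_eqF. Qed.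
Definition lconst (c : R) : laurent R := Laurent (lconst_bounded c).

Fact zpow_bounded (n : int) : exists a : int, vanishes_below a (fun i => (i == n)%:R : R).
Proof. by exists n => i i0; rewrite lt_eqF. Qed.
Definition zpow (n : int) : laurent R := Laurent (zpow_bounded n).

(* The infinite product is a limit in the z-adic topology: its coefficient of *)
(* z^n only depends on the factors with i <= n.                               *)
Definition lprod_coef (a : nat -> R) (n : int) : R :=
  if n is Posz d then (\prod_(1 <= i < d.+1) (1 - (a i)%:P * 'X^i))`_d else 0.
Fact lprod_bounded (a : nat -> R) : exists b : int, vanishes_below b (lprod_coef a).
Proof. by exists 0 => -[]. Qed.
Definition lprod (a : nat -> R) : laurent R := Laurent (lprod_bounded a).

End LaurentOps.

Section LaurentMap.
Variables (R S : comNzRingType) (s : {rmorphism R -> S}).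
Fact lmap_bounded (f : laurent R) : exists a : int, vanishes_below a (fun i => s (f i)).
Proof. by have [a fa] := lcoef_bounded f; exists a => i /fa ->; rewrite rmorph0. Qed.
Definition lmap (f : laurent R) : laurent S := Laurent (lmap_bounded f).
End LaurentMap.

Lemma finite_alg_ext (k : fieldType) (L : fieldExtType k) : finite_alg L.
Proof.
exists (\dim {:L}), (fun i => (vbasis {:L})`_i) => y.
exists [ffun i => coord (vbasis {:L}) i y]; split.
  rewrite [LHS](coord_vbasis (memvf y)).
  by apply: eq_bigr => i _; rewrite ffunE.
move=> c yE; apply/ffunP => i; rewrite ffunE yE coord_sum_free //.
by have /andP[] := vbasisP {:L}.
Qed.

Lemma fdim_ext (k : fieldType) (L : fieldExtType k) :
  fdim (finite_alg_ext L) = \dim {:L}.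
Proof.
pose X := [tuple fbasis (finite_alg_ext L) i | i < fdim (finite_alg_ext L)].
have XE (i : 'I_(fdim (finite_alg_ext L))) : X`_i = fbasis (finite_alg_ext L) i by rewrite -tnth_nth tnth_mktuple.
suff /size_basis -> : basis_of {:L} X by [].
apply/andP; split.
  rewrite eqEsubv subvf; apply/subvP => y _.
  rewrite (fcoordE (finite_alg_ext L) y).
  apply: memv_suml => i _; apply: memvZ; rewrite -XE.
  by apply: memv_span; apply: mem_nth; rewrite size_tuple.
apply/freeP => c c0 i.
have cE := @fcoord_uniq _ _ (finite_alg_ext L) 0 c.
have zE := @fcoord_uniq _ _ (finite_alg_ext L) 0 (fun=> 0).
rewrite -cE ?zE //; first by rewrite big1 // => j _; rewrite scale0r.
by rewrite -[LHS]c0; apply: eq_bigr => j _; rewrite XE.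
Qed.

Section NormTheory.
Variables (k : fieldType) (A : comUnitRingType) (s : {rmorphism k -> A}).
Variables (F : comUnitAlgType k) (hF : finite_alg F).
Implicit Types x y : tens s hF.

Lemma tnormM x y : tnorm (x * y) = tnorm x * tnorm y.
Proof.
rewrite /tnorm [RHS]mulrC -det_mulmx; congr (\det _); apply/matrixP => i j.
rewrite !mxE -mulrA [y * _]tens_sum mulr_sumr sum_ffunE.
apply: eq_bigr => l _; rewrite !mxE -tinlM_coef.
by rewrite mulrCA.
Qed.

Lemma tnorm_tinl a : tnorm (tinl s hF a) = a ^+ fdim hF.
Proof.
rewrite /tnorm -det_scalar; congr (\det _); apply/matrixP => i j.
by rewrite !mxE tinlM_coef ffunE fcoord_basis rmorph_nat mulr_natr.
Qed.

Lemma tnorm_sign (n : int) :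
  tnorm ((-1) ^ n : tens s hF) = (-1) ^ (n * (fdim hF)%:Z).
Proof.
have E : tnorm (-1 : tens s hF) = (-1) ^+ fdim hF.
  by rewrite -tnorm_tinl rmorphN rmorph1.
have N (j : nat) : tnorm ((-1) ^+ j : tens s hF) = (-1) ^+ (j * fdim hF).
  elim: j => [|j IHj]; first by rewrite -(rmorph1 (tinl s hF)) tnorm_tinl expr1n.
  by rewrite exprS tnormM E IHj mulSn exprD.
case: n => j; first by rewrite -PoszM -!exprnP N.
by rewrite NegzE mulNr -PoszM -!exprnN -!exprVn !invrN1 N.
Qed.

End NormTheory.

Section Curves.
Variables (k : finFieldType) (K : fieldType) (s : {rmorphism k -> K}).

(* K is a finite extension of k(x) for some x transcendental over k.          *)
Definition one_variable_function_field : Prop :=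
  exists x : K, (forall q : {poly k}, q != 0 -> (map_poly s q).[x] != 0) /\
  exists (n : nat) (e : 'I_n -> K), forall y : K,
    exists (a b : 'I_n -> {poly k}), (forall i, b i != 0) /\
      y = \sum_i (map_poly s (a i)).[x] / (map_poly s (b i)).[x] * e i.

Definition k_subalgebra (O : set K) : Prop :=
  [/\ forall c, O (s c), forall x y, O x -> O y -> O (x - y)
    & forall x y, O x -> O y -> O (x * y)].

Definition valuation_ring (O : set K) : Prop :=
  k_subalgebra O /\ forall x, O x \/ O x^-1.

Definition discrete_valuation_ring (O : set K) : Prop :=
  k_subalgebra O /\ exists v : K -> int,
  [/\ exists2 t, t != 0 & v t = 1,
      forall x y, x != 0 -> y != 0 -> v (x * y) = v x + v y,
      forall x y, x != 0 -> y != 0 -> x + y != 0 ->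
        Num.min (v x) (v y) <= v (x + y)
    & O = [set x | x = 0 \/ 0 <= v x]].

(* The set of non-units of O; the first disjunct is there because 0^-1 = 0.   *)
Definition max_ideal (O : set K) : set K :=
  [set x | O x /\ (x = 0 \/ ~ O x^-1)].

Definition dominates (V O : set K) : Prop :=
  O `<=` V /\ max_ideal O `<=` max_ideal V.

Definition residue_map (O : set K) (L : fieldExtType k) (res : K -> L) : Prop :=
  [/\ forall c, res (s c) = c%:A,
      forall x y, O x -> O y -> res (x + y) = res x + res y,
      forall x y, O x -> O y -> res (x * y) = res x * res y,
      forall y, exists2 x, O x & res x = y
    & forall x, O x -> (res x = 0 <-> max_ideal O x)].

End Curves.

(* A complete, irreducible, non-singular curve over k, described through its  *)
(* function field and the local rings of its closed points, as a scheme in    *)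
(* the sense of Chevalley. Non-singularity in dimension one says that the     *)
(* local rings are discrete valuation rings. The field complete_separated is  *)
(* the valuative criterion of properness (existence and uniqueness of the     *)
(* centre); the valuations other than the trivial one are those centred at    *)
(* closed points. residue_field p is a model of the residue field k(p),       *)
(* identified with local_ring p / max_ideal by residue p; the latter is only  *)
(* meaningful on local_ring p.                                                *)
Record curve (k : finFieldType) := Curve {
  function_field : fieldType;
  constants : {rmorphism k -> function_field};
  closed_point : choiceType;
  local_ring : closed_point -> set function_field;
  residue_field : closed_point -> fieldExtType k;
  residue : forall p : closed_point, function_field -> residue_field p;
  dimension_one : one_variable_function_field constants;
  nonsingular : forall p, discrete_valuation_ring constants (local_ring p);
  complete_separated : forall V : set function_field,
    valuation_ring constants V -> V <> setT ->
    exists! p, dominates V (local_ring p);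
  residueP : forall p, residue_map constants (local_ring p) (residue p)
}.

Definition degree (k : finFieldType) (C : curve k) (p : closed_point C) : nat :=
  \dim {: residue_field p}.

(* iota restricts to a map from the local ring O_p to k(p)[[z]] lifting the   *)
(* residue map and inducing isomorphisms O_p / m_p^n -> k(p)[[z]] / (z^n) for *)
(* all n, that is, it is the composite of the inclusion into the completion   *)
(* with an isomorphism of the completion onto k(p)[[z]].                      *)
Definition laurent_expansion (k : finFieldType) (C : curve k) (p : closed_point C)
    (iota : function_field C -> laurent (residue_field p)) : Prop :=
  [/\ forall c : k, iota (constants C c) = lconst c%:A,
      forall f, local_ring p f ->
        vanishes_below 0 (iota f) /\ iota f 0 = residue p f,
      forall t, max_ideal (local_ring p) = [set t * h | h in local_ring p] ->
        forall (n : nat) f, local_ring p f ->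
        (vanishes_below n%:Z (iota f) <-> exists2 h, local_ring p h & f = t ^+ n * h)
    & forall (n : nat) (h : laurent (residue_field p)), vanishes_below 0 h ->
        exists2 f, local_ring p f & vanishes_below n%:Z (iota f - h)].

(* An invertible Laurent series given by its factors, see gamma_series: g_neg i *)
(* is a_{-i} for 1 <= i <= g_len and g_pos i is a_i for 1 <= i; the remaining *)
(* entries of these two sequences are not used.                               *)
Record gamma (R : comUnitRingType) := Gamma {
  g_ord : int;
  g_lead : R;
  g_len : nat;
  g_neg : nat -> R;
  g_pos : nat -> R;
  g_leadP : g_lead \is a GRing.unit;
  g_negP : forall i, (0 < i <= g_len)%N -> exists e : nat, g_neg i ^+ e = 0
}.

Section Gamma.
Variable R : comUnitRingType.
Implicit Types u w : gamma R.

(* lambda z^n \prod_(i <= l) (1 - a_{-i} z^{-i}) \prod_i (1 - a_i z^i)        *)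
Definition gamma_series u : laurent R :=
  lconst (g_lead u) * zpow R (g_ord u)
  * (\prod_(1 <= i < (g_len u).+1) (1 - lconst (g_neg u i) * zpow R (- i%:Z)))
  * lprod (g_pos u).

(* Almost all factors are 1 when the b j are nilpotent. *)
Definition cross_product (a : nat -> R) (h : nat) (b : nat -> R) : R :=
  \big[*%R/1]_(i \in [set i : nat | (0 < i)%N])
    \prod_(1 <= j < h.+1)
      (1 - a i ^+ (j %/ gcdn i j) * b j ^+ (i %/ gcdn i j)) ^+ gcdn i j.

Definition symbol_ratio u w : R :=
  (g_lead u ^ g_ord w * cross_product (g_pos u) (g_len w) (g_neg w))
  / (g_lead w ^ g_ord u * cross_product (g_pos w) (g_len u) (g_neg u)).

Definition idempotent_partition (r : nat) (e : 'I_r -> R) : Prop :=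
  (forall i j, e i * e j = e i *+ (i == j)) /\ \sum_i e i = 1.

Definition glue (r : nat) (e : 'I_r -> R) (d : 'I_r -> gamma R) : laurent R :=
  \sum_i lconst (e i) * gamma_series (d i).

End Gamma.

Section Symbol.
Variables (k : finFieldType) (C : curve k) (B : comUnitAlgType k).

Definition residue_tensor (p : closed_point C) : comUnitRingType :=
  tens (in_alg B) (finite_alg_ext (residue_field p)).

Variable p : closed_point C.
Implicit Types u w : gamma (residue_tensor p).

Definition residue_norm (x : residue_tensor p) : B := tnorm x.

Definition symbol u w : B :=
  (-1) ^ (g_ord u * g_ord w * (degree p)%:Z) * residue_norm (symbol_ratio u w).

(* When the residue field of B is bigger than k, the ring B (x) k(p) need not *)
(* be local and the order n of an invertible Laurent series is only a locally *)
(* constant function on its spectrum: the series is of the form gamma_series  *)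
(* on each piece of a partition of the spectrum into open and closed subsets, *)
(* given by orthogonal idempotents. The quantity whose norm is the symbol is  *)
(* glued accordingly (note that (-1)^(n s deg p) is the norm of (-1)^(n s));  *)
(* glued_symbol_gamma checks that this is symbol when n and s are constant.   *)
Definition glued_symbol (U W : laurent (residue_tensor p)) (b : B) : Prop :=
  exists (r : nat) (e : 'I_r -> residue_tensor p)
         (u w : 'I_r -> gamma (residue_tensor p)),
  [/\ idempotent_partition e, U = glue e u, W = glue e w
    & b = residue_norm (\sum_i e i *
            ((-1) ^ (g_ord (u i) * g_ord (w i)) * symbol_ratio (u i) (w i)))].

Lemma glued_symbol_gamma u w :
  glued_symbol (gamma_series u) (gamma_series w) (symbol u w).
Proof.
have l1 : lconst 1 = 1 :> laurent (residue_tensor p).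
  by apply: laurentP => i /=; case: eqP.
exists 1, (fun=> 1), (fun=> u), (fun=> w); split.
- by split=> [i j|]; rewrite ?big_ord1 // !ord1 eqxx mulr1.
- by rewrite /glue big_ord1 l1 mul1r.
- by rewrite /glue big_ord1 l1 mul1r.
rewrite big_ord1 mul1r /residue_norm tnormM; congr (_ * _).
by rewrite tnorm_sign fdim_ext.
Qed.

End Symbol.

Definition is_local (B : comUnitRingType) : Prop :=
  forall x y : B, x \isn't a GRing.unit -> y \isn't a GRing.unit ->
    x + y \isn't a GRing.unit.

Definition mu (m : nat) (B : comUnitRingType) : set B := [set b | b ^+ m = 1].

Section CurveSymbol.
Variables (k : finFieldType) (C : curve k).
Variables (B : comUnitAlgType k) (finB : finite_alg B).

Definition function_tensor : comUnitRingType := tens (constants C) finB.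

Variable p : closed_point C.
Variable iota : {rmorphism function_field C -> laurent (residue_field p)}.

Definition expand (f : function_tensor) : laurent (residue_tensor B p) :=
  \sum_i lconst (tinl (in_alg B) (finite_alg_ext (residue_field p)) (fbasis finB i))
         * lmap (tinr (in_alg B) (finite_alg_ext (residue_field p))) (iota (f i)).

(* The default value 1 of xget is irrelevant when f and g are invertible.     *)
Definition curve_symbol (N : nat) (f g : function_tensor) : B :=
  xget 1 [set b | glued_symbol (expand f) (expand g) b] ^+ N.

End CurveSymbol.

(* Main.v *)
(* Applying the hypothesis on symbols at the rational point oo to a constant b  *)
(* and the coordinate z, whose symbol is b, gives b^(N m) = 1 for every unit b  *)
(* of B. As m is prime to the characteristic, it follows that b^N = 1 whenever  *)
(* b - 1 is nilpotent, and it suffices to prove the reciprocity law after a     *)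
(* homomorphism from B to an algebraically closed field F whose kernel consists *)
(* of nilpotent elements. The symbol at p then becomes the product of the tame  *)
(* symbols at the deg p embeddings of k(p) in F.                                *)
(*   Let A be the ring of functions regular away from oo, and V the tensor      *)
(* product of A and F. Invertible elements are fractions of elements of V, and  *)
(* the tame symbol is bimultiplicative, so f and g may be taken in V. Now V/fgV *)
(* is an extension of V/fV by V/gV and of V/gV by V/fV. Comparing volumes for   *)
(* the basis of V given by pole orders at oo, in which f and g have leading     *)
(* coefficient 1, and for the basis given by expansions at the zeros of f and g *)
(* yields Weil reciprocity for f and g.                                         *)
(*   That V is large enough rests on the weak form of Riemann's inequality. It  *)
(* is obtained by counting dimensions over k(y) and from the existence of       *)
(* valuation rings (Chevalley); strong approximation then prescribes the        *)
(* expansions at finitely many points.                                          *)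
(*   The symbols are defined because, on each piece of the partition of the     *)
(* spectrum by the idempotents c^M, an invertible Laurent series over a finite  *)
(* ring has an order below which its coefficients are nilpotent and at which    *)
(* its coefficient is invertible; it then factors by successive approximation   *)
(* modulo powers of the nilradical.                                             *)

Require Import Defs.
From HB Require Import structures.
From mathcomp Require Import all_boot all_order all_fingroup all_algebra all_solvable all_field.
From mathcomp Require Import all_classical.
From mathcomp Require Import zify ring.
Set Implicit Arguments.
Unset Strict Implicit.
Unset Printing Implicit Defensive.
Import Order.TTheory GRing.Theory Num.Theory.
Local Open Scope classical_set_scope.
Local Open Scope ring_scope.

(** Let [b p] be a value of the glued symbol of f and g at p, so that the factor at p is [b p ^+ N].
    The hypothesis on symbols at the rational point oo yields [unipotent_power]: the N-th power
    kills every element that becomes 1 under a morphism [pi] with nil kernel from B to an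
    algebraically closed field F ([residue_closure]). It is therefore enough that the product of the
    [pi (b p)] be 1. Over F the norm from k(p) splits as a product over the embeddings of k(p)
    ([norm_product]) and nilpotent parameters disappear, so [pi (b p)] is the product of the tame
    symbols at the geometric points over p ([glue_tame], [tame_norm]).

    What remains is Weil reciprocity with constants F. By bimultiplicativity ([tensor_reciprocity])
    it is enough to treat elements f and g of V, the ring of functions with constants F regular away
    from oo. Let al and be be bases of V/fV and V/gV with prescribed expansions at the zeros. Then
    al, f be and be, g al are two bases of V/fgV. They have the same volume with respect to pole
    orders at oo ([seq_det_reciprocity]). With respect to expansion coefficients at the zeros, and
    after sorting by points, their matrices are triangular, with determinants the products of the
    u^n and of the v^m, where u, v are the leading coefficients and m, n the orders of f, g. Sorting
    produces the signs ([inversions_sum]); this is [affine_reciprocity], and [regular_reciprocity]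
    adds the symbol at oo.

    The volumes have the right size because an element of V has as many zeros as its pole order
    ([product_formula]). That V is large enough comes from [pole_degree_le], which bounds poles by
    the degree over k(y), from [exists_pole], which rests on valuation rings, and from the count in
    [exists_affine_pole]; [strong_approximation] and [affine_basis] follow. Dimension counts over k
    are made by comparing cardinalities of finite sets. The ring V itself is not formed: an element
    is a polynomial, read as a list of coordinates on [affine_basis], and is seen through its
    expansions [fspan]. Finally [glue_units] shows that the symbols of invertible series exist. *)

Lemma strong_recursion (T : Type) (next : seq T -> T) :
  exists g : nat -> T, forall n, g n = next (mkseq g n).
Proof.
pose s := fix s n := if n is m.+1 then rcons (s m) (next (s m)) else [::].
exists (fun n => next (s n)) => n; congr next.
by elim: n => // n IHn; rewrite [LHS]/= {1}IHn mkseqS.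
Qed.

(** * Laurent series *)

Section LaurentBasics.
Variable R : comNzRingType.
Implicit Types f g h : laurent R.

Lemma lcoef1 i : (1 : laurent R) i = (i == 0)%:R. Proof. by []. Qed.
Lemma lcoefD f g i : (f + g) i = f i + g i. Proof. by []. Qed.
Lemma lcoefN f i : (- f) i = - f i. Proof. by []. Qed.
Lemma lcoefB f g i : (f - g) i = f i - g i. Proof. by []. Qed.
Lemma lcoef_sum (I : Type) (r : seq I) (P : pred I) (G : I -> laurent R) i :
  (\sum_(j <- r | P j) G j) i = \sum_(j <- r | P j) G j i.
Proof. by elim/big_rec2: _ => // j x y _ <-. Qed.

Lemma lcoefM a b f g d D : vanishes_below a f -> vanishes_below b g -> (d < D)%N ->
  (f * g) (a + b + d%:Z) = (ltrunc f a D * ltrunc g b D)`_d.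
Proof. by move=> fa gb; apply: lmul_coefE. Qed.

Lemma vb_le a b f : a <= b -> vanishes_below b f -> vanishes_below a f.
Proof. exact: vanishes_below_le. Qed.
Lemma vb0 a : vanishes_below a (0 : laurent R). Proof. by []. Qed.
Lemma vb1 : vanishes_below 0 (1 : laurent R).
Proof. by move=> i i0; rewrite lcoef1 lt_eqF. Qed.
Lemma vbD a f g : vanishes_below a f -> vanishes_below a g -> vanishes_below a (f + g).
Proof. by move=> fa ga i ia; rewrite lcoefD fa ?ga ?addr0. Qed.
Lemma vbN a f : vanishes_below a f -> vanishes_below a (- f).
Proof. by move=> fa i ia; rewrite lcoefN fa ?oppr0. Qed.
Lemma vbB a f g : vanishes_below a f -> vanishes_below a g -> vanishes_below a (f - g).
Proof. by move=> fa ga; apply: vbD => //; apply: vbN. Qed.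
Lemma vb_sum a (I : Type) (r : seq I) (P : pred I) (G : I -> laurent R) :
  (forall i, P i -> vanishes_below a (G i)) -> vanishes_below a (\sum_(i <- r | P i) G i).
Proof.
move=> h; elim/big_rec: _ => [|i x Pi hx]; first exact: vb0.
by apply: vbD => //; apply: h.
Qed.
Lemma vbM a b f g : vanishes_below a f -> vanishes_below b g -> vanishes_below (a + b) (f * g).
Proof. exact: lmul_coef0. Qed.
Lemma vbX (n : nat) a f : vanishes_below a f -> vanishes_below (a * n%:Z) (f ^+ n).
Proof.
move=> fa; elim: n => [|n IH]; first by rewrite mulr0; apply: vb1.
by rewrite exprS (_ : a * n.+1%:Z = a + a * n%:Z); [apply: vbM | lia].
Qed.

Lemma lead_mul a b f g : vanishes_below a f -> vanishes_below b g ->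
  (f * g) (a + b) = f a * g b.
Proof.
move=> fa gb; rewrite -[a + b]addr0 (lcoefM fa gb (ltnSn 0)).
by rewrite coefM big_ord1 !coef_poly /= !addr0.
Qed.

Lemma lconst_mulE c f i : (lconst c * f) i = c * f i.
Proof.
have [a fa] := lcoef_bounded f.
have c0 : vanishes_below 0 (lconst c) by move=> j j0 /=; rewrite lt_eqF.
have [ia|ai] := ltP i a.
  by rewrite fa // mulr0 (vbM c0 fa) // add0r.
have -> : i = 0 + a + `|i - a|%N%:Z by lia.
rewrite (lcoefM c0 fa (ltnSn _)) coefM (bigD1 ord0) //= !coef_poly /= subn0 ltnSn ?addr0 ?add0r.
rewrite big1 ?addr0 // => j j0; rewrite coef_poly ltn_ord add0r /=.
by rewrite ifF ?mul0r //; apply/negbTE; rewrite eqz_nat.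
Qed.

Fact lconst_nmod : nmod_morphism (@lconst R).
Proof. by split=> [|x y]; apply: laurentP => i /=; case: ifP; rewrite ?addr0. Qed.
Fact lconst_monoid : monoid_morphism (@lconst R).
Proof.
split=> [|x y]; apply: laurentP => i; first by rewrite /= ; case: ifP.
by rewrite lconst_mulE /=; case: ifP; rewrite ?mulr0.
Qed.
HB.instance Definition _ := GRing.isNmodMorphism.Build R (laurent R) (@lconst R) lconst_nmod.
HB.instance Definition _ := GRing.isMonoidMorphism.Build R (laurent R) (@lconst R) lconst_monoid.

Lemma zpow_mulE n f i : (zpow R n * f) i = f (i - n).
Proof.
have [a fa] := lcoef_bounded f.
have n0 : vanishes_below n (zpow R n) by move=> j j0 /=; rewrite lt_eqF.
have [ia|ai] := ltP i (n + a).
  by rewrite (vbM n0 fa) // fa //; lia.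
have -> : i = n + a + `|(i - (n + a))%R|%N%:Z by lia.
rewrite (lcoefM n0 fa (ltnSn _)) coefM (bigD1 ord0) //= !coef_poly /= subn0 ltnSn ?addr0 ?eqxx ?mul1r.
rewrite big1 ?addr0 => [|j j0]; first by congr (f _); lia.
rewrite coef_poly ltn_ord /=.
have -> : (n + Posz j == n :> int) = false by apply/negbTE; move: j0; rewrite -val_eqE /=; lia.
by rewrite mul0r.
Qed.

Lemma vb_lconst c : vanishes_below 0 (lconst c : laurent R).
Proof. by move=> j j0 /=; rewrite lt_eqF. Qed.
Lemma vb_zpow n : vanishes_below n (zpow R n).
Proof. by move=> j j0 /=; rewrite lt_eqF. Qed.
Lemma zpowD m n : zpow R m * zpow R n = zpow R (m + n).
Proof. by apply: laurentP => i; rewrite zpow_mulE /=; congr (_%:R : R); lia. Qed.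
Lemma zpow0 : zpow R 0 = 1.
Proof. exact: laurentP. Qed.
Lemma zpowX m (j : nat) : zpow R m ^+ j = zpow R (m * j%:Z).
Proof.
elim: j => [|j IH]; first by rewrite mulr0 zpow0.
by rewrite exprS IH zpowD; congr zpow; lia.
Qed.

(** The coefficients of the inverse solve a triangular system with the unit [h 0] on the
    diagonal. *)
Lemma laurent_inverse h : vanishes_below 0 h -> (exists c, h 0 * c = 1) ->
  exists2 g : laurent R, vanishes_below 0 g & h * g = 1.
Proof.
move=> h0 [c hc].
have [u uE] := strong_recursion (fun s : seq R =>
  c * ((size s == 0%N)%:R - \sum_(i < size s) nth 0 s i * h (size s - i)%N%:Z)).
have gb : exists a, vanishes_below a (fun i : int => if i is Posz d then u d else 0).
  by exists 0 => -[].
exists (Laurent gb); first by case.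
apply: (@laurent_ext _ 0).
- by rewrite -[0]addr0; apply: vbM => // -[].
- exact: vb1.
move=> d.
have g0 : vanishes_below 0 (Laurent gb) by case.
have -> : (0 : int) + d%:Z = 0 + 0 + d%:Z by lia.
have gE (i : nat) : (i < d.+1)%N -> (ltrunc (Laurent gb) 0 d.+1)`_i = u i.
  by move=> id; rewrite coef_poly id.
have hE (i : nat) : (i < d.+1)%N -> (ltrunc h 0 d.+1)`_i = h i%:Z.
  by move=> id; rewrite coef_poly id add0r.
rewrite mulrC (lcoefM g0 h0 (ltnSn d)) !add0r lcoef1 coefM.
under eq_bigr => i _ do rewrite gE ?ltn_ord // hE ?ltnS ?leq_subr //.
rewrite big_ord_recr /= subnn (uE d) size_mkseq.
under [X in _ - X]eq_bigr => i _ do rewrite nth_mkseq //.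
rewrite [c * _]mulrC -mulrA [c * _]mulrC hc mulr1.
by rewrite addrCA subrr addr0; case: d {gE hE}.
Qed.

End LaurentBasics.

Section LaurentMapMorphism.
Variables (R S : comNzRingType) (s : {rmorphism R -> S}).

Lemma vb_lmap a (f : laurent R) : vanishes_below a f -> vanishes_below a (lmap s f).
Proof. by move=> fa i ia /=; rewrite fa ?rmorph0. Qed.

Fact lmap_nmod : nmod_morphism (lmap s).
Proof. by split=> [|x y]; apply: laurentP => i /=; rewrite ?rmorph0 ?rmorphD. Qed.
Fact lmap_monoid : monoid_morphism (lmap s).
Proof.
split=> [|x y]; first by apply: laurentP => i; rewrite /= rmorph_nat.
have [[a xa] [b yb]] := (lcoef_bounded x, lcoef_bounded y).
apply: (@laurent_ext _ (a + b)); first by apply: vb_lmap; apply: vbM.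
  by apply: vbM; apply: vb_lmap.
move=> d; rewrite (lcoefM (vb_lmap xa) (vb_lmap yb) (ltnSn d)).
rewrite [LHS]/= -[lmul_coef _ _ _]/((x * y) _) (lcoefM xa yb (ltnSn d)) -coef_map rmorphM.
have tE f e : map_poly s (ltrunc f e d.+1) = ltrunc (fun i => s (f i)) e d.+1.
  by apply/polyP => i; rewrite coef_map !coef_poly; case: ifP => _ //; exact: (rmorph0 s).
by rewrite /= !tE.
Qed.
HB.instance Definition _ := GRing.isNmodMorphism.Build _ _ (lmap s) lmap_nmod.
HB.instance Definition _ := GRing.isMonoidMorphism.Build _ _ (lmap s) lmap_monoid.

Lemma lmap_lconst c : lmap s (lconst c) = lconst (s c).
Proof. by apply: laurentP => i /=; case: ifP; rewrite ?rmorph0. Qed.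
Lemma lmap_zpow n : lmap s (zpow R n) = zpow S n.
Proof. by apply: laurentP => i /=; rewrite rmorph_nat. Qed.
End LaurentMapMorphism.

Section Order.
Variable F : fieldType.
Implicit Types f g : laurent F.

(** A relation, since 0 has no order; it also carries the leading coefficient, which enters the tame
    symbol. *)
Definition has_order f (n : int) (c : F) := [/\ vanishes_below n f, f n = c & c != 0].

(** The predicate is arbitrary because this also serves over rings, with non-nilpotence in place of
    being nonzero. *)
Lemma least_nonzero (R : comNzRingType) (f : laurent R) (P : pred R) :
  ~~ P 0 -> (exists i, P (f i)) -> exists2 n, P (f n) & forall i, i < n -> ~~ P (f i).
Proof.
move=> P0 [i fi]; have [a fa] := lcoef_bounded f.
have ex : exists d : nat, P (f (a + d%:Z)).
  exists `|i - a|%N; suff -> : a + `|i - a|%N%:Z = i by [].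
  suff : a <= i by lia.
  by rewrite leNgt; apply/negP => /fa E; move: fi; rewrite E (negPf P0).
have [d Pd min_d] := ex_minnP ex; exists (a + d%:Z) => // j jd.
apply/negP => Pj; have ja : a <= j.
  by rewrite leNgt; apply/negP => /fa E; move: Pj; rewrite E (negPf P0).
have jE : j = a + `|j - a|%N%:Z by lia.
by move: Pj; rewrite jE => /min_d; lia.
Qed.

Lemma order_exists f : f != 0 -> exists n c, has_order f n c.
Proof.
move=> f0; have /(@least_nonzero _ f (fun c => c != 0)) [] : exists i, f i != 0.
  apply: contrapT => h; case/eqP: f0; apply: laurentP => i; apply/eqP.
  by apply/negPn/negP => fi; apply: h; exists i.
- by rewrite eqxx.
move=> n fn h; exists n, (f n); split=> // i /h /negPn /eqP //.
Qed.

Lemma has_order_unique f n c m d : has_order f n c -> has_order f m d -> n = m /\ c = d.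
Proof.
case=> fn fnc c0 [fm fmd d0].
have [nm|mn|nm] := ltgtP n m.
- by move: c0; rewrite -fnc fm // eqxx.
- by move: d0; rewrite -fmd fn // eqxx.
by rewrite -fnc -fmd nm.
Qed.

Lemma has_orderM f n c g m d : has_order f n c -> has_order g m d ->
  has_order (f * g) (n + m) (c * d).
Proof.
case=> fn fnc c0 [gm gmd d0]; split; first exact: vbM.
  by rewrite lead_mul // fnc gmd.
by rewrite mulf_neq0.
Qed.

Lemma has_order1 : has_order 1 0 1.
Proof. by split; [apply: vb1 | | rewrite oner_eq0]. Qed.

Lemma has_order_neq0 f n c : has_order f n c -> f != 0.
Proof. by case=> _ fn c0; apply/eqP => f0; rewrite -fn f0 eqxx in c0. Qed.

Lemma order_vb f n c a : has_order f n c -> (vanishes_below a f <-> a <= n).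
Proof.
case=> fn fnc c0; split=> [fa|an]; last exact: vb_le fn.
by rewrite leNgt; apply/negP => /fa E; rewrite -fnc E eqxx in c0.
Qed.

Lemma laurent_mulf_eq0 f g : f * g = 0 -> f = 0 \/ g = 0.
Proof.
move=> fg; have [->|f0] := eqVneq f 0; first by left.
have [->|g0] := eqVneq g 0; first by right.
have [[n [c fo]] [m [d go]]] := (order_exists f0, order_exists g0).
by have := has_order_neq0 (has_orderM fo go); rewrite fg eqxx.
Qed.

End Order.

Lemma order_lmap (K F : fieldType) (s : {rmorphism K -> F}) (f : laurent K) n c :
  has_order f n c -> has_order (lmap s f) n (s c).
Proof.
case=> fn fnc c0; split; first exact: vb_lmap.
  by rewrite /= fnc.
by rewrite fmorph_eq0.
Qed.

(** * Coordinate determinants and reciprocity for commuting operators *)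

Section SeqDet.
Variable F : fieldType.
Local Notation V := {poly F}.
Implicit Types (s p q : seq V) (phi psi : nat -> V -> F).

Definition lin_form (f : V -> F) :=
  (forall P Q, f (P + Q) = f P + f Q) /\ (forall c P, f (c *: P) = c * f P).

Lemma lin_form_sum f (I : Type) (r : seq I) (c : I -> F) (P : I -> V) :
  lin_form f -> f (\sum_(i <- r) c i *: P i) = \sum_(i <- r) c i * f (P i).
Proof.
move=> [fD fZ]; elim: r => [|i r IH]; last by rewrite !big_cons fD fZ IH.
by rewrite !big_nil -(scale0r 0) fZ mul0r.
Qed.

Lemma lin_form_coef i : lin_form (fun P : V => P`_i).
Proof. by split=> *; rewrite ?coefD ?coefZ. Qed.

(** Here {poly F} is only a vector space with basis the monomials: X^j stands for the j-th function
    of a basis. The determinant is a volume of s in the quotient by the common kernel of the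
    forms. *)
Definition seq_det n phi s : F := \det (\matrix_(i < n, j < n) phi j (s`_i)).

Lemma seq_det_mul n phi s e (T : 'M[F]_n) : (forall j, lin_form (phi j)) ->
  (forall i : 'I_n, s`_i = \sum_(j < n) T i j *: e`_j) ->
  seq_det n phi s = \det T * seq_det n phi e.
Proof.
move=> phil sE; rewrite -det_mulmx; congr (\det _); apply/matrixP => i j.
by rewrite !mxE sE lin_form_sum //; apply: eq_bigr => l _; rewrite !mxE.
Qed.

Lemma seq_det_swap phi s1 x y s2 n : n = size (s1 ++ [:: x, y & s2]) ->
  seq_det n phi (s1 ++ [:: x, y & s2]) = - seq_det n phi (s1 ++ [:: y, x & s2]).
Proof.
rewrite size_cat /= => nE.
have i1 : (size s1 < n)%N by rewrite nE; lia.
have i2 : ((size s1).+1 < n)%N by rewrite nE; lia.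
pose j1 := Ordinal i1; pose j2 := Ordinal i2.
have d12 : j1 != j2 by rewrite -val_eqE /=; lia.
rewrite /seq_det; set A := (X in _ = - \det X).
have -> : - \det A = \det (tperm_mx j1 j2 *m A).
  by rewrite det_mulmx det_perm odd_tperm d12 expr1 mulN1r.
rewrite -xrowE; congr (\det _); apply/matrixP => i j; rewrite !mxE; congr (phi _ _).
case: tpermP => [->|->|/eqP n1 /eqP n2].
- by rewrite !nth_cat /= !ltnn subnn ltnNge leqnSn /= subSnn.
- by rewrite !nth_cat /= !ltnn subnn ltnNge leqnSn /= subSnn.
move: n1 n2; rewrite -!val_eqE /= => n1 n2.
rewrite !nth_cat; case: ltnP => // le1.
have -> : (i - size s1)%N = (i - size s1 - 2).+2 by lia.
by [].
Qed.

Lemma seq_det_move phi s1 x q s2 n : n = size (s1 ++ x :: q ++ s2) ->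
  seq_det n phi (s1 ++ x :: q ++ s2) = (-1) ^+ size q * seq_det n phi (s1 ++ q ++ x :: s2).
Proof.
elim: q s1 => [|y q IH] s1 nE; first by rewrite mul1r.
rewrite /= seq_det_swap // -cat_rcons IH; last first.
  by rewrite nE; do 4 rewrite /= ?size_cat ?size_rcons; lia.
by rewrite cat_rcons exprS mulN1r mulNr.
Qed.

Lemma seq_det_cat_swap phi s1 p q s2 n : n = size (s1 ++ p ++ q ++ s2) ->
  seq_det n phi (s1 ++ p ++ q ++ s2) =
  (-1) ^+ (size p * size q) * seq_det n phi (s1 ++ q ++ p ++ s2).
Proof.
elim: p s1 => [|x p IH] s1 nE; first by rewrite mul1r.
rewrite /= -cat_rcons IH; last first.
  by rewrite nE; do 4 rewrite /= ?size_cat ?size_rcons; lia.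
rewrite cat_rcons seq_det_move; last by rewrite nE; do 4 rewrite /= ?size_cat ?size_rcons; lia.
by rewrite mulrA -exprD mulSn addnC.
Qed.

Local Notation mono i := ('X^i : {poly F})%R.

Definition coef_det n s : F := seq_det n (fun j (P : V) => P`_j) s.
Definition monomials (r : nat) : seq V := mkseq (fun j => 'X^j) r.

Lemma poly_monomials n (P : V) : (size P <= n)%N -> P = \sum_(j < n) P`_j *: (monomials n)`_j.
Proof.
move=> Pn; apply/polyP => i; rewrite coef_sum.
under eq_bigr => j _ do rewrite coefZ nth_mkseq // coefXn.
have [ni|ii] := leqP n i.
  rewrite nth_default ?(leq_trans Pn) // big1 // => j _.
  by rewrite (_ : (i == j :> nat) = false) ?mulr0 //; apply/negbTE; have := ltn_ord j; lia.
rewrite (bigD1 (Ordinal ii)) //= eqxx mulr1 big1 ?addr0 // => j.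
by rewrite -val_eqE /= eq_sym => /negPf ->; rewrite mulr0.
Qed.

Lemma seq_det_coef n phi s : (forall j, lin_form (phi j)) ->
  (forall P, P \in s -> (size P <= n)%N) ->
  seq_det n phi s = coef_det n s * seq_det n phi (monomials n).
Proof.
move=> phil sn; apply: seq_det_mul => // i.
have si : (size (s`_i)%R <= n)%N.
  have [is_|si] := ltnP i (size s); first by apply: sn; rewrite mem_nth.
  by rewrite nth_default // size_poly0.
by rewrite [LHS](poly_monomials si); apply: eq_bigr => j _; rewrite !mxE.
Qed.

(* Multiplication by a function with a pole of order a at infinity and leading *)
(* coefficient 1, in coordinates on a basis of functions whose pole orders     *)
(* increase, by steps of 1 from the index r0 on.                               *)
Record graded_op (a r0 : nat) (M : V -> V) : Prop := GradedOp {
  gop_add : forall P Q, M (P + Q) = M P + M Q;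
  gop_scale : forall c P, M (c *: P) = c *: M P;
  gop_monic : forall i, M (mono i) \is monic;
  gop_incr : forall i, (size (M (mono i)) < size (M (mono i.+1)))%N;
  gop_size : forall r, (r0 <= r)%N -> size (M (mono r)) = (r + a).+1 }.

Lemma gop_sum a r0 M (I : Type) (r : seq I) (c : I -> F) (P : I -> V) :
  graded_op a r0 M -> M (\sum_(i <- r) c i *: P i) = \sum_(i <- r) c i *: M (P i).
Proof.
move=> op; elim: r => [|i r IH]; last by rewrite !big_cons (gop_add op) (gop_scale op) IH.
by rewrite !big_nil -(scale0r 0) (gop_scale op) !scale0r.
Qed.

Lemma gop_incr_lt a r0 M i j : graded_op a r0 M -> (i < j)%N ->
  (size (M (mono i)) < size (M (mono j)))%N.
Proof.
move=> op; elim: j => // j IH; rewrite ltnS leq_eqVlt => /orP[/eqP ->|/IH ij].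
  exact: gop_incr op _.
exact: ltn_trans ij (gop_incr op _).
Qed.

Lemma gop_bound a r0 M r (P : V) : graded_op a r0 M -> (r0 <= r)%N -> (size P <= r)%N ->
  (size (M P) <= r + a)%N.
Proof.
move=> op rr Pr; rewrite (poly_monomials Pr) (gop_sum _ _ _ op).
apply: leq_trans (size_sum _ _ _) _; apply/bigmax_leqP => j _.
apply: leq_trans (size_scale_leq _ _) _; rewrite nth_mkseq // -ltnS -(gop_size op rr).
exact: gop_incr_lt op (ltn_ord j).
Qed.

Lemma seq_nth_map0 a r0 M s i : graded_op a r0 M -> (map M s)`_i = M s`_i.
Proof.
move=> op; have [si|is_] := leqP (size s) i; last by rewrite (nth_map 0).
rewrite !nth_default ?size_map //.
by rewrite -[in RHS](scale0r 0) (gop_scale op) scale0r.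
Qed.

(** By linearity of M, the two families differ by the block diagonal matrix made of the identity and
    of the coordinates of s. *)
Lemma coef_det_op a m (al s : seq V) M b r0 : graded_op b r0 M -> size al = a ->
  (forall P, P \in s -> (size P <= m)%N) ->
  coef_det (a + m) (al ++ map M s) = coef_det m s * coef_det (a + m) (al ++ map M (monomials m)).
Proof.
move=> op sal ss.
pose T : 'M[F]_(a + m) := block_mx 1%:M 0 0 (\matrix_(i, j) (s`_i)`_j).
have -> : coef_det m s = \det T by rewrite det_ublock det1 mul1r.
apply: seq_det_mul => [j|i]; first exact: lin_form_coef.
rewrite big_split_ord /=; case: (split_ordP i) => j ->.
  rewrite nth_cat /= sal ltn_ord (bigD1 j) //= block_mxEul mxE eqxx scale1r nth_cat sal ltn_ord.
  rewrite big1 => [|l]; last by rewrite block_mxEul mxE eq_sym => /negPf ->; rewrite scale0r.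
  rewrite big1 ?addr0 // => l _; by rewrite block_mxEur mxE scale0r.
rewrite big1 => [|l _]; last by rewrite block_mxEdl mxE scale0r.
rewrite add0r nth_cat /= sal ltnNge leq_addr /= addKn (seq_nth_map0 _ _ op).
have sj : (size (s`_j)%R <= m)%N.
  have [is_|si] := ltnP j (size s); first by apply: ss; rewrite mem_nth.
  by rewrite nth_default // size_poly0.
rewrite (poly_monomials sj) (gop_sum _ _ _ op); apply: eq_bigr => l _.
by rewrite block_mxEdr mxE nth_cat sal ltnNge leq_addr /= addKn (seq_nth_map0 _ _ op).
Qed.

(** M X^r is monic of degree r + a and all other rows have smaller degree, so the last column has
    the single entry 1. The stable value is the volume of al in the quotient by the image of M. *)
Lemma coef_det_step a r0 M (al : seq V) r : graded_op a r0 M -> size al = a -> (r0 <= r)%N ->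
  (forall P, P \in al -> (size P <= a + r)%N) ->
  coef_det (a + r.+1) (al ++ map M (monomials r.+1)) =
  coef_det (a + r) (al ++ map M (monomials r)).
Proof.
move=> op sal rr sP; rewrite /coef_det /seq_det addnS.
set A := \matrix_(i, j) _.
have lastcol (i : 'I_(a + r).+1) : A i ord_max = (i == ord_max)%:R.
  rewrite mxE nth_cat sal; case: ltnP => ia.
    rewrite nth_default /=; last by apply: sP; rewrite mem_nth // sal.
    by rewrite -val_eqE /= (_ : _ == _ = false) //; apply/negbTE; lia.
  rewrite (seq_nth_map0 _ _ op) nth_mkseq; last by have := ltn_ord i; lia.
  rewrite -val_eqE /=; case: eqP => [->|ne].
    have /monicP := gop_monic op (a + r - a)%N.
    rewrite /lead_coef (_ : (a + r - a)%N = r); last by lia.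
    by rewrite (gop_size op rr) /= addnC.
  rewrite nth_default //; apply: leq_trans (gop_bound op rr _) _.
    by rewrite size_polyXn; have := ltn_ord i; lia.
  by rewrite addnC.
rewrite (expand_det_col A ord_max) (bigD1 ord_max) //= big1 => [|i /negPf ni]; last first.
  by rewrite lastcol ni mul0r.
rewrite addr0 lastcol eqxx mul1r /cofactor addnn -mul2n exprM sqrrN !expr1n mul1r.
congr (\det _); apply/matrixP => i j; rewrite !mxE !lift_max.
rewrite !nth_cat sal; case: ifP => // /negbT; rewrite -leqNgt => ia.
have ir : (i < a + r)%N := ltn_ord i.
have ja : (i - a < r)%N by rewrite ltn_subLR.
by rewrite !(seq_nth_map0 _ _ op) !nth_mkseq // ltnW.
Qed.

Lemma coef_det_stable a r0 M (al : seq V) r t : graded_op a r0 M -> size al = a -> (r0 <= r)%N ->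
  (forall P, P \in al -> (size P <= a + r)%N) ->
  coef_det (a + (r + t)) (al ++ map M (monomials (r + t))) =
  coef_det (a + r) (al ++ map M (monomials r)).
Proof.
move=> op sal rr sP; elim: t => [|t IH]; first by rewrite addn0.
rewrite addnS (coef_det_step op) ?IH //; first by rewrite (leq_trans rr) ?leq_addr.
by move=> P /sP; lia.
Qed.

Section Quotient.
Variables (n r a r0 : nat) (M : V -> V) (phi : nat -> V -> F).
Hypotheses (op : graded_op a r0 M) (phil : forall j, lin_form (phi j)).
Hypothesis phiM : forall j P, (j < n)%N -> phi j (M P) = 0.

(** Completes phi by reading off the leading coefficients of the images M X^i. On X followed by
    these images the matrix is block triangular, with a unitriangular second diagonal block. *)
Let ext j (P : V) := if (j < n)%N then phi j P else P`_(size (M (mono (j - n)))).-1.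

(* The right factor does not depend on X, which makes coordinate determinants  *)
(* modulo the image of M comparable with determinants of linear forms that     *)
(* vanish on this image.                                                       *)
Lemma seq_det_quotient (X : seq V) : size X = n ->
  (forall P, P \in X ++ map M (monomials r) -> (size P <= n + r)%N) ->
  seq_det n phi X = coef_det (n + r) (X ++ map M (monomials r)) *
    seq_det (n + r) ext (monomials (n + r)).
Proof.
move=> sX sP.
have extl j : lin_form (ext j).
  by rewrite /ext; case: (j < n)%N; [apply: phil | apply: lin_form_coef].
rewrite -(seq_det_coef extl sP) /seq_det.
pose A : 'M[F]_n := \matrix_(i, j) phi j X`_i.
pose B : 'M[F]_(n + r) := \matrix_(i, j) ext j (X ++ map M (monomials r))`_i.
rewrite -/A -/B.
have phi0 j : phi j 0 = 0 by rewrite -(scale0r 0) (phil j).2 mul0r.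
have -> : B = block_mx A (ursubmx B) 0 (drsubmx B).
  rewrite -[LHS](submxK B); congr (block_mx _ _ _ _); apply/matrixP => i j; rewrite !mxE.
    by rewrite nth_cat sX /= ltn_ord /ext ltn_ord.
  rewrite nth_cat sX /= ltnNge leq_addr /= addKn /ext ltn_ord (seq_nth_map0 _ _ op).
  exact: phiM.
rewrite det_ublock [Y in _ * Y]det_trig; last first.
  apply/is_trig_mxP => i j ij; rewrite !mxE nth_cat sX /= ltnNge leq_addr /= addKn.
  rewrite /ext ltnNge leq_addr /= addKn (seq_nth_map0 _ _ op) nth_mkseq //.
  have h := gop_incr_lt op ij; by rewrite nth_default // -ltnS (ltn_predK h).
rewrite big1 ?mulr1 // => i _; rewrite !mxE nth_cat sX /= ltnNge leq_addr /= addKn.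
rewrite /ext ltnNge leq_addr /= addKn (seq_nth_map0 _ _ op) nth_mkseq //.
exact/eqP/(gop_monic op).
Qed.
End Quotient.

Lemma seq_size_bound (s : seq V) : exists d, forall P, P \in s -> (size P <= d)%N.
Proof.
exists (\max_(P <- s) size P) => P Ps.
by rewrite (big_rem P Ps) /= leq_maxl.
Qed.

(** If n > a, the n + r vectors all have degree less than a + r, so their coordinate matrix has a
    zero column. Thus the image of M has codimension at most a. *)
Lemma quotient_dim_le n a r0 M phi (X : seq V) : graded_op a r0 M -> (forall j, lin_form (phi j)) ->
  (forall j P, (j < n)%N -> phi j (M P) = 0) -> size X = n ->
  seq_det n phi X != 0 -> (n <= a)%N.
Proof.
move=> op phil phiM sX; apply: contraNT; rewrite -ltnNge => an.
have [d sd] := seq_size_bound X.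
pose r := (r0 + d)%N.
have sP P : P \in X ++ map M (monomials r) -> (size P <= a + r)%N.
  rewrite mem_cat => /orP[/sd|/mapP [Q]]; first by rewrite /r; lia.
  move=> /(nthP 0) [i]; rewrite size_mkseq => ir <- ->; rewrite nth_mkseq // addnC.
  by apply: (gop_bound op); rewrite ?size_polyXn ?leq_addr.
rewrite (@seq_det_quotient n r a r0 M phi op) //; last by move=> P /sP; lia.
have nr : ((n + r).-1 < n + r)%N by lia.
rewrite /coef_det /seq_det (expand_det_col _ (Ordinal nr)) big1 ?mul0r // => i _.
rewrite mxE nth_default ?mul0r //=.
set s := X ++ _ in sP *; have [is_|si] := ltnP i (size s).
  by apply: leq_trans (sP _ (mem_nth 0 is_)) _; lia.
by rewrite (nth_default _ si) size_poly0.
Qed.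

(** A monic polynomial of degree r has under M an image that is monic of the same degree as M
    X^r. *)
Lemma gop_comp a b r0 M N : graded_op a r0 M -> graded_op b r0 N -> graded_op (b + a) r0 (M \o N).
Proof.
move=> oM oN.
have key (P : V) r : P \is monic -> size P = r.+1 -> M P \is monic /\ size (M P) = size (M (mono r)).
  move=> Pm sP.
  have PE : P = \sum_(i < r) P`_i *: 'X^i + 'X^r.
    rewrite {1}(poly_monomials (eq_leq sP)) big_ord_recr /=.
    rewrite (_ : P`_r = 1); last by move/monicP: Pm; rewrite /lead_coef sP.
    rewrite scale1r nth_mkseq //; congr (_ + _); apply: eq_bigr => i _.
    by rewrite nth_mkseq // ltnS ltnW.
  have small : (size (M (\sum_(i < r) P`_i *: 'X^i)%R) < size (M (mono r)))%N.
    rewrite (gop_sum _ _ _ oM); apply: leq_ltn_trans (size_sum _ _ _) _.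
    have pos : (0 < size (M (mono r)))%N.
      by rewrite size_poly_gt0 monic_neq0 // (gop_monic oM).
    rewrite -(ltn_predK pos) ltnS; apply/bigmax_leqP => j _.
    apply: leq_trans (size_scale_leq _ _) _; have := gop_incr_lt oM (ltn_ord j); lia.
  rewrite PE (gop_add oM) addrC; split; last by rewrite size_polyDl.
  by rewrite monicE lead_coefDl //; apply: (gop_monic oM).
have keyN i : size (N (mono i)) = (size (N (mono i))).-1.+1.
  by rewrite prednK // size_poly_gt0 monic_neq0 // (gop_monic oN).
split=> [P Q|c P|i|i|r rr] /=.
- by rewrite (gop_add oN) (gop_add oM).
- by rewrite (gop_scale oN) (gop_scale oM).
- exact: (key _ _ (gop_monic oN i) (keyN i)).1.
- rewrite (key _ _ (gop_monic oN i) (keyN i)).2 (key _ _ (gop_monic oN i.+1) (keyN i.+1)).2.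
  by apply: (gop_incr_lt oM); have := gop_incr oN i; have := keyN i; lia.
rewrite (key _ _ (gop_monic oN r) (keyN r)).2 (gop_size oN rr) /=.
by rewrite (gop_size oM) ?addnA // (leq_trans rr) ?leq_addr.
Qed.

(* Both determinants are, up to a common factor, the product of the volume of  *)
(* al in V/fV by that of be in V/gV, since V/fgV is an extension of V/fV by    *)
(* V/gV in two ways.                                                           *)
Lemma seq_det_reciprocity a b r0 f g phi (al be : seq V) :
  graded_op a r0 f -> graded_op b r0 g -> (forall P, f (g P) = g (f P)) ->
  (forall j, lin_form (phi j)) -> (forall j P, (j < a + b)%N -> phi j (f (g P)) = 0) ->
  size al = a -> size be = b ->
  seq_det (a + b) phi (al ++ map f be) = seq_det (a + b) phi (be ++ map g al).
Proof.
move=> opf opg fgC phil phi0 sal sbe.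
have [d sd] := seq_size_bound (al ++ be).
pose r := (r0 + d)%N; have rr : (r0 <= r)%N by rewrite leq_addr.
have ald P : P \in al -> (size P <= d)%N by move=> Pa; apply: sd; rewrite mem_cat Pa.
have bed P : P \in be -> (size P <= d)%N by move=> Pa; apply: sd; rewrite mem_cat Pa orbT.
have opfg : graded_op (b + a) r0 (f \o g) by apply: gop_comp.
have mon c (h : V -> V) : graded_op c r0 h -> forall P, P \in map h (monomials r) -> (size P <= r + c)%N.
  move=> oph P /mapP [Q /(nthP 0) [i]]; rewrite size_mkseq => ir <- ->; rewrite nth_mkseq //.
  by apply: (gop_bound oph); rewrite ?size_polyXn.
have bd c (h : V -> V) (P : V) : graded_op c r0 h -> (size P <= d)%N -> (size (h P) <= r + c)%N.
  by move=> oph Pd; apply: (gop_bound oph) => //; rewrite /r; lia.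
have T : map g (map f (monomials r)) = map f (map g (monomials r)).
  by rewrite -!map_comp; apply: eq_map => P /=; rewrite fgC.
(* All that follows al is an image under f: the volume of be followed by g of the monomials comes
   out by [coef_det_op], and the remaining factor no longer depends on the number of monomials. *)
have volX : coef_det (a + b + r) ((al ++ map f be) ++ map (f \o g) (monomials r)) =
    coef_det (b + r) (be ++ map g (monomials r)) * coef_det (a + r) (al ++ map f (monomials r)).
  rewrite map_comp -catA -map_cat -addnA (coef_det_op opf) //; last first.
    move=> P; rewrite mem_cat => /orP[/bed|]; first by rewrite /r; lia.
    by rewrite addnC; apply: mon opg P.
  congr (_ * _); rewrite [(b + r)%N]addnC; apply: (coef_det_stable _ opf) => //.
  by move=> P /ald; rewrite /r; lia.
have volY : coef_det (a + b + r) ((be ++ map g al) ++ map (f \o g) (monomials r)) =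
    coef_det (a + r) (al ++ map f (monomials r)) * coef_det (b + r) (be ++ map g (monomials r)).
  rewrite map_comp -T -catA -map_cat [(a + b)%N]addnC -addnA (coef_det_op opg) //; last first.
    move=> P; rewrite mem_cat => /orP[/ald|]; first by rewrite /r; lia.
    by rewrite addnC; apply: mon opf P.
  congr (_ * _); rewrite [(a + r)%N]addnC; apply: (coef_det_stable _ opg) => //.
  by move=> P /bed; rewrite /r; lia.
rewrite (seq_det_quotient opfg phil phi0 (X := al ++ map f be) (r := r)).
- rewrite (seq_det_quotient opfg phil phi0 (X := be ++ map g al) (r := r)).
  + by rewrite volX volY [in RHS](mulrC (coef_det (a + r) _)).
  + by rewrite size_cat size_map sal sbe addnC.
  move=> P; rewrite !mem_cat => /orP[/orP[/bed|/mapP [Q /ald Qd ->]]|].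
  + by rewrite /r; lia.
  + by apply: leq_trans (bd _ _ _ opg Qd) _; lia.
  + by move/(mon _ _ opfg)/leq_trans; apply; lia.
- by rewrite size_cat size_map sal sbe.
move=> P; rewrite !mem_cat => /orP[/orP[/ald|/mapP [Q /bed Qd ->]]|].
+ by rewrite /r; lia.
+ by apply: leq_trans (bd _ _ _ opf Qd) _; lia.
+ by move/(mon _ _ opfg)/leq_trans; apply; lia.
Qed.

End SeqDet.

(** * Orders at closed points and weak approximation *)

Section LocalTheory.
Variables (k : finFieldType) (C : curve k).
Local Notation K := (function_field C).
Variable iota : forall p : closed_point C, {rmorphism K -> laurent (residue_field p)}.
Hypothesis iotaP : forall p : closed_point C, laurent_expansion (iota p).
Implicit Types (p q : closed_point C) (ps qs : seq (closed_point C)) (f g h x y z : K).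

(** A lower bound on the order at p that also makes sense for 0. *)
Definition vge p (n : int) f : Prop := vanishes_below n (iota p f).

Lemma vge_le p m n f : m <= n -> vge p n f -> vge p m f.
Proof. exact: vb_le. Qed.
Lemma vge_0 p n : vge p n 0.
Proof. by rewrite /vge rmorph0. Qed.
Lemma vge_1 p : vge p 0 1.
Proof. by rewrite /vge rmorph1; apply: vb1. Qed.
Lemma vgeD p n f g : vge p n f -> vge p n g -> vge p n (f + g).
Proof. by rewrite /vge rmorphD; apply: vbD. Qed.
Lemma vgeB p n f g : vge p n f -> vge p n g -> vge p n (f - g).
Proof. by rewrite /vge rmorphB; apply: vbB. Qed.
Lemma vge_sum p n (I : Type) (r : seq I) (P : pred I) (G : I -> K) :
  (forall i, P i -> vge p n (G i)) -> vge p n (\sum_(i <- r | P i) G i).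
Proof. by rewrite /vge rmorph_sum; apply: vb_sum. Qed.
Lemma vge_const p c : vge p 0 (constants C c).
Proof. by rewrite /vge; case: (iotaP p) => -> _ _ _; apply: vb_lconst. Qed.
Lemma vgeM p m n f g : vge p m f -> vge p n g -> vge p (m + n) (f * g).
Proof. by rewrite /vge rmorphM; apply: vbM. Qed.
Lemma vgeMl p n f g : vge p 0 f -> vge p n g -> vge p n (f * g).
Proof. by move=> f0 gn; rewrite -[n]add0r; apply: vgeM. Qed.
Lemma vgeX p n f (j : nat) : vge p n f -> vge p (n * j%:Z) (f ^+ j).
Proof. by rewrite /vge rmorphXn; apply: vbX. Qed.
Lemma vgeX0 p f (j : nat) : vge p 0 f -> vge p 0 (f ^+ j).
Proof. by move=> f0; rewrite -(mul0r j%:Z); apply: vgeX. Qed.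
Lemma vge_poly p (c : {poly k}) f : vge p 0 f -> vge p 0 (map_poly (constants C) c).[f].
Proof.
move=> f0; rewrite horner_coef; apply: vge_sum => i _; rewrite coef_map.
by apply: vgeMl; [apply: vge_const | apply: vgeX0].
Qed.
Lemma vge_bounded p f : exists n : nat, vge p (- n%:Z) f.
Proof.
have [a fa] := lcoef_bounded (iota p f); exists `|a|%N.
by apply: (vb_le _ fa); lia.
Qed.

Definition ord p f : int := xget 0 [set n | exists c, has_order (iota p f) n c].

Lemma ordP p f : f != 0 -> exists c, has_order (iota p f) (ord p f) c.
Proof.
move=> f0; have /order_exists [n [c fo]] : iota p f != 0.
  apply/eqP => /(congr1 (fun u => u * iota p f^-1)).
  by rewrite mul0r -rmorphM divff // rmorph1 => /eqP; rewrite oner_eq0.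
by rewrite /ord; case: xgetP => [m _ //|/(_ n)]; case; exists c.
Qed.

Lemma ord_eq p f n c : has_order (iota p f) n c -> ord p f = n.
Proof.
move=> fo; have [|d fo'] := @ordP p f; last by have [-> _] := has_order_unique fo fo'.
by apply/eqP => f0; have := has_order_neq0 fo; rewrite f0 rmorph0 eqxx.
Qed.

Lemma vgeE p n f : f != 0 -> vge p n f <-> n <= ord p f.
Proof. by case/(ordP p) => c fo; apply: order_vb fo. Qed.

Lemma ordM p f g : f != 0 -> g != 0 -> ord p (f * g) = ord p f + ord p g.
Proof.
move=> /(ordP p) [c fo] /(ordP p) [d go]; apply: (@ord_eq _ _ _ (c * d)).
by rewrite rmorphM; apply: has_orderM.
Qed.
Lemma ord1 p : ord p 1 = 0.
Proof. by apply: (@ord_eq _ _ _ 1); rewrite rmorph1; apply: has_order1. Qed.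
Lemma ordV p f : f != 0 -> ord p f^-1 = - ord p f.
Proof.
move=> f0; have := @ordM p f f^-1 f0; rewrite invr_eq0 f0 divff // ord1 => /(_ isT).
by lia.
Qed.
Lemma ordX p f (j : nat) : f != 0 -> ord p (f ^+ j) = ord p f * j%:Z.
Proof.
move=> f0; elim: j => [|j IH]; first by rewrite mulr0 ord1.
by rewrite exprS ordM ?expf_neq0 // IH; lia.
Qed.

Lemma vge_neg p f : ~ vge p 0 f -> f != 0 /\ ord p f < 0.
Proof.
move=> nf; have f0 : f != 0 by apply/eqP => f0; apply: nf; rewrite f0; apply: vge_0.
by split=> //; rewrite ltNge; apply/negP => h; apply: nf; apply/vgeE.
Qed.

(** The definition of an expansion gives one direction. Conversely, if f is not in the valuation
    ring, its inverse is in the maximal ideal and vanishes at p, so 1 would vanish as well were f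
    regular. *)
Lemma local_ringE p f : local_ring p f <-> vge p 0 f.
Proof.
have [_ i2 _ _] := iotaP p; split=> [/i2 [] //|f0].
apply: contrapT => nf.
have [kO [v [_ vM _ OE]]] := nonsingular p.
have fn0 : f != 0 by apply/eqP => e; apply: nf; rewrite OE; left.
have fi0 : f^-1 != 0 by rewrite invr_eq0.
have v1 : v 1 = 0 by have := vM 1 1 (oner_neq0 _) (oner_neq0 _); rewrite mulr1; lia.
have vi : v f + v f^-1 = 0 by rewrite -vM // divff.
have vf : v f < 0.
  by rewrite ltNge; apply/negP => ge; apply: nf; rewrite OE; right.
have fiO : local_ring p f^-1 by rewrite OE; right; lia.
have [_ _ _ _ rz] := residueP p.
have /(rz _ fiO) r0 : max_ideal (local_ring p) f^-1.
  by split=> //; right; rewrite invrK.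
have fi1 : vge p 1 f^-1.
  have [a b] := i2 _ fiO; move=> i i1; have [/a //|] := ltP i 0.
  by move=> i0; rewrite (_ : i = 0) ?b //; lia.
have := vgeM f0 fi1; rewrite divff // => /(_ 0); rewrite rmorph1 lcoef1 eqxx => /(_ isT).
by move/eqP; rewrite oner_eq0.
Qed.

Lemma residue_iota p f : vge p 0 f -> iota p f 0 = residue p f.
Proof. by move=> /local_ringE; have [_ i2 _ _] := iotaP p => /i2 []. Qed.

Lemma max_ideal_vge p f : max_ideal (local_ring p) f -> vge p 1 f.
Proof.
move=> mf; have fO := mf.1; have [_ _ _ _ rz] := residueP p.
have r0 := (rz _ fO).2 mf; have f0 := (local_ringE p f).1 fO.
move=> i i1; have [/f0 //|i0] := ltP i 0.
by rewrite (_ : i = 0) ?residue_iota //; lia.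
Qed.

Lemma iota_dense p (n : nat) (h : laurent (residue_field p)) : vanishes_below 0 h ->
  exists2 f, vge p 0 f & vanishes_below n%:Z (iota p f - h).
Proof.
have [_ _ _ i4] := iotaP p => h0; have [f fO fh] := i4 n h h0.
by exists f => //; apply/local_ringE.
Qed.

Lemma uniformizer p : exists t, has_order (iota p t) 1 1.
Proof.
have z0 : vanishes_below 0 (zpow (residue_field p) 1).
  by apply: (@vb_le _ 0 1) => //; apply: vb_zpow.
have [t t0 tz] := iota_dense 2 z0; exists t.
have E i : i < 2 -> iota p t i = (i == 1)%:R.
  by move=> /tz /eqP; rewrite lcoefB subr_eq0 => /eqP ->.
split; rewrite ?oner_eq0 ?E //.
by move=> i i1; rewrite E ?lt_eqF //; lia.
Qed.

Lemma local_ring_proper p : local_ring p <> setT.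
Proof.
have [t to] := uniformizer p; move=> E.
have t0 : t != 0.
  by apply/eqP => t0; have := has_order_neq0 to; rewrite t0 rmorph0 eqxx.
have : local_ring p t^-1 by rewrite E.
move=> /local_ringE /vgeE; rewrite invr_eq0 t0 => /(_ isT).
by rewrite ordV // (ord_eq to).
Qed.

Lemma local_ring_valuation p : valuation_ring (constants C) (local_ring p).
Proof.
split; first by have [] := nonsingular p.
move=> x; have [->|x0] := eqVneq x 0.
  by left; apply/local_ringE; apply: vge_0.
have [h|h] := leP 0 (ord p x); first by left; apply/local_ringE/vgeE.
by right; apply/local_ringE/vgeE; rewrite ?invr_eq0 // ordV //; lia.
Qed.

(** The ring at q would dominate the ring at p as well as itself, and a valuation ring has only one
    centre. If some x in the maximal ideal at p were invertible at q, then y = x^-n (x^n y) would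
    put all of K in the ring at q. *)
Lemma local_ring_incomparable p q : (forall f, vge p 0 f -> vge q 0 f) -> p = q.
Proof.
move=> pq; have [u [_ uu]] := complete_separated (local_ring_valuation q) (@local_ring_proper q).
have {}uu r : dominates (local_ring q) (local_ring r) -> r = u by move=> /uu ->.
rewrite [RHS]uu; last by split.
apply: uu; split=> [f /local_ringE /pq /local_ringE //|x mx].
have xO := (local_ringE q x).2 (pq _ ((local_ringE p x).1 mx.1)).
split=> //; have [->|x0] := eqVneq x 0; first by left.
right => xi; apply: (@local_ring_proper q); apply/seteqP; split=> // y _.
have [n yn] := vge_bounded p y.
have -> : y = x^-1 ^+ n * (x ^+ n * y).
  by rewrite mulrA -exprMn mulVf // expr1n mul1r.
apply/local_ringE; apply: vgeMl; first by apply: vgeX0; apply/local_ringE.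
apply: pq; rewrite (_ : 0 = n%:Z + - n%:Z); last by lia.
by apply: vgeM => //; rewrite -[n%:Z]mul1r; apply: vgeX; apply: max_ideal_vge.
Qed.

Lemma separate_two p q : p != q -> exists z, [/\ z != 0, vge p 1 z & ~ vge q 0 z].
Proof.
move=> pq.
have key u v : u != v -> exists2 f, vge u 0 f & ~ vge v 0 f.
  move=> uv; apply: contrapT => h; case/eqP: uv; apply: local_ring_incomparable => f uf.
  by apply: contrapT => vf; apply: h; exists f.
have qp : q != p by rewrite eq_sym.
have [[a pa qa] [b qb pb]] := (key _ _ pq, key _ _ qp).
have [[a0 ao] [b0 bo]] := (vge_neg qa, vge_neg pb).
have ab0 : a / b != 0 by rewrite mulf_neq0 ?invr_eq0.
exists (a / b); split=> //.
  by apply/vgeE => //; move/vgeE: pa => /(_ a0); rewrite ordM ?invr_eq0 ?ordV //; lia.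
by move/vgeE => /(_ ab0); move/vgeE: qb => /(_ b0); rewrite ordM ?invr_eq0 ?ordV //; lia.
Qed.

Lemma vge_seq_bounded (ps : seq (closed_point C)) y :
  exists n : nat, forall p, p \in ps -> vge p (- n%:Z) y.
Proof.
elim: ps => [|p ps [n hn]]; first by exists 0%N.
have [m hm] := vge_bounded p y; exists (maxn m n) => q; rewrite inE => /orP[/eqP ->|/hn].
  by apply: vge_le hm; lia.
by apply: vge_le; lia.
Qed.

Lemma separate p qs : p \notin qs ->
  exists z, [/\ z != 0, vge p 1 z & forall q, q \in qs -> ~ vge q 0 z].
Proof.
elim: qs => [|q qs IH].
  have [t to] := uniformizer p; exists t; split=> //; last by case: to.
  by apply/eqP => t0; have := has_order_neq0 to; rewrite t0 rmorph0 eqxx.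
rewrite inE negb_or => /andP[pq /IH [z [z0 pz qz]]].
have [z' [z'0 pz' qz']] := separate_two pq.
have [n hn] := vge_seq_bounded (q :: qs) z'.
(* The exponent exceeds the pole orders of z', so the power of z dominates wherever z has a pole;
   among the points at hand, z can only be regular at q, where z' has a pole. *)
pose w := z' + z ^+ n.+1.
have qw r : r \in q :: qs -> ~ vge r 0 w.
  move=> rqs rw; have [rz|/vge_neg [_ rz]] := pselect (vge r 0 z).
    have rq : r = q.
      by move: rqs; rewrite inE => /orP[/eqP //|/qz].
    have z'E : z' = w - z ^+ n.+1 by rewrite addrK.
    apply: qz'; rewrite -rq z'E.
    by apply: vgeB => //; apply: vgeX0.
  have : vge r (- n%:Z) (z ^+ n.+1).
    rewrite (_ : z ^+ n.+1 = w - z'); last by rewrite /w addrC addKr.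
    by apply: vgeB; [apply: vge_le rw; lia | apply: hn].
  move/vgeE; rewrite expf_neq0 // => /(_ isT); rewrite ordX //; nia.
exists w; split=> //.
- by apply/eqP => w0; apply: (qw q); rewrite ?mem_head // w0; apply: vge_0.
- apply: vgeD => //; rewrite exprS -[1]addr0; apply: vgeM => //.
  by apply: vgeX0; apply: vge_le pz.
Qed.

(** The function 1 / (1 + z^(n+1)), with z given by [separate], is close to 1 where z vanishes and
    close to 0 at the poles of z. *)
Lemma local_idempotent p qs (n : nat) : p \notin qs ->
  exists e, vge p n%:Z (e - 1) /\ forall q, q \in qs -> vge q n%:Z e.
Proof.
move=> /separate [z [z0 pz qz]]; pose u := 1 + z ^+ n.+1.
have zn : vge p n.+1%:Z (z ^+ n.+1) by rewrite -[n.+1%:Z]mul1r; apply: vgeX.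
have uo : has_order (iota p u) 0 1.
  rewrite /u rmorphD rmorph1; split; rewrite ?oner_eq0 //.
    by apply: vbD; [apply: vb1 | apply: vb_le zn].
  by rewrite lcoefD lcoef1 zn ?addr0.
have u0 : u != 0 by apply/eqP => u0; have := has_order_neq0 uo; rewrite u0 rmorph0 eqxx.
exists u^-1; split.
  have -> : u^-1 - 1 = - (u^-1 * z ^+ n.+1).
    by apply: (mulfI u0); rewrite mulrBr mulrN mulrA divff // mulr1 mul1r /u opprD addNKr.
  rewrite -sub0r; apply: vgeB; first exact: vge_0.
  apply: vgeMl; last by apply: vge_le zn; lia.
  by apply/vgeE; rewrite ?invr_eq0 // ordV // (ord_eq uo).
move=> q qqs; apply/vgeE; rewrite ?invr_eq0 // ordV //.
have [_ oz] := vge_neg (qz _ qqs).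
suff : ord q u <= - n%:Z by lia.
rewrite leNgt; apply/negP => lt.
have : vge q (- n%:Z) (z ^+ n.+1).
  rewrite (_ : z ^+ n.+1 = u - 1); last by rewrite /u addrC addKr.
  apply: vgeB; last by apply: vge_le (vge_1 q); lia.
  by apply/vgeE => //; lia.
by move/vgeE; rewrite expf_neq0 // => /(_ isT); rewrite ordX //; nia.
Qed.

(** The targets are added with approximate idempotents as weights, taken to precision n + N to
    absorb poles of order N of the targets. *)
Lemma weak_approximation ps (n : nat) (y : closed_point C -> K) : uniq ps ->
  exists h, forall p, p \in ps -> vge p n%:Z (h - y p).
Proof.
move=> ups.
have [N hN] : exists N : nat, forall p q, p \in ps -> q \in ps -> vge q (- N%:Z) (y p).
  elim: {1}ps => [|p ps' [N hN]]; first by exists 0%N.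
  have [m hm] := vge_seq_bounded ps (y p); exists (maxn m N) => p' q.
  rewrite inE => /orP[/eqP -> /hm|p'ps' qps].
    by apply: vge_le; lia.
  by apply: vge_le (hN _ _ p'ps' qps); lia.
have /choice [e eP] p : exists e, p \in ps ->
    vge p (n + N)%N%:Z (e - 1) /\ forall q, q \in rem p ps -> vge q (n + N)%N%:Z e.
  have [pps|pps] := boolP (p \in ps); last by exists 0.
  have [|e he] := @local_idempotent p (rem p ps) (n + N); first by rewrite mem_rem_uniq // inE eqxx.
  by exists e.
exists (\sum_(q <- ps) e q * y q) => p pps.
rewrite (bigD1_seq p) //=.
have -> : e p * y p + \sum_(i <- ps | i != p) e i * y i - y p =
    (e p - 1) * y p + \sum_(i <- ps | i != p) e i * y i.
  by rewrite mulrBl mul1r addrAC.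
have E : n%:Z = (n + N)%N%:Z + - N%:Z by lia.
apply: vgeD.
  by rewrite E; apply: vgeM; [apply: (eP p pps).1 | apply: hN].
rewrite big_seq_cond; apply: vge_sum => q /andP[qps qp].
rewrite E; apply: vgeM; last exact: hN.
by apply: (eP q qps).2; rewrite mem_rem_uniq // inE eq_sym qp.
Qed.

Lemma prescribe ps (n : nat) (H : forall p, laurent (residue_field p)) : uniq ps ->
  (forall p, p \in ps -> vanishes_below 0 (H p)) ->
  exists h, forall p, p \in ps -> vanishes_below n%:Z (iota p h - H p).
Proof.
move=> ups H0.
have /choice [y yP] p : exists y, p \in ps -> vanishes_below n%:Z (iota p y - H p).
  have [pps|_] := boolP (p \in ps); last by exists 0.
  by have [f _ fH] := iota_dense n (H0 _ pps); exists f.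
have [h hP] := weak_approximation n y ups; exists h => p pps.
have -> : iota p h - H p = iota p (h - y p) + (iota p (y p) - H p).
  by rewrite rmorphB addrA subrK.
by apply: vbD; [apply: hP | apply: yP].
Qed.

End LocalTheory.

(** * Poles of functions *)

Section FunctionField.
Variables (k : finFieldType) (K : fieldType) (s : {rmorphism k -> K}).
Hypothesis K1 : one_variable_function_field s.

Definition peval (c : {poly k}) (h : K) : K := (map_poly s c).[h].

Lemma pevalB c d h : peval (c - d) h = peval c h - peval d h.
Proof. by rewrite /peval rmorphB hornerD hornerN. Qed.
Lemma pevalM c d h : peval (c * d) h = peval c h * peval d h.
Proof. by rewrite /peval rmorphM hornerM. Qed.
Lemma peval1 h : peval 1 h = 1.
Proof. by rewrite /peval rmorph1 hornerC. Qed.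
Lemma pevalX h : peval 'X h = h.
Proof. by rewrite /peval map_polyX hornerX. Qed.
Lemma pevalC c h : peval c%:P h = s c.
Proof. by rewrite /peval map_polyC hornerC. Qed.
Lemma pevalXn c h n : peval (c ^+ n) h = peval c h ^+ n.
Proof. by rewrite /peval rmorphXn horner_exp. Qed.
Lemma peval_sum (I : Type) (r : seq I) (P : pred I) (c : I -> {poly k}) h :
  peval (\sum_(i <- r | P i) c i) h = \sum_(i <- r | P i) peval (c i) h.
Proof. by rewrite /peval rmorph_sum horner_sum. Qed.
Lemma pevalE (c : {poly k}) h n : (size c <= n)%N -> peval c h = \sum_(i < n) s c`_i * h ^+ i.
Proof.
move=> cn; rewrite /peval (@horner_coef_wide _ n) ?(leq_trans (size_poly _ _)) //.
by apply: eq_bigr => i _; rewrite coef_map.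
Qed.

Definition transcendental h := forall c : {poly k}, c != 0 -> peval c h != 0.

(** For h transcendental this is linear independence over k(h), denominators being cleared. *)
Definition independent_over h (I : finType) (y : I -> K) :=
  forall c : I -> {poly k}, \sum_i peval (c i) h * y i = 0 -> forall i, c i = 0.

Lemma common_denominator (x : K) n (e : 'I_n -> K) :
  (forall q : {poly k}, q != 0 -> peval q x != 0) ->
  (forall y : K, exists (a b : 'I_n -> {poly k}), (forall i, b i != 0) /\
      y = \sum_i peval (a i) x / peval (b i) x * e i) ->
  forall (m : nat) (z : 'I_m -> K), exists (D : {poly k}) (A : 'I_m -> 'I_n -> {poly k}),
    D != 0 /\ forall j, peval D x * z j = \sum_i peval (A j i) x * e i.
Proof.
move=> xt sp m z.
have /choice [Aj Aj_] : forall j, exists Dj : {poly k} * ('I_n -> {poly k}),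
    Dj.1 != 0 /\ peval Dj.1 x * z j = \sum_i peval (Dj.2 i) x * e i.
  move=> j; have [a [b [b0 zE]]] := sp (z j).
  exists (\prod_i b i, fun i => a i * \prod_(l | l != i) b l); split.
    by apply/prodf_neq0 => i _.
  rewrite zE mulr_sumr; apply: eq_bigr => i _ /=.
  rewrite (bigD1 i) //= !pevalM mulrA; congr (_ * _).
  by rewrite mulrC mulrA divfK ?xt.
exists (\prod_j (Aj j).1), (fun j i => (\prod_(l | l != j) (Aj l).1) * (Aj j).2 i); split.
  by apply/prodf_neq0 => j _; case: (Aj_ j).
move=> j; rewrite (bigD1 j) //= pevalM mulrC mulrA [z j * _]mulrC (Aj_ j).2 mulr_suml.
by apply: eq_bigr => i _; rewrite pevalM mulrAC [_ * peval _ x]mulrC.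
Qed.

Lemma ex_size_bound (I J : finType) (A : I -> J -> {poly k}) :
  exists S, forall i j, (size (A i j) <= S)%N.
Proof.
exists (\max_i \max_j size (A i j)) => i j.
apply: leq_trans (leq_bigmax (F := fun i => \max_j size (A i j)) i).
exact: (leq_bigmax (F := fun j => size (A i j)) j).
Qed.

(** By counting: the combinations of the y j with coefficients polynomials in h of degree less than
    M become, after multiplication by a fixed function, combinations of the e i with coefficients
    polynomials in x whose degree grows linearly in M. *)
Lemma finite_degree h : transcendental h ->
  exists n, forall (I : finType) (y : I -> K), independent_over h y -> (#|I| <= n)%N.
Proof.
move=> ht; have [x [xt [n [e sp]]]] := K1.
have [D [A [D0 hE]]] := common_denominator xt sp (fun l : 'I_n => h * e l).
have [S1 hS1] := ex_size_bound A.
pose S := maxn S1 (size D).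
have AS i j : (size (A i j) <= S)%N by apply: leq_trans (hS1 i j) _; rewrite leq_maxl.
have DS : (size D <= S)%N by rewrite leq_maxr.
exists (n * S)%N => I y yind.
have [b [p [b0 pE]]] := common_denominator xt sp (fun j : 'I_#|I| => y (enum_val j)).
have [T hT] := ex_size_bound p.
(* Each multiplication by D h raises the degrees of the coordinates by at most S. *)
have powE u (j : I) : exists Q : 'I_n -> {poly k}, (forall i, (size (Q i) <= T + u * S)%N) /\
    peval D x ^+ u * h ^+ u * (peval b x * y j) = \sum_i peval (Q i) x * e i.
  elim: u => [|u [Q [QS QE]]].
    exists (p (enum_rank j)); split=> [i|]; first by rewrite addn0.
    by rewrite !expr0 !mul1r -pE enum_rankK.
  exists (fun i => \sum_l Q l * A l i); split=> [i|].
    apply: leq_trans (size_sum _ _ _) _; apply/bigmax_leqP => l _.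
    apply: leq_trans (size_polyMleq _ _) _; apply: leq_trans (leq_pred _) _.
    by rewrite mulSn addnCA [(S + _)%N]addnC leq_add.
  rewrite !exprS.
  have -> : peval D x * peval D x ^+ u * (h * h ^+ u) * (peval b x * y j) =
      peval D x * h * (peval D x ^+ u * h ^+ u * (peval b x * y j)) by ring.
  rewrite QE mulr_sumr.
  under eq_bigr => l _.
    have -> : peval D x * h * (peval (Q l) x * e l) = peval (Q l) x * (peval D x * (h * e l)) by ring.
    rewrite hE mulr_sumr; over.
  rewrite exchange_big; apply: eq_bigr => i _ /=; rewrite peval_sum mulr_suml.
  by apply: eq_bigr => l _; rewrite pevalM mulrA.
rewrite leqNgt; apply/negP => lt.
(* With more than n S elements the count would give (n S + 1) M <= n W = n (T + 1) + n S M, hence M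
   <= n (T + 1). *)
pose M := (n * (T + 1)).+1; pose W := (T + M * S).+1.
pose val (c : {ffun I * 'I_M -> k}) : K := \sum_j peval (\poly_(u < M) (c (j, inord u))) h * y j.
have valB c c' : val c - val c' = \sum_j peval (\poly_(u < M) ((c - c') (j, inord u))) h * y j.
  rewrite /val -sumrB; apply: eq_bigr => j _; rewrite -mulrBl -pevalB; congr (peval _ _ * _).
  by apply/polyP => i; rewrite coefB !coef_poly; case: ifP => _; rewrite ?subr0 // !ffunE.
have val_inj : injective val.
  move=> c c' cc; apply/ffunP => -[j u]; apply/eqP; rewrite -subr_eq0.
  have := valB c c'; rewrite cc subrr => /esym /yind /(_ j) /polyP /(_ u).
  by rewrite coef_poly ltn_ord coef0 inord_val !ffunE => ->.
pose dec (R : {ffun 'I_n * 'I_W -> k}) : K :=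
  \sum_i peval (\poly_(u < W) (R (i, inord u))) x * e i.
have /choice [G GE] c : exists R, peval D x ^+ M * peval b x * val c = dec R.
  have /choice [Q QP] : forall ju : I * 'I_M, exists Q : 'I_n -> {poly k},
      (forall i, (size (Q i) <= T + ju.2 * S)%N) /\
      peval D x ^+ ju.2 * h ^+ ju.2 * (peval b x * y ju.1) = \sum_i peval (Q i) x * e i.
    by move=> ju; apply: powE.
  pose P i := \sum_(ju : I * 'I_M) c ju *: (D ^+ (M - ju.2) * Q ju i).
  have PS i : (size (P i) <= W)%N.
    apply: leq_trans (size_sum _ _ _) _; apply/bigmax_leqP => -[j u] _.
    apply: leq_trans (size_scale_leq _ _) _.
    apply: leq_trans (size_polyMleq _ _) _; apply: leq_trans (leq_pred _) _.
    have h1 : (size (D ^+ (M - u)) <= (M - u) * S + 1)%N.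
      apply: leq_trans (size_poly_exp_leq _ _) _; rewrite addn1 ltnS mulnC.
      by rewrite leq_mul2l (leq_trans (leq_pred _) DS) orbT.
    apply: leq_trans (leq_add h1 ((QP (j, u)).1 i)) _; rewrite /= /W.
    have -> : (M * S = (M - u) * S + u * S)%N by rewrite -mulnDl subnK // ltnW.
    by lia.
  exists [ffun iu : 'I_n * 'I_W => (P iu.1)`_iu.2].
  rewrite /dec.
  under [RHS]eq_bigr => i _.
    have -> : \poly_(u < W) ([ffun iu : 'I_n * 'I_W => (P iu.1)`_iu.2] (i, inord u)) = P i.
      apply/polyP => u; rewrite coef_poly; case: ltnP => uW.
        by rewrite ffunE /= inordK.
      by rewrite nth_default // (leq_trans (PS i)).
    rewrite peval_sum mulr_suml; over.
  rewrite exchange_big /= /val mulr_sumr.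
  transitivity (\sum_j \sum_(u < M) peval D x ^+ M * peval b x * (s (c (j, u)) * h ^+ u * y j)).
    apply: eq_bigr => j _; rewrite (@pevalE (\poly_(u < M) _) h M) ?size_poly // mulr_suml mulr_sumr.
    by apply: eq_bigr => u _; rewrite coef_poly ltn_ord inord_val.
  rewrite pair_big /=; apply: eq_bigr => -[j u] _ /=.
  under [RHS]eq_bigr => i _.
    have -> : peval (c (j, u) *: (D ^+ (M - u) * Q (j, u) i)) x * e i =
        s (c (j, u)) * peval D x ^+ (M - u) * (peval (Q (j, u) i) x * e i).
      by rewrite -mul_polyC !pevalM pevalC pevalXn; ring.
    over.
  rewrite -mulr_sumr -(QP (j, u)).2 /=.
  have -> : peval D x ^+ M = peval D x ^+ (M - u) * peval D x ^+ u.
    by rewrite -exprD subnK // ltnW.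
  by ring.
have /leq_card : injective G.
  move=> c c' Gc; apply: val_inj.
  have d0 : peval D x ^+ M * peval b x != 0 by rewrite mulf_neq0 ?expf_neq0 ?xt.
  by apply: (mulfI d0); rewrite !GE Gc.
rewrite !card_ffun !card_prod !card_ord leq_exp2l; last exact: finNzRing_gt1.
move=> le1; have : ((n * S).+1 * M <= n * W)%N by apply: leq_trans le1; rewrite leq_mul2r lt orbT.
rewrite /W /M; set m := (n * (T + 1))%N.
have : (n * (T + m.+1 * S).+1 = m + m.+1 * (n * S))%N by rewrite /m -addn1; ring.
by move=> ->; rewrite mulSn; nia.
Qed.

End FunctionField.

Lemma finite_enumeration (T : eqType) (P : T -> Prop) (n : nat) :
  (forall l : seq T, uniq l -> (forall x, x \in l -> P x) -> (size l <= n)%N) ->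
  exists l : seq T, uniq l /\ forall x, P x <-> x \in l.
Proof.
move=> bound.
pose Q j := `[< exists l : seq T, [/\ uniq l, forall x, x \in l -> P x & size l = j] >].
have Q0 : exists j, Q j by exists 0%N; apply/asboolP; exists [::].
have Qn j : Q j -> (j <= n)%N by move=> /asboolP [l [ul lP <-]]; apply: bound.
have [j /asboolP [l [ul lP lj]] jmax] := ex_maxnP Q0 Qn.
exists l; split=> // x; split=> [Px|/lP //]; apply/negPn/negP => xl.
suff : Q j.+1 by move=> /jmax; rewrite ltnn.
apply/asboolP; exists (x :: l); split=> [|y|]; rewrite /= ?xl ?lj //.
by rewrite inE => /orP[/eqP -> //|/lP].
Qed.

Section Poles.
Variables (k : finFieldType) (C : curve k).
Local Notation K := (function_field C).
Local Notation s := (constants C).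
Variable iota : forall p : closed_point C, {rmorphism K -> laurent (residue_field p)}.
Hypothesis iotaP : forall p : closed_point C, laurent_expansion (iota p).
Implicit Types (p q : closed_point C) (ps qs : seq (closed_point C)) (f g h x y z : K).
Local Notation vge := (vge iota).
Local Notation ord := (ord iota).

Definition kbasis p (l : nat) : residue_field p := (vbasis {:residue_field p})`_l.

Lemma kbasis_free p (d : 'I_(degree p) -> k) :
  \sum_l d l *: kbasis p l = 0 -> forall l, d l = 0.
Proof.
have /freeP free : free (vbasis {:residue_field p}) by have /andP[] := vbasisP {:residue_field p}.
exact: free.
Qed.

Lemma degree_gt0 p : (0 < degree p)%N.
Proof. exact: adim_gt0. Qed.

Lemma iota_const p c : iota p (s c) = lconst c%:A.
Proof. by case: (iotaP p). Qed.

Lemma lcoef_constM p c f i : iota p (s c * f) i = c *: iota p f i.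
Proof. by rewrite rmorphM iota_const lconst_mulE mulr_algl. Qed.

Lemma lmonomialE p (c : residue_field p) (j : nat) i :
  (lconst c * zpow (residue_field p) j%:Z) i = if i == j%:Z then c else 0.
Proof. by rewrite lconst_mulE /=; case: ifP; rewrite ?mulr1 ?mulr0. Qed.

(** The functions [w], with leading terms (basis element of k(p)) z^j for j < m p at one point and
    small elsewhere, are independent over k[y]: in a relation, the coefficients of the highest power
    of y satisfy a relation modulo order m p at every p, which the expansions rule out. *)
Lemma pole_degree_le (n : nat) y (m : closed_point C -> nat) ps :
  (forall (I : finType) (w : I -> K), independent_over s y w -> (#|I| <= n)%N) ->
  y != 0 -> uniq ps -> (forall p, p \in ps -> vge p (m p)%:Z y^-1) ->
  (\sum_(p <- ps) m p * degree p <= n)%N.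
Proof.
move=> bound y0 ups ym.
pose P (i : 'I_(size ps)) := tnth (in_tuple ps) i.
have Pps i : P i \in ps by apply: mem_tnth.
have Pinj : injective P by apply/tuple_uniqP.
pose J i : finType := ('I_(m (P i)) * 'I_(degree (P i)))%type.
pose I : finType := {i : 'I_(size ps) & J i}.
have cI : #|I| = (\sum_(p <- ps) m p * degree p)%N.
  rewrite card_tagged sumnE big_map big_enum /= [RHS]big_tnth.
  by apply: eq_bigr => i _; rewrite card_prod !card_ord.
rewrite -cI.
pose M := (\max_(p <- ps) m p)%N.
have mM p : p \in ps -> (m p <= M)%N by move=> pps; rewrite /M (big_rem p pps) leq_maxl.
pose H (al : I) p : laurent (residue_field p) :=
  if p == P (tag al) then lconst (kbasis p (tagged al).2) * zpow _ (tagged al).1%:Z else 0.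
have H0 al p : p \in ps -> vanishes_below 0 (H al p).
  move=> _; rewrite /H; case: ifP => _; last exact: vb0.
  rewrite -[0]addr0; apply: vbM; first exact: vb_lconst.
  by apply: (@vb_le _ 0 (tagged al).1%:Z) => //; apply: vb_zpow.
have /choice [w wH] al : exists w, forall p, p \in ps -> vanishes_below M%:Z (iota p w - H al p).
  by apply: prescribe => // p; apply: H0.
apply: (bound I w) => c c0.
have w0 al p : p \in ps -> vge p 0 (w al).
  move=> pps; rewrite /vge (_ : iota p (w al) = iota p (w al) - H al p + H al p); last by rewrite subrK.
  by apply: vbD; [apply: vb_le (wH al p pps) | apply: H0].
apply: contrapT => /existsNP [al0 /eqP c_neq0].
pose D1 := (\max_al size (c al))%N.
have D1_gt0 : (0 < D1)%N.
  apply: leq_trans (leq_bigmax al0); by rewrite size_poly_gt0.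
pose D := D1.-1; have DD : D1 = D.+1 by rewrite /D prednK.
have cD al : (size (c al) <= D.+1)%N by rewrite -DD; apply: leq_bigmax.
have [al1 al1E] : exists al : I, size (c al) = D.+1.
  have [|al alE] := @bigop.eq_bigmax I (fun al => size (c al)); first by apply/card_gt0P; exists al0.
  by exists al; rewrite -alE -DD.
have c1 : (c al1)`_D != 0.
  have : lead_coef (c al1) != 0 by rewrite lead_coef_eq0 -size_poly_gt0 al1E.
  by rewrite lead_coefE al1E.
pose x := y^-1.
(* After multiplication by y^-D, each coefficient is its coefficient of degree D plus a multiple of
   y^-1, and y^-1 has order at least m p at p. *)
pose r al := peval s (c al) y * x ^+ D - s (c al)`_D.
have rm al p : p \in ps -> vge p (m p)%:Z (r al).
  move=> pps; have xm := ym p pps; have x0 : vge p 0 x by apply: vge_le xm.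
  rewrite /r (pevalE _ _ (cD al)) big_ord_recr /= mulrDl -mulrA -exprMn divff // expr1n mulr1.
  rewrite addrK mulr_suml; apply: vge_sum => e _.
  have -> : x ^+ D = x ^+ (D - e.+1 + 1 + e).
    by congr (_ ^+ _); have := ltn_ord e; lia.
  rewrite exprD -mulrA [_ * x ^+ e]mulrC [y ^+ e * _]mulrA -exprMn divff // expr1n mul1r.
  apply: vgeMl; first exact: vge_const.
  by rewrite exprD expr1; apply: vgeMl => //; apply: vgeX0.
have sumr p : p \in ps -> vge p (m p)%:Z (\sum_al s (c al)`_D * w al).
  move=> pps; have -> : \sum_al s (c al)`_D * w al = - (\sum_al r al * w al).
    apply/eqP; rewrite -addr_eq0 -big_split /=.
    under eq_bigr => al _ do rewrite -mulrDl /r addrC subrK mulrAC.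
    by rewrite -mulr_suml c0 mul0r.
  rewrite -sub0r; apply: vgeB; first exact: vge_0.
  apply: vge_sum => al _; rewrite mulrC; apply: vgeMl; [exact: w0 | exact: rm].
case: al1 al1E c1 => i [j l] al1E; apply/negP/negPn/eqP.
have := @sumr (P i) (Pps i) j%:Z _; rewrite ltz_nat ltn_ord => /(_ isT).
rewrite rmorph_sum lcoef_sum.
have wc al : iota (P i) (s (c al)`_D * w al) j%:Z =
    if (tag al == i) && ((tagged al).1 == j :> nat) then (c al)`_D *: kbasis (P i) (tagged al).2 else 0.
  rewrite lcoef_constM.
  have : iota (P i) (w al) j%:Z = H al (P i) j%:Z.
    apply/eqP; rewrite -subr_eq0 -lcoefB; apply/eqP; apply: wH (Pps i) _ _.
    by rewrite ltz_nat; apply: leq_trans (ltn_ord j) (mM _ (Pps i)).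
  move=> ->; rewrite /H (inj_eq Pinj) eq_sym; case: eqP => // ti; last by rewrite scaler0.
  by rewrite lmonomialE eqz_nat eq_sym; case: eqP => // _; rewrite scaler0.
under eq_bigr => al _ do rewrite wc.
pose G i' (j' : 'I_(m (P i'))) (l' : 'I_(degree (P i'))) :=
  if (i' == i) && (j' == j :> nat)
  then (c (@Tagged _ i' J (j', l')))`_D *: kbasis (P i) l' else 0.
have -> : \sum_(al : I) (if (tag al == i) && ((tagged al).1 == j :> nat)
    then (c al)`_D *: kbasis (P i) (tagged al).2 else 0) =
    \sum_i' \sum_(jl : J i') G i' jl.1 jl.2.
  by rewrite sig_big_dep; apply: eq_bigr => -[i' []].
rewrite (bigD1 i) //= [X in _ + X]big1 ?addr0; last first.
  by move=> i' /negPf ni; rewrite big1 // => jl _; rewrite /G ni.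
rewrite -(pair_bigA _ (G i)) /= (bigD1 j) //= [X in _ + X]big1 ?addr0; last first.
  by move=> j' nj; rewrite big1 // => l' _; rewrite /G /= eqxx -[_ == _ :> nat]/(j' == j) (negPf nj).
under eq_bigr => l' _ do rewrite /G !eqxx /=.
by move/kbasis_free/(_ l).
Qed.

(** In a polynomial in h, the term of highest degree has a pole of larger order than all others. *)
Lemma transcendental_pole p h : ~ vge p 0 h -> transcendental s h.
Proof.
move=> /vge_neg [h0 oh] c c0; apply/eqP => ch.
have sc : size c = (size c).-1.+1 by rewrite prednK // size_poly_gt0.
have lc : c`_(size c).-1 != 0 by rewrite -lead_coefE lead_coef_eq0.
move: (size c).-1 sc lc => n sc lc.
have sn0 : s c`_n != 0 by rewrite fmorph_eq0.
have o0 : ord p (s c`_n) = 0.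
  apply: (@ord_eq _ _ _ _ _ _ (c`_n)%:A); rewrite iota_const; split=> //.
    exact: vb_lconst.
  by rewrite scaler_eq0 oner_eq0 orbF.
have : vge p (ord p h * n%:Z + 1) (s c`_n * h ^+ n).
  move: ch; rewrite (pevalE _ _ (eq_leq sc)) big_ord_recr /= addrC => /eqP.
  rewrite addr_eq0 => /eqP ->; rewrite -sub0r; apply: vgeB; first exact: vge_0.
  apply: vge_sum => i _; apply: vgeMl; first exact: vge_const.
  apply/vgeE; rewrite ?expf_neq0 // ordX //; have := ltn_ord i; nia.
by move/vgeE; rewrite mulf_neq0 ?expf_neq0 // ordM ?expf_neq0 // o0 ordX // => /(_ isT); lia.
Qed.

(** Each pole contributes at least 1 to the sum bounded in [pole_degree_le]. *)
Lemma finite_poles y : exists ps, uniq ps /\ forall p, ~ vge p 0 y <-> p \in ps.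
Proof.
have [[p0 yp0]|none] := pselect (exists p, ~ vge p 0 y); last first.
  by exists [::]; split=> // p; split=> // yp; case: none; exists p.
have y0 := (vge_neg yp0).1.
have [n hn] := finite_degree (dimension_one C) (transcendental_pole yp0).
apply: (@finite_enumeration _ _ n) => l ul lP.
have : (\sum_(p <- l) 1 * degree p <= n)%N.
  apply: (pole_degree_le (m := fun=> 1%N) hn) => // p /lP /vge_neg [_ yo].
  by apply/vgeE; rewrite ?invr_eq0 // ordV //; lia.
apply: leq_trans; rewrite -sum1_size; apply: leq_sum => p _; rewrite mul1n.
exact: degree_gt0.
Qed.

End Poles.

(** * Existence of valuation rings *)

Section Chevalley.
Variables (k : finFieldType) (K : fieldType) (s : {rmorphism k -> K}).
Implicit Types (V : set K) (x y z : K) (P Q : {poly K}).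

Section Subalgebra.
Variable V : set K.
Hypothesis Valg : k_subalgebra s V.

Lemma subalg_const c : V (s c). Proof. by case: Valg. Qed.
Lemma subalg0 : V 0. Proof. by rewrite -(rmorph0 s); apply: subalg_const. Qed.
Lemma subalg1 : V 1. Proof. by rewrite -(rmorph1 s); apply: subalg_const. Qed.
Lemma subalgB x y : V x -> V y -> V (x - y). Proof. by case: Valg => _ + _; apply. Qed.
Lemma subalgM x y : V x -> V y -> V (x * y). Proof. by case: Valg => _ _; apply. Qed.
Lemma subalgD x y : V x -> V y -> V (x + y).
Proof.
move=> Vx Vy; rewrite -[y]opprK; apply: subalgB => //.
by rewrite -sub0r; apply: subalgB => //; apply: subalg0.
Qed.
Lemma subalgX x n : V x -> V (x ^+ n).
Proof. by move=> Vx; elim: n => [|n IH]; [apply: subalg1 | rewrite exprS; apply: subalgM]. Qed.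
Lemma subalg_sum (I : Type) (r : seq I) (p : pred I) (F : I -> K) :
  (forall i, p i -> V (F i)) -> V (\sum_(i <- r | p i) F i).
Proof. by move=> VF; elim/big_ind: _ => //; [apply: subalg0 | apply: subalgD]. Qed.

Definition coefs_in (W : set K) P := forall i, W P`_i.
Definition adjoin z : set K := [set x | exists2 P, coefs_in V P & P.[z] = x].

Lemma adjoin_subalgebra z : k_subalgebra s (adjoin z).
Proof.
split=> [c|_ _ [P VP <-] [Q VQ <-]|_ _ [P VP <-] [Q VQ <-]].
- exists (s c)%:P; last by rewrite hornerC.
  by move=> i; rewrite coefC; case: ifP => _; [apply: subalg_const | apply: subalg0].
- exists (P - Q); last by rewrite hornerD hornerN.
  by move=> i; rewrite coefB; apply: subalgB.
- exists (P * Q); last by rewrite hornerM.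
  by move=> i; rewrite coefM; apply: subalg_sum => j _; apply: subalgM.
Qed.

Lemma sub_adjoin z : V `<=` adjoin z.
Proof.
move=> x Vx; exists x%:P; last by rewrite hornerC.
by move=> i; rewrite coefC; case: ifP => _ //; apply: subalg0.
Qed.

Lemma adjoin_gen z : adjoin z z.
Proof.
exists 'X; last by rewrite hornerX.
by move=> i; rewrite coefX; case: eqP => _; [apply: subalg1 | apply: subalg0].
Qed.
End Subalgebra.

(* V is a subalgebra maximal among those containing y but not 1/y.            *)
Section Maximal.
Variables (V : set K) (y : K).
Hypotheses (y0 : y != 0) (Valg : k_subalgebra s V) (Vy : V y) (Vh : ~ V y^-1).
Hypothesis Vmax : forall W : set K, k_subalgebra s W -> V `<=` W -> ~ W y^-1 -> W `<=` V.

Let I : set K := [set y * v | v in V].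

Let I_sub : I `<=` V. Proof. by move=> _ [v Vv <-]; apply: subalgM. Qed.
Let I0 : I 0. Proof. by exists 0; rewrite ?mulr0 //; apply: subalg0 Valg. Qed.
Let ID a b : I a -> I b -> I (a + b).
Proof. by move=> [u Vu <-] [v Vv <-]; exists (u + v); rewrite ?mulrDr //; apply: subalgD. Qed.
Let IM a b : I a -> V b -> I (a * b).
Proof. by move=> [u Vu <-] Vb; exists (u * b); rewrite ?mulrA //; apply: subalgM. Qed.
Let I1 : ~ I 1.
Proof. by move=> [u Vu yu]; apply: Vh; rewrite -(mulfK y0 u) mulrC [u * y]mulrC yu mulr1 in Vu *. Qed.

(** By maximality V[z] contains the inverse of y; multiplying the expression by y puts its
    coefficients in the ideal yV. *)
Let max_adjoin z : ~ V z -> exists2 P, coefs_in I P & P.[z] = 1.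
Proof.
move=> Vz; have [[P VP Ph]|na] := pselect (adjoin V z y^-1).
  exists (y *: P); last by rewrite hornerZ Ph divff.
  by move=> i; rewrite coefZ; exists P`_i.
case: Vz; apply: (Vmax (adjoin_subalgebra Valg z) (sub_adjoin Valg _) na).
exact: adjoin_gen.
Qed.

(** Otherwise 1 is a polynomial in (1 - d)^-1 with coefficients in I; clearing denominators puts a
    power of 1 - d, which is 1 modulo I, into I. *)
Let unit1B d : I d -> V (1 - d)^-1.
Proof.
move=> Id; have d1 : 1 - d != 0.
  by apply/eqP => /eqP; rewrite subr_eq0 => /eqP d1; apply: I1; rewrite d1.
apply: contrapT => /max_adjoin [P IP P1]; apply: I1.
have Vd : V (1 - d) by apply: subalgB => //; [apply: subalg1 Valg | apply: I_sub].
have powd n : I ((1 - d) ^+ n - 1).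
  elim: n => [|n IH]; first by rewrite subrr.
  rewrite (_ : _ - 1 = ((1 - d) ^+ n - 1) * (1 - d) + d * (- 1)); last by rewrite exprS; ring.
  apply: ID; first exact: IM.
  by apply: IM => //; rewrite -sub0r; apply: subalgB => //; [apply: subalg0 Valg | apply: subalg1 Valg].
pose n := size P.
have : I ((1 - d) ^+ n).
  rewrite (_ : _ ^+ n = (1 - d) ^+ n * P.[(1 - d)^-1]); last by rewrite P1 mulr1.
  rewrite horner_coef mulr_sumr.
  elim/big_ind: _ => // i _.
  rewrite mulrCA; apply: IM; first exact: IP.
  have -> : (1 - d) ^+ n = (1 - d) ^+ (n - i) * (1 - d) ^+ i.
    by rewrite -exprD subnK // ltnW.
  by rewrite exprVn -mulrA divff ?expf_neq0 // mulr1; apply: subalgX.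
move=> In; rewrite (_ : 1 = (1 - d) ^+ n + ((1 - d) ^+ n - 1) * (- 1)); last by ring.
apply: ID => //; apply: IM => //; rewrite -sub0r.
by apply: subalgB => //; [apply: subalg0 Valg | apply: subalg1 Valg].
Qed.

Let rep z n := exists P, [/\ (size P <= n)%N, coefs_in I P & P.[z] = 1].

Let rep0 z : ~ rep z 0.
Proof.
move=> [P []]; rewrite leqn0 size_poly_eq0 => /eqP -> _; rewrite horner0 => /esym/eqP.
by rewrite oner_eq0.
Qed.

(** In the expression of 1 by z^-1, the coefficient 1 - Q_0 is a unit, so z^n is a combination of
    lower powers of z with coefficients in I; this replaces the top term of the expression by z. *)
Let rep_reduce z n m : z != 0 -> rep z n.+1 -> rep z^-1 m -> (m <= n.+1)%N -> rep z n.
Proof.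
move=> z0 [P [Pn IP P1]] [Q [Qm IQ Q1]] mn.
pose w := (1 - Q`_0)^-1.
have Vw : V w by apply: unit1B.
have wn : w * z ^+ n * (1 - Q`_0) = z ^+ n.
  rewrite mulrAC mulVf ?mul1r //; apply/eqP => /eqP; rewrite subr_eq0 => /eqP e.
  by apply: I1; rewrite e.
exists (\poly_(i < n) (P`_i + P`_n * w * Q`_(n - i))); split; first exact: size_poly.
  move=> i; rewrite coef_poly; case: ifP => _ //; apply: ID => //.
  by apply: IM; [apply: IM | apply: I_sub].
rewrite horner_poly.
under eq_bigr => i _ do rewrite mulrDl.
rewrite big_split /=.
have Q1' : \sum_(i < n.+1) Q`_i * z^-1 ^+ i = 1.
  by rewrite -Q1 (@horner_coef_wide _ n.+1) // (leq_trans Qm).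
have -> : \sum_(i < n) P`_n * w * Q`_(n - i) * z ^+ i = P`_n * z ^+ n.
  rewrite -[in RHS]wn -[in RHS]Q1' big_ord_recl expr0 mulr1 addrC addKr !mulr_sumr.
  rewrite [RHS](reindex_inj rev_ord_inj) /=; apply: eq_bigr => i _.
  rewrite /bump leq0n add1n subnSK // -!mulrA; congr (_ * (_ * _)).
  rewrite mulrCA; congr (_ * _).
  have {2}-> : n = (i + (n - i))%N by rewrite subnKC // ltnW.
  by rewrite exprD exprVn -mulrA divff ?expf_neq0 // mulr1.
by rewrite -(big_ord_recr n (fun i => P`_i * z ^+ i)) -P1 (@horner_coef_wide _ n.+1).
Qed.

(** If neither z nor its inverse is in V, take the shortest expressions of 1 by each: the longer one
    can be shortened with the help of the other. *)
Lemma maximal_valuation z : V z \/ V z^-1.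
Proof.
have [->|z0] := eqVneq z 0; first by left; apply: subalg0 Valg.
apply: contrapT => /not_orP [nz nzi].
have ex x : ~ V x -> exists n, `[< rep x n >].
  by move=> /max_adjoin [P IP P1]; exists (size P); apply/asboolP; exists P.
have [n /asboolP rn nmin] := ex_minnP (ex _ nz).
have [m /asboolP rm mmin] := ex_minnP (ex _ nzi).
have {}nmin j : rep z j -> (n <= j)%N by move=> /asboolP /nmin.
have {}mmin j : rep z^-1 j -> (m <= j)%N by move=> /asboolP /mmin.
case: n rn nmin => [/rep0 //|n rn nmin]; case: m rm mmin => [/rep0 //|m rm mmin].
have [mn|nm] := leqP m.+1 n.+1.
  by have := nmin _ (rep_reduce z0 rn rm mn); rewrite ltnn.
have zi0 : z^-1 != 0 by rewrite invr_eq0.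
have rn' : rep z^-1^-1 n.+1 by rewrite invrK.
by have := mmin _ (rep_reduce zi0 rm rn' (ltnW nm)); rewrite ltnn.
Qed.
End Maximal.

Lemma valuation_ring_avoiding h : h != 0 -> (forall c, peval s c h^-1 != h) ->
  exists V, valuation_ring s V /\ ~ V h.
Proof.
move=> h0 nh; pose y := h^-1.
pose good V := [/\ k_subalgebra s V, V y & ~ V h].
pose R0 : set K := [set x | exists c, peval s c y = x].
have R0good : good R0.
  split.
  - split=> [c|_ _ [c <-] [d <-]|_ _ [c <-] [d <-]].
    + by exists c%:P; rewrite pevalC.
    + by exists (c - d); rewrite pevalB.
    + by exists (c * d); rewrite pevalM.
  - by exists 'X; rewrite pevalX.
  - by move=> [c ch]; have := nh c; rewrite -/y ch eqxx.
have [|V [Vg Vmax]] := @Zorn_bigcup K (fun V => V = set0 \/ good V).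
  move=> F FP Ftot.
  have [[V0 [FV0 gV0]]|none] := pselect (exists V0, F V0 /\ good V0); last first.
    left; apply/seteqP; split=> // x [V FV Vx].
    have [e|g] := FP _ FV; first by rewrite e in Vx.
    by case: none; exists V.
  right; have goodF V x : F V -> V x -> good V.
    by move=> FV Vx; case: (FP _ FV) => // e; rewrite e in Vx.
  have two x x' : (\bigcup_(X in F) X) x -> (\bigcup_(X in F) X) x' ->
      exists V, [/\ F V, V x & V x'].
    move=> [V FV Vx] [W FW Wx]; have [VW|WV] := Ftot _ _ FV FW.
      by exists W; split=> //; apply: VW.
    by exists V; split=> //; apply: WV.
  have [[c0 _ _] V0y _] := gV0.
  split.
  - split=> [c|x x' xF x'F|x x' xF x'F].
    + by exists V0.
    + have [V [FV Vx Vx']] := two _ _ xF x'F; exists V => //.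
      by have [[_ + _] _ _] := goodF _ _ FV Vx; apply.
    + have [V [FV Vx Vx']] := two _ _ xF x'F; exists V => //.
      by have [[_ _ +] _ _] := goodF _ _ FV Vx; apply.
  - by exists V0.
  - by move=> [V FV Vh]; have [_ _] := goodF _ _ FV Vh.
have {}Vg : good V.
  case: Vg => // V0; case: (Vmax R0); last by right.
  rewrite V0; split=> [x []|/(_ y)]; case.
  by case: R0good.
have [Valg Vy Vh] := Vg; exists V; split=> //; split=> //.
have y0 : y != 0 by rewrite invr_eq0.
apply: (maximal_valuation y0) => //; first by rewrite invrK.
move=> W Walg VW; rewrite invrK => Wh; apply: contrapT => nWV.
by apply: (Vmax W); [split | right; split=> //; apply: VW].
Qed.
End Chevalley.

(** * Functions regular away from a rational point *)

Section AffineRing.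
Variables (k : finFieldType) (C : curve k).
Local Notation K := (function_field C).
Local Notation s := (constants C).
Variable iota : forall p : closed_point C, {rmorphism K -> laurent (residue_field p)}.
Hypothesis iotaP : forall p : closed_point C, laurent_expansion (iota p).
Variable oo : closed_point C.
Hypothesis oo1 : degree oo = 1%N.
Implicit Types (p q : closed_point C) (ps qs : seq (closed_point C)) (a f g h x y z : K).
Local Notation vge := (vge iota).
Local Notation ord := (ord iota).

(** A valuation ring that omits h has a centre, whose local ring it contains. *)
Lemma exists_pole h : h != 0 -> (forall c, peval s c h^-1 != h) -> exists p, ~ vge p 0 h.
Proof.
move=> h0 hc; have [V [Vv Vh]] := valuation_ring_avoiding h0 hc.
have VT : V <> setT by move=> VT; apply: Vh; rewrite VT.
have [p [[pV _] _]] := complete_separated Vv VT.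
by exists p => /(local_ringE iotaP) /pV.
Qed.

Definition affine a := forall p, p != oo -> vge p 0 a.

Lemma affine_const c : affine (s c).
Proof. by move=> p _; apply: vge_const. Qed.
Lemma affine1 : affine 1. Proof. by move=> p _; apply: vge_1. Qed.
Lemma affineB f g : affine f -> affine g -> affine (f - g).
Proof. by move=> fA gA p po; apply: vgeB; [apply: fA | apply: gA]. Qed.
Lemma affineM f g : affine f -> affine g -> affine (f * g).
Proof. by move=> fA gA p po; apply: vgeMl; [apply: fA | apply: gA]. Qed.
Lemma affineX f n : affine f -> affine (f ^+ n).
Proof. by move=> fA p po; apply: vgeX0; apply: fA. Qed.
Lemma affine_prod (I : eqType) (r : seq I) (F : I -> K) :
  (forall i, i \in r -> affine (F i)) -> affine (\prod_(i <- r) F i).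
Proof.
move=> FA; rewrite big_seq_cond; elim/big_ind: _ => [||i]; first exact: affine1.
  exact: affineM.
by rewrite andbT => /FA.
Qed.

(** A nonzero a that vanishes at oo has a transcendental inverse, so a is not a polynomial in its
    inverse and must have a pole; but it is regular everywhere. *)
Lemma affine_vanishing a : affine a -> vge oo 1 a -> a = 0.
Proof.
move=> aA a1; apply/eqP/negPn/negP => a0.
have ai : ~ vge oo 0 a^-1.
  move/vgeE; rewrite invr_eq0 => /(_ a0); rewrite ordV //.
  by move/vgeE: a1 => /(_ a0); lia.
have [|p pa] := exists_pole a0.
  move=> c; apply/eqP => ca.
  have /(transcendental_pole iotaP ai) : 'X * c - 1 != 0.
    apply/eqP => /(congr1 (fun P : {poly k} => P`_0)).
    by rewrite coefB coefXM coef1 coef0 sub0r => /eqP; rewrite oppr_eq0 oner_eq0.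
  by rewrite pevalB pevalM pevalX peval1 ca mulVf // subrr eqxx.
by apply: pa; have [->|/aA //] := eqVneq p oo; apply: vge_le a1.
Qed.

(** The map records the coordinates over k of the coefficients of index -N p to -1. Only the
    cardinality of its target matters: it turns dimension counts into injectivity arguments. *)
Lemma polar_parts ps (N : closed_point C -> nat) : uniq ps ->
  exists (T : finType) (loc : K -> T), #|T| = (#|k| ^ \sum_(p <- ps) N p * degree p)%N /\
    forall f g, (forall p, p \in ps -> vge p (- (N p)%:Z) f) ->
      (forall p, p \in ps -> vge p (- (N p)%:Z) g) -> loc f = loc g ->
      forall p, p \in ps -> vge p 0 (f - g).
Proof.
move=> ups.
pose P (i : 'I_(size ps)) := tnth (in_tuple ps) i.
pose J i : finType := ('I_(N (P i)) * 'I_(degree (P i)))%type.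
pose I : finType := {i : 'I_(size ps) & J i}.
have cI : #|I| = (\sum_(p <- ps) N p * degree p)%N.
  rewrite card_tagged sumnE big_map big_enum /= [RHS]big_tnth.
  by apply: eq_bigr => i _; rewrite card_prod !card_ord.
pose loc f : {ffun I -> k} := [ffun al : I => coord (vbasis {:residue_field (P (tag al))})
   (tagged al).2 (iota (P (tag al)) f ((tagged al).1%:Z - (N (P (tag al)))%:Z))].
exists {ffun I -> k}, loc; split; first by rewrite card_ffun cI.
move=> f g fN gN /ffunP fg p pps.
have [i pE] : exists i, P i = p.
  by have /tnthP [i ->] : p \in in_tuple ps by []; exists i.
subst p; move=> d d0; have [dN|dN] := ltP d (- (N (P i))%:Z).
  by rewrite rmorphB lcoefB fN ?gN ?subrr.
have jN : (`|(d + (N (P i))%:Z)%R| < N (P i))%N by lia.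
have dE : d = `|(d + (N (P i))%:Z)%R|%N%:Z - (N (P i))%:Z by lia.
rewrite rmorphB lcoefB; apply/eqP; rewrite subr_eq0; apply/eqP.
rewrite [LHS](coord_vbasis (memvf _)) [RHS](coord_vbasis (memvf _)).
apply: eq_bigr => l _; congr (_ *: _).
have := fg (@Tagged _ i J (Ordinal jN, l)); rewrite !ffunE /= -dE.
by [].
Qed.

(** The powers 1, u, ..., u^n satisfy a relation over k[y]. With D its leading coefficient, D u is
    integral over k[y], hence regular wherever y is. *)
Lemma integral_denominator n y (u : K) : transcendental s y ->
  (forall (I : finType) (w : I -> K), independent_over s y w -> (#|I| <= n)%N) ->
  exists2 D : {poly k}, D != 0 & forall p, vge p 0 y -> vge p 0 (peval s D y * u).
Proof.
move=> yt bound.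
have : ~ independent_over s y (fun i : 'I_n.+1 => u ^+ i).
  by move=> /bound; rewrite card_ord ltnn.
move=> /existsNP [c /not_implyP [c0 /existsNP [i0 /eqP ci0]]].
have [i ci imax] := @arg_maxnP _ i0 (fun i => c i != 0) (fun i => i : nat) ci0.
have {}imax (j : 'I_n.+1) : c j != 0 -> (j <= i)%N by move=> /imax.
exists (c i) => // p yp; have [->|u0] := eqVneq u 0; first by rewrite mulr0; apply: vge_0.
pose D := peval s (c i) y; pose v := D * u.
have D0 : D != 0 by apply: yt.
have v0 : v != 0 by rewrite mulf_neq0.
apply: contrapT => /vge_neg [_ vo].
have : vge p (ord p v * (i : nat)%:Z + 1) (v ^+ i).
  case iE : (i : nat) => [|m].
    have : D = 0.
      rewrite -c0 (bigD1 i) //= iE expr0 mulr1 big1 ?addr0 // => j ji.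
      have [->|/imax] := eqVneq (c j) 0; first by rewrite /peval rmorph0 horner0 mul0r.
      by rewrite iE leqn0 => j0; case/eqP: ji; apply: val_inj => /=; rewrite iE; apply/eqP.
    by move/eqP; rewrite (negPf D0).
  have -> : v ^+ m.+1 = - \sum_(j < n.+1 | j != i) peval s (c j) y * D ^+ (m - j) * v ^+ j.
    apply/eqP; rewrite -addr_eq0; apply/eqP; rewrite -[RHS](mulr0 (D ^+ m)) -[X in _ = _ * X]c0 [X in _ = _ * X](bigD1 i) //= mulrDr.
    congr (_ + _); first by rewrite iE exprMn [D ^+ m.+1]exprSr mulrA.
    rewrite mulr_sumr; apply: eq_bigr => j ji.
    have [->|/imax jm] := eqVneq (c j) 0; first by rewrite /peval rmorph0 horner0 !mul0r mulr0.
    have {jm ji}jm : (j <= m)%N.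
      by rewrite -ltnS -iE ltn_neqAle jm andbT.
    rewrite exprMn mulrA -[_ * D ^+ (m - j) * _]mulrA -exprD subnK // mulrA; congr (_ * _).
    by rewrite mulrC.
  rewrite -sub0r; apply: vgeB; first exact: vge_0.
  apply: vge_sum => j ji; have [->|/imax jm] := eqVneq (c j) 0.
    by rewrite /peval rmorph0 horner0 !mul0r; apply: vge_0.
  have {jm ji}jm : (j <= m)%N by rewrite -ltnS -iE ltn_neqAle jm andbT.
  apply: vgeMl; first by apply: vgeMl; [apply: vge_poly | apply: vgeX0; apply: vge_poly].
  apply/vgeE; rewrite ?expf_neq0 // ordX //; have e : m.+1%:Z = (j : nat)%:Z + (m - j)%N%:Z + 1 by lia.
  by rewrite e; move: (m - j)%N (ord p v) vo => t o vo; nia.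
by move/vgeE; rewrite expf_neq0 // => /(_ isT); rewrite ordX //; lia.
Qed.

Lemma rational_residue f g : vge oo 0 (f - g) ->
  coord (vbasis {:residue_field oo}) (Ordinal (degree_gt0 oo)) (iota oo f 0) =
  coord (vbasis {:residue_field oo}) (Ordinal (degree_gt0 oo)) (iota oo g 0) ->
  vge oo 1 (f - g).
Proof.
move=> fg0 fg i i1; have [/fg0 //|i0] := ltP i 0.
have -> : i = 0 by lia.
rewrite rmorphB lcoefB; apply/eqP; rewrite subr_eq0; apply/eqP.
rewrite [LHS](coord_vbasis (memvf _)) [RHS](coord_vbasis (memvf _)).
apply: eq_bigr => l _; congr (_ *: _).
suff -> : l = Ordinal (degree_gt0 oo) by [].
have l1 : (l < degree oo)%N := ltn_ord l.
by apply: val_inj => /=; rewrite oo1 in l1; lia.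
Qed.

(* Riemann's inequality in its weakest form. With y having a simple pole at    *)
(* the rational point oo, and n the degree of K over k(y), the functions with  *)
(* poles of order at most l at the poles of y form a space of dimension        *)
(* n l + O(1), while regularity at the poles other than oo imposes only        *)
(* (n - 1) l + O(1) conditions.                                                *)
Lemma exists_affine_pole : exists2 a, affine a & ~ vge oo 0 a.
Proof.
apply: contrapT => none.
have {}none a : affine a -> vge oo 0 a.
  by move=> aA; apply: contrapT => a0; apply: none; exists a.
have [x xo] := uniformizer iotaP oo.
have x0 : x != 0 by apply/eqP => x0; have := has_order_neq0 xo; rewrite x0 rmorph0 eqxx.
pose y := x^-1; have y0 : y != 0 by rewrite invr_eq0.
have oy : ord oo y = -1 by rewrite ordV // (ord_eq xo).
have yoo : ~ vge oo 0 y by move/vgeE => /(_ y0); rewrite oy.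
have yt := transcendental_pole iotaP yoo.
have [n0 hn0] := finite_degree (dimension_one C) yt.
pose Q j := `[< exists (I : finType) (w : I -> K), independent_over s y w /\ #|I| = j >].
have Q0 : exists j, Q j.
  by exists 0%N; apply/asboolP; exists void, (fun=> 0); rewrite card_void; split=> // c _ [].
have Qn j : Q j -> (j <= n0)%N by move=> /asboolP [I [w [wi <-]]]; apply: hn0 wi.
have [n /asboolP [I [u [ui In]]] nmax] := ex_maxnP Q0 Qn.
have {nmax}bound (J : finType) (w : J -> K) : independent_over s y w -> (#|J| <= n)%N.
  by move=> wi; apply: nmax; apply/asboolP; exists J, w.
have /choice [D DP] (j : I) : exists D : {poly k}, D != 0 /\
    forall p, vge p 0 y -> vge p 0 (peval s D y * u j).
  by have [D D0 DP] := integral_denominator (u j) yt bound; exists D.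
pose v j := peval s (D j) y * u j.
have vi : independent_over s y v.
  move=> c c0 j.
  have /ui/(_ j)/eqP : \sum_i peval s (c i * D i) y * u i = 0.
    by rewrite -[RHS]c0; apply: eq_bigr => i _; rewrite pevalM mulrA.
  by rewrite mulf_eq0 (negPf (DP j).1) orbF => /eqP.
have [Z [uZ ZP]] := finite_poles iotaP y.
have [c cP] : exists c : nat, forall j p, p \in Z -> vge p (- c%:Z) (v j).
  have /choice [c cP] (j : I) : exists c : nat, forall p, p \in Z -> vge p (- c%:Z) (v j).
    exact: vge_seq_bounded.
  exists (\max_j c j)%N => j p pZ. apply: (vge_le _ (cP j p pZ)).
  by rewrite lerN2 lez_nat; apply: leq_bigmax.
pose m p := `|ord p y|%N.
have mE p : p \in Z -> ord p y = - (m p)%:Z.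
  by move=> /ZP /vge_neg [_]; rewrite /m; lia.
have ooZ : oo \in Z by apply/ZP.
have moo : m oo = 1%N by rewrite /m oy.
pose Z' := rem oo Z.
have uZ' : uniq Z' by apply: rem_uniq.
have Z'P p : p \in Z' -> p \in Z by apply: mem_rem.
have nZ : (\sum_(p <- Z') m p * degree p < n)%N.
  have : (\sum_(p <- Z) m p * degree p <= n)%N.
    apply: (pole_degree_le iotaP bound) => // p pZ.
    by apply/vgeE; rewrite ?invr_eq0 // ordV // mE // opprK.
  by rewrite (big_rem oo ooZ) /= moo oo1.
pose d := (\sum_(p <- Z') degree p)%N.
(* The count gives n l <= l (n - 1) + c d + 1, which this l contradicts: c d comes from the poles of
   the v j, and 1 from the residue at oo. *)
pose l := (c * d).+2.
pose N p := (l * m p + c)%N.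
have [T [loc [cT locP]]] := polar_parts N uZ'.
pose val (t : {ffun I * 'I_l -> k}) : K := \sum_j peval s (\poly_(i < l) (t (j, inord i))) y * v j.
have val_pole t p : p \in Z -> vge p (- (N p)%:Z) (val t).
  move=> pZ; apply: vge_sum => j _.
  have -> : - (N p)%:Z = (ord p y * l%:Z) + - c%:Z by rewrite mE // /N; lia.
  apply: vgeM; last exact: cP.
  rewrite (@pevalE _ _ s _ y l) ?size_poly //; apply: vge_sum => i _.
  apply: vgeMl; first exact: vge_const.
  apply/vgeE; rewrite ?expf_neq0 // ordX // mE //; have := ltn_ord i; nia.
have val_reg t p : p \notin Z -> vge p 0 (val t).
  move=> /negP pZ; have yp : vge p 0 y by apply: contrapT => /ZP.
  apply: vge_sum => j _; apply: vgeMl; first exact: vge_poly.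
  exact: (DP j).2.
(* Two functions with the same polar parts away from oo differ by an affine function, which is
   regular at oo by assumption; if the residues at oo agree too, the difference vanishes there and
   is 0. *)
have inj : injective (fun t => (loc (val t),
    coord (vbasis {:residue_field oo}) (Ordinal (degree_gt0 oo)) (iota oo (val t) 0))).
  move=> t t' [lt ct].
  have vA : affine (val t - val t').
    move=> p po; have [pZ|pZ] := boolP (p \in Z); last by apply: vgeB; apply: val_reg.
    apply: (locP (val t) (val t')) => //; try by move=> q /Z'P; apply: val_pole.
    by rewrite mem_rem_uniq // inE po.
  have v0 : val t - val t' = 0.
    by apply: affine_vanishing => //; apply: rational_residue ct; apply: none.
  apply/ffunP => -[j i]; apply/eqP; rewrite -subr_eq0; apply/eqP.
  have /vi/(_ j)/polyP/(_ i) : \sum_j peval s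
      (\poly_(i < l) (t (j, inord i)) - \poly_(i < l) (t' (j, inord i))) y * v j = 0.
    by rewrite -[RHS]v0 /val -sumrB; apply: eq_bigr => i' _; rewrite pevalB mulrBl.
  by rewrite coefB !coef_poly ltn_ord inord_val coef0.
have := leq_card _ inj; rewrite card_prod cT card_ffun card_prod card_ord In -expnSr.
rewrite leq_exp2l; last exact: finNzRing_gt1.
have -> : (\sum_(p <- Z') N p * degree p = l * (\sum_(p <- Z') m p * degree p) + c * d)%N.
  by rewrite /N /d !big_distrr -big_split /=; apply: eq_bigr => p _; rewrite mulnDl mulnA.
by move: nZ; rewrite /l; nia.
Qed.

End AffineRing.

(** * Strong approximation away from the rational point *)

Section StrongApproximation.
Variables (k : finFieldType) (C : curve k).
Local Notation K := (function_field C).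
Local Notation s := (constants C).
Variable iota : forall p : closed_point C, {rmorphism K -> laurent (residue_field p)}.
Hypothesis iotaP : forall p : closed_point C, laurent_expansion (iota p).
Variable oo : closed_point C.
Hypothesis oo1 : degree oo = 1%N.
Implicit Types (p q : closed_point C) (ps qs : seq (closed_point C)) (a f g h x y z : K).
Local Notation vge := (vge iota).
Local Notation ord := (ord iota).
Local Notation affine := (affine iota oo).

Lemma residue_power p (z : residue_field p) : z ^+ (#|k| ^ degree p) = z.
Proof.
have := Fermat's_little_theorem {:residue_field p}%AS z.
by rewrite memvf => /esym/eqP.
Qed.

Lemma card_gt1 : (1 < #|k|)%N.
Proof. exact: finNzRing_gt1. Qed.

Lemma vge1_mul p (n : nat) u v : vge p 0 v -> vge p n%:Z (u - 1) -> vge p n%:Z (v - 1) ->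
  vge p n%:Z (u * v - 1).
Proof.
move=> v0 u1 v1; have -> : u * v - 1 = v * (u - 1) + (v - 1) by ring.
by apply: vgeD => //; apply: vgeMl.
Qed.

Lemma vge1_prod p (n : nat) (I : eqType) (r : seq I) (F : I -> K) :
  (forall i, i \in r -> vge p 0 (F i)) ->
  (forall i, i \in r -> vge p n%:Z (F i - 1)) -> vge p n%:Z (\prod_(i <- r) F i - 1).
Proof.
elim: r => [|i r IH] F0 F1; first by rewrite big_nil subrr; apply: vge_0.
rewrite big_cons mulrC; apply: vge1_mul; first by apply: F0; rewrite mem_head.
  by apply: IH => j jr; [apply: F0 | apply: F1]; rewrite inE jr orbT.
by apply: F1; rewrite mem_head.
Qed.

Lemma vge1_exp p (n j : nat) u : vge p 0 u -> vge p n%:Z (u - 1) -> vge p n%:Z (u ^+ j - 1).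
Proof.
move=> u0 u1; elim: j => [|j IH]; first by rewrite expr0 subrr; apply: vge_0.
by rewrite exprSr; apply: vge1_mul.
Qed.

Lemma vge_res0 p f : vge p 0 f -> iota p f 0 = 0 -> vge p 1 f.
Proof. by move=> f0 r0 i i1; have [/f0 //|i0] := ltP i 0; rewrite (_ : i = 0) //; lia. Qed.

Lemma iota_res_exp p f n : vge p 0 f -> iota p (f ^+ n) 0 = (iota p f 0) ^+ n.
Proof.
move=> f0; elim: n => [|n IH]; first by rewrite rmorph1 lcoef1 eqxx.
rewrite !exprS rmorphM -[0 in LHS]addr0 lead_mul ?IH //.
exact: vgeX0.
Qed.

(** For a affine with a pole at oo, a^(#k(p)) - a vanishes at p by Fermat's little theorem and is
    nonzero because a is transcendental. *)
Lemma vanishing_element ps : oo \notin ps ->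
  exists a, [/\ a != 0, affine a & forall p, p \in ps -> vge p 1 a].
Proof.
move=> oops; have [a aA a_oo] := exists_affine_pole iotaP oo1.
have at_ := transcendental_pole iotaP a_oo.
pose F p := a ^+ (#|k| ^ degree p) - a.
have FA p : affine (F p) by apply: affineB => //; apply: affineX.
have N1 p : (1 < #|k| ^ degree p)%N.
  by rewrite -(expn0 #|k|) ltn_exp2l ?card_gt1 // degree_gt0.
have F0 p : F p != 0.
  have : 'X^(#|k| ^ degree p) - 'X != 0 :> {poly k}.
    rewrite -size_poly_eq0 size_polyDl ?size_polyXn // size_polyN size_polyX.
    exact: N1.
  by move/at_; rewrite pevalB pevalXn pevalX.
have Fp p : p != oo -> vge p 1 (F p).
  move=> po; apply: vge_res0; first exact: FA.
  by rewrite rmorphB lcoefB iota_res_exp ?residue_power ?subrr //; apply: aA.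
exists (\prod_(p <- ps) F p); split.
- by rewrite prodf_seq_neq0; apply/allP => p _; apply/implyP.
- by apply: affine_prod => p _.
move=> p pps; rewrite (big_rem p pps) /=; rewrite -[1]addr0.
have po : p != oo by apply: contraNneq oops => <-.
by apply: vgeM; [apply: Fp | apply: affine_prod].
Qed.

(** The poles of f away from oo are cancelled by a power of an affine function that vanishes at
    them. *)
Lemma denominator f : exists a, [/\ a != 0, affine a & affine (a * f)].
Proof.
have [Z [uZ ZP]] := finite_poles iotaP f.
have [|a [a0 aA aZ]] := @vanishing_element (rem oo Z).
  by rewrite mem_rem_uniqF.
have [n nP] := vge_seq_bounded iota Z f.
exists (a ^+ n); split; [exact: expf_neq0 | exact: affineX |].
move=> p po; have [fp|fp] := pselect (vge p 0 f).
  exact: (vgeMl (affineX n aA po) fp).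
have pZ : p \in Z by apply/ZP.
rewrite -(subrr n%:Z); apply: vgeM; last exact: nP.
by rewrite -[n%:Z]mul1r; apply: vgeX; apply: aZ; rewrite mem_rem_uniq // inE po.
Qed.

(* The function h provided by weak approximation may have other poles; they    *)
(* are cancelled by powers of the functions 1 - a^((#k(q) - 1) (n + 1)), which *)
(* vanish where a does not and are 1 modulo z^(n+1) where it does.             *)
Lemma strong_approximation ps (n : nat) (H : forall p, laurent (residue_field p)) :
  uniq ps -> oo \notin ps -> (forall p, p \in ps -> vanishes_below 0 (H p)) ->
  exists2 a, affine a & forall p, p \in ps -> vanishes_below n%:Z (iota p a - H p).
Proof.
move=> ups oops H0; have [a [a0 aA aps]] := vanishing_element oops.
have [Z [uZ ZP]] := finite_poles iotaP a^-1.
pose ps' := rem oo Z.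
have ps'P p : p != oo -> (p \in ps') = (p \in Z).
  by move=> po; rewrite mem_rem_uniq // inE po.
have ps'oo p : p \in ps' -> p != oo.
  by move=> pps; apply/eqP => e; move: pps; rewrite e mem_rem_uniqF.
have aZ p : p != oo -> p \notin ps' -> has_order (iota p a) 0 (iota p a 0).
  move=> po; rewrite ps'P // => /negP pZ.
  have ai : vge p 0 a^-1 by apply: contrapT => /ZP.
  have : ord p a = 0.
    move/vgeE: ai; rewrite invr_eq0 => /(_ a0); rewrite ordV //.
    by have := (vgeE iota p 0 a0).1 (aA p po); lia.
  have [c ao] := ordP iota p a0; move=> o0; rewrite o0 in ao.
  by case: ao => v0 vc c0; split => //; rewrite vc.
have ps'1 p : p \in ps' -> vge p 1 a.
  move=> pps; have po := ps'oo _ pps; move: pps; rewrite ps'P // => /ZP /vge_neg [_].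
  by rewrite ordV // => ?; apply/vgeE => //; lia.
have subps p : p \in ps -> p \in ps'.
  move=> pps; have po : p != oo by apply: contraNneq oops => <-.
  rewrite ps'P //; apply/ZP => /vgeE; rewrite invr_eq0 => /(_ a0); rewrite ordV //.
  by have := (vgeE iota p 1 a0).1 (aps p pps); lia.
pose H' p := if p \in ps then H p else 0.
have H'0 p : p \in ps' -> vanishes_below 0 (H' p).
  by move=> _; rewrite /H'; case: ifP => [/H0 //|_]; apply: vb0.
have [h hP] := prescribe iotaP n (rem_uniq _ uZ) H'0.
have h0 p : p \in ps' -> vge p 0 h.
  move=> pps; rewrite /vge (_ : iota p h = iota p h - H' p + H' p); last by rewrite subrK.
  by apply: vbD; [apply: vb_le (hP p pps) | apply: H'0].
have [W [uW WP]] := finite_poles iotaP h.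
have [M hM] := vge_seq_bounded iota W h.
pose S q := 1 - a ^+ ((#|k| ^ degree q).-1 * n.+1).
have SA q : affine (S q) by apply: affineB; [apply: affine1 | apply: affineX].
have Sq q : q != oo -> q \notin ps' -> vge q 1 (S q).
  move=> qo qps; have [a00 _ ar] := aZ q qo qps.
  apply: vge_res0; first exact: SA.
  rewrite rmorphB rmorph1 lcoefB lcoef1 eqxx iota_res_exp // exprM.
  have -> : iota q a 0 ^+ (#|k| ^ degree q).-1 = 1; last by rewrite expr1n subrr.
  apply: (mulfI ar); rewrite mulr1 -exprS prednK ?residue_power //.
  by rewrite expn_gt0 (ltnW card_gt1).
have S1 q p : p \in ps' -> vge p n%:Z (S q - 1).
  move=> /ps'1 a1; rewrite /S addrAC subrr add0r -sub0r; apply: vgeB; first exact: vge_0.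
  rewrite mulnC exprM; set e := (_ .-1).
  have e0 : (0 < e)%N.
    have := degree_gt0 q; have := card_gt1; rewrite /e -(ltn_exp2l 0 _ card_gt1) expn0.
    by move: (_ ^ _)%N => t; lia.
  rewrite -(prednK e0) exprS -[n%:Z]addr0; apply: vgeM.
    by apply: (@vge_le _ _ _ _ _ n.+1%:Z); [lia | rewrite -[n.+1%:Z]mul1r; apply: vgeX].
  by do 2![apply: vgeX0]; apply: vge_le a1.
pose W' := rem oo W.
pose T := \prod_(q <- W') S q ^+ M.
have TA : affine T by apply: affine_prod => q _; apply: affineX.
have T1 p : p \in ps' -> vge p n%:Z (T - 1).
  move=> pps; have po := ps'oo _ pps; apply: vge1_prod => q _.
    by apply: vgeX0; apply: SA.
  by apply: vge1_exp; [apply: SA | apply: S1].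
exists (h * T) => [p po|p pps].
  have [hp|hp] := pselect (vge p 0 h); first by apply: vgeMl => //; apply: TA.
  have pW : p \in W by apply/WP.
  have pps : p \notin ps' by apply/negP => /h0.
  rewrite -(addNr M%:Z); apply: vgeM; first exact: hM.
  have pW' : p \in W' by rewrite mem_rem_uniq // inE po.
  rewrite /T (big_rem p pW') /= -[M%:Z]addr0; apply: vgeM.
    by rewrite -[M%:Z]mul1r; apply: vgeX; apply: Sq.
  by apply: affine_prod po => q _; apply: affineX.
have pps' := subps _ pps.
have -> : iota p (h * T) - H p = iota p (h * (T - 1)) + (iota p h - H' p).
  by rewrite /H' pps addrA -rmorphD; congr (iota p _ - _); ring.
apply: vbD; last exact: hP.
by apply: (vgeMl (h0 _ pps') (T1 _ pps')).
Qed.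

End StrongApproximation.

(** * Pole numbers at the rational point and a basis of the affine ring *)

Lemma semigroup_conductor (W : nat -> Prop) : W 0 -> (forall m n, W m -> W n -> W (m + n)%N) ->
  (exists w, W w /\ W w.+1) -> exists c, forall n, (c <= n)%N -> W n.
Proof.
move=> W0 WD [w [Ww Ww1]].
have WM j n : W n -> W (j * n)%N.
  by move=> Wn; elim: j => [|j IH]; rewrite ?mul0n // mulSn; apply: WD.
have [w0|w0] := posnP w.
  by exists 0%N => n _; rewrite w0 in Ww1; rewrite -[n]muln1; apply: WM.
exists (w * w)%N => n wn.
have lt : (n %% w < w)%N by rewrite ltn_mod.
have le : (w <= n %/ w)%N by rewrite leq_divRL.
(* With q and r the quotient and the remainder of n by w, n is r copies of w + 1 and q - r copies of
   w; n >= w^2 ensures q >= r. *)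
have -> : n = ((n %/ w - n %% w) * w + (n %% w) * w.+1)%N.
  by rewrite {1}(divn_eq n w) mulnSr addnA -mulnDl subnK // ltnW // (leq_trans lt).
by apply: WD; apply: WM.
Qed.

Section AffineBasis.
Variables (k : finFieldType) (C : curve k).
Local Notation K := (function_field C).
Local Notation s := (constants C).
Variable iota : forall p : closed_point C, {rmorphism K -> laurent (residue_field p)}.
Hypothesis iotaP : forall p : closed_point C, laurent_expansion (iota p).
Variable oo : closed_point C.
Hypothesis oo1 : degree oo = 1%N.
Implicit Types (p q : closed_point C) (ps qs : seq (closed_point C)) (a f g h x y z : K).
Local Notation vge := (vge iota).
Local Notation ord := (ord iota).
Local Notation affine := (affine iota oo).

Lemma rational_scalar (z : residue_field oo) : exists c : k, z = c%:A.
Proof.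
have : z \in <[1]>%VS.
  suff -> : (<[1]> = {:residue_field oo})%VS by apply: memvf.
  apply/eqP; rewrite eqEdim subvf /= dim_vline oner_eq0.
  by rewrite -[\dim _]/(degree oo) oo1.
by move=> /vlineP [c ->]; exists c.
Qed.

Lemma affine_order a : affine a -> a != 0 -> exists (n : nat) (c : k),
  c != 0 /\ has_order (iota oo a) (- n%:Z) c%:A.
Proof.
move=> aA a0; have [z ao] := ordP iota oo a0.
have [c zc] := rational_scalar z; rewrite zc in ao.
exists `|ord oo a|%N, c; split.
  by case: ao => _ _; rewrite scaler_eq0 negb_or => /andP[].
suff <- : ord oo a = - `|ord oo a|%N%:Z by [].
suff : ord oo a <= 0 by lia.
rewrite leNgt; apply/negP => pos.
have a1 := (vgeE iota oo 1 a0).2 pos.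
by rewrite (affine_vanishing iotaP oo1 aA a1) eqxx in a0.
Qed.

Definition pole_number (n : nat) := exists a, affine a /\ has_order (iota oo a) (- n%:Z) 1.

Lemma affine_pole_number a (n : nat) (lc : residue_field oo) : affine a -> has_order (iota oo a) (- n%:Z) lc -> pole_number n.
Proof.
move=> aA; have [c ->] := rational_scalar lc => ao.
have c0 : c != 0 by case: ao => _ _; rewrite scaler_eq0 negb_or => /andP[].
exists (s c^-1 * a); split; first by apply: affineM => //; apply: affine_const.
have co : has_order (iota oo (s c^-1)) 0 (c^-1)%:A.
  rewrite (iota_const iotaP); split=> //; first exact: vb_lconst.
  by rewrite scaler_eq0 oner_eq0 invr_eq0 orbF.
have := has_orderM co ao.
by rewrite -rmorphM add0r -scalerAl mul1r scalerA mulVf // scale1r.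
Qed.

Lemma pole_number0 : pole_number 0.
Proof. by exists 1; split; [apply: affine1 | rewrite rmorph1; apply: has_order1]. Qed.

Lemma pole_numberD m n : pole_number m -> pole_number n -> pole_number (m + n).
Proof.
move=> [a [aA ao]] [b [bA bo]]; exists (a * b); split; first exact: affineM.
have := has_orderM ao bo; rewrite -rmorphM mulr1 (_ : _ + _ = - (m + n)%N%:Z) //; lia.
Qed.

(** For a uniformizer t at oo and a denominator a of t, the pole orders of a and of a t differ by
    1. *)
Lemma pole_number_consecutive : exists w, pole_number w /\ pole_number w.+1.
Proof.
have [t to] := uniformizer iotaP oo.
have [a [a0 aA atA]] := denominator iotaP oo1 t.
have t0 : t != 0 by apply/eqP => t0; have := has_order_neq0 to; rewrite t0 rmorph0 eqxx.
have [n [c [_ ao]]] := affine_order aA a0.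
have [m [d [_ ato]]] := affine_order atA (mulf_neq0 a0 t0).
have := has_orderM ao to; rewrite -rmorphM => /(has_order_unique ato) [nm _].
exists m; split; first exact: affine_pole_number ato.
by apply: affine_pole_number aA _; rewrite (_ : m.+1 = n); [exact: ao | lia].
Qed.

(** One function, with leading coefficient 1, is chosen for each pole number. The sequence w lists
    the pole numbers in increasing order and [ga] is the number of gaps. *)
Lemma affine_basis : exists (e : nat -> K) (w : nat -> nat) (ga r0 : nat),
  [/\ forall j, affine (e j) /\ has_order (iota oo (e j)) (- (w j)%:Z) 1,
      forall j, (w j < w j.+1)%N,
      forall j, (r0 <= j)%N -> w j = (j + ga)%N
    & forall n, pole_number n -> exists j, w j = n].
Proof.
have [c cP] := semigroup_conductor pole_number0 pole_numberD pole_number_consecutive.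
pose L := [seq n <- seq.iota 0 c | `[< pole_number n >]].
have LP n : (n \in L) = (n < c)%N && `[< pole_number n >].
  by rewrite mem_filter mem_iota add0n andbC.
have sL : sorted ltn L by apply: sorted_filter; [apply: ltn_trans | apply: iota_ltn_sorted].
have szL : (size L <= c)%N by rewrite size_filter (leq_trans (count_size _ _)) // size_iota.
pose w j := if (j < size L)%N then nth 0%N L j else (c + (j - size L))%N.
have wP j : pole_number (w j).
  rewrite /w; case: ltnP => jL; last by apply: cP; apply: leq_addr.
  by have := mem_nth 0%N jL; rewrite LP => /andP[_ /asboolP].
have /choice [e eP] j : exists a, affine a /\ has_order (iota oo a) (- (w j)%:Z) 1 by apply: wP.
exists e, w, (c - size L)%N, (size L); split=> //.
- move=> j; rewrite /w; case: (ltnP j.+1 (size L)) => [jL|jL].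
    by rewrite (ltnW jL); apply: (sorted_ltn_nth ltn_trans 0%N sL); rewrite ?inE // ltnW.
  case: (ltnP j (size L)) => jL'; last by rewrite ltn_add2l; lia.
  have : nth 0%N L j \in L by apply: mem_nth.
  by rewrite LP => /andP[/leq_trans -> //]; apply: leq_addr.
- by move=> j jL; rewrite /w ltnNge jL /=; lia.
move=> n nW; have [nc|cn] := ltnP n c.
  have nL : n \in L by rewrite LP nc; apply/asboolP.
  by exists (index n L); rewrite /w index_mem nL nth_index.
by exists (size L + (n - c))%N; rewrite /w ltnNge leq_addr /= addKn subnKC.
Qed.

End AffineBasis.

(* The geometric points over a closed point p are the embeddings of k(p) in F. *)
Section Coordinates.
Variables (k : finFieldType) (C : curve k).
Local Notation K := (function_field C).
Local Notation s := (constants C).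
Variable iota : forall p : closed_point C, {rmorphism K -> laurent (residue_field p)}.
Hypothesis iotaP : forall p : closed_point C, laurent_expansion (iota p).
Variable oo : closed_point C.
Hypothesis oo1 : degree oo = 1%N.
Variables (e : nat -> K) (w : nat -> nat) (ga r0 : nat).
Hypothesis eP : forall j, affine iota oo (e j) /\ has_order (iota oo (e j)) (- (w j)%:Z) 1.
Hypothesis w_incr : forall j, (w j < w j.+1)%N.
Hypothesis w_stable : forall j, (r0 <= j)%N -> w j = (j + ga)%N.
Hypothesis w_onto : forall n, pole_number iota oo n -> exists j, w j = n.
Local Notation affine := (affine iota oo).

Lemma w_lt i j : (i < j)%N -> (w i < w j)%N.
Proof.
elim: j => // j IH; rewrite ltnS leq_eqVlt => /orP[/eqP -> //|/IH lt].
exact: ltn_trans lt (w_incr j).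
Qed.

Lemma w_inj : injective w.
Proof.
by move=> i j ij; have [/w_lt|/w_lt|] := ltngtP i j; rewrite ?ij ?ltnn.
Qed.

Definition kspan (P : {poly k}) : K := \sum_(i < size P) s P`_i * e i.

Lemma kspanE n (P : {poly k}) : (size P <= n)%N -> kspan P = \sum_(i < n) s P`_i * e i.
Proof.
move=> Pn; rewrite /kspan (big_ord_widen n (fun i => s P`_i * e i)) // big_mkcond /=.
by apply: eq_bigr => i _; case: ltnP => // iP; rewrite nth_default // rmorph0 mul0r.
Qed.

Lemma kspanD P Q : kspan (P + Q) = kspan P + kspan Q.
Proof.
pose n := maxn (size P) (size Q).
rewrite !(@kspanE n) ?leq_maxl ?leq_maxr ?(leq_trans (size_polyD _ _)) // -big_split /=.
by apply: eq_bigr => i _; rewrite coefD rmorphD mulrDl.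
Qed.

Lemma kspan_monomial c j : kspan (c *: 'X^j) = s c * e j.
Proof.
rewrite (@kspanE j.+1); last by rewrite (leq_trans (size_scale_leq _ _)) // size_polyXn.
rewrite big_ord_recr /= coefZ coefXn eqxx mulr1 big1 ?add0r // => i _.
by rewrite coefZ coefXn ltn_eqF // mulr0 rmorph0 mul0r.
Qed.

(** Subtracting the multiple of the e j with the same polar term lowers the pole order at oo; the
    process ends because an affine function vanishing at oo is 0. *)
Lemma kspan_onto a : affine a -> exists P, a = kspan P.
Proof.
move=> aA.
have [n an] : exists n : nat, vge iota oo (1 - n%:Z) a.
  have [n an] := vge_bounded iota oo a; exists n.+1; rewrite (_ : 1 - _ = - n%:Z) //; lia.
elim: n a aA an => [|n IH] a aA an.
  by exists 0; rewrite (affine_vanishing iotaP oo1 aA an) /kspan size_poly0 big_ord0.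
have [a1|a1] := pselect (vge iota oo (1 - n%:Z) a); first exact: IH.
have a0 : a != 0 by apply/eqP => a0; apply: a1; rewrite a0; apply: vge_0.
have [m [c [c0 ao]]] := affine_order iotaP oo1 aA a0.
have mn : m = n.
  have /(order_vb _ ao) := an.
  have : ~ (1 - n%:Z <= - m%:Z) by move/(order_vb _ ao).
  by lia.
have [j wj] := w_onto (affine_pole_number iotaP oo1 aA ao).
have [eA eo] := eP j.
have bA : affine (a - s c * e j) by apply: affineB => //; apply: affineM => //; apply: affine_const.
have [|P PE] := IH _ bA.
  move=> i iN; rewrite rmorphB lcoefB (lcoef_constM iotaP).
  move: ao eo; rewrite wj mn => -[av ac _] [ev ec _].
  have [lt|ge] := ltP i (- n%:Z); first by rewrite av // ev // scaler0 subrr.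
  have -> : i = - n%:Z by lia.
  by rewrite ac ec subrr.
exists (P + c *: 'X^j); rewrite kspanD kspan_monomial -PE; ring.
Qed.

Section Place.
Variables (F : fieldType) (io : {rmorphism k -> F}).

Section Span.
Variable xi : {rmorphism K -> laurent F}.
Hypothesis xi_const : forall c, xi (s c) = lconst (io c).

(** The expansion at a geometric point of the function with coordinates P and constants in F. *)
Definition fspan (P : {poly F}) : laurent F := \sum_(i < size P) lconst P`_i * xi (e i).

Lemma fspanE n (P : {poly F}) : (size P <= n)%N -> fspan P = \sum_(i < n) lconst P`_i * xi (e i).
Proof.
move=> Pn; rewrite /fspan (big_ord_widen n (fun i => lconst P`_i * xi (e i))) // big_mkcond /=.
by apply: eq_bigr => i _; case: ltnP => // iP; rewrite nth_default // rmorph0 mul0r.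
Qed.

Lemma fspanD P Q : fspan (P + Q) = fspan P + fspan Q.
Proof.
pose n := maxn (size P) (size Q).
rewrite !(@fspanE n) ?leq_maxl ?leq_maxr ?(leq_trans (size_polyD _ _)) // -big_split /=.
by apply: eq_bigr => i _; rewrite coefD rmorphD mulrDl.
Qed.

Lemma fspanZ c P : fspan (c *: P) = lconst c * fspan P.
Proof.
rewrite !(@fspanE (size P)) ?size_scale_leq // mulr_sumr.
by apply: eq_bigr => i _; rewrite coefZ rmorphM mulrA.
Qed.

Lemma fspan0 : fspan 0 = 0.
Proof. by rewrite -(scale0r 0) fspanZ rmorph0 mul0r. Qed.

Lemma fspan_sum (I : Type) (r : seq I) (c : I -> F) (P : I -> {poly F}) :
  fspan (\sum_(i <- r) c i *: P i) = \sum_(i <- r) lconst (c i) * fspan (P i).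
Proof.
elim: r => [|i r IH]; last by rewrite !big_cons fspanD fspanZ IH.
by rewrite !big_nil fspan0.
Qed.

Lemma fspan_map P : fspan (map_poly io P) = xi (kspan P).
Proof.
rewrite (@fspanE (size P)) ?size_poly // rmorph_sum.
by apply: eq_bigr => i _; rewrite coef_map rmorphM xi_const.
Qed.

Lemma fspan_order P : (forall j, has_order (xi (e j)) (- (w j)%:Z) 1) -> P != 0 ->
  has_order (fspan P) (- (w (size P).-1)%:Z) (lead_coef P).
Proof.
move=> eo P0; have sP : size P = (size P).-1.+1 by rewrite prednK // size_poly_gt0.
rewrite (fspanE (eq_leq sP)) lead_coefE big_ord_recr /=.
have lc : P`_(size P).-1 != 0 by rewrite -lead_coefE lead_coef_eq0.
have [v1 v2 _] := eo (size P).-1.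
set n := (size P).-1 in lc sP v1 v2 *.
have small : vanishes_below (1 - (w n)%:Z) (\sum_(i < n) lconst P`_i * xi (e i)).
  apply: vb_sum => i _ t tn; rewrite lconst_mulE.
  have [vi _ _] := eo i; rewrite vi ?mulr0 //.
  by have := w_lt (ltn_ord i); lia.
split=> //.
  apply: vbD; first by apply: vb_le small; lia.
  by move=> t tn; rewrite lconst_mulE v1 ?mulr0.
by rewrite lcoefD lconst_mulE v2 mulr1 small ?add0r //; lia.
Qed.
End Span.

Variables (X : Type) (xi : X -> {rmorphism K -> laurent F}).
Hypothesis xi_const : forall x c, xi x (s c) = lconst (io c).
Variable x0 : X.
Hypothesis xi0 : forall j, has_order (xi x0 (e j)) (- (w j)%:Z) 1.
Local Notation ev x P := (fspan (xi x) P).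

Lemma fspan_inj P Q : ev x0 P = ev x0 Q -> P = Q.
Proof.
move=> PQ; apply/eqP; rewrite -subr_eq0; apply/negPn/negP => PQ0.
have := has_order_neq0 (fspan_order xi0 PQ0).
by rewrite -scaleN1r fspanD fspanZ PQ rmorphN rmorph1 mulN1r subrr eqxx.
Qed.

(** The structure constants of the affine ring on the basis e lie in k, so that one R serves at all
    points x. *)
Lemma fspan_mul P Q : exists R, forall x, ev x R = ev x P * ev x Q.
Proof.
have /choice [T TE] (ij : nat * nat) : exists R, e ij.1 * e ij.2 = kspan R.
  by apply: kspan_onto; apply: affineM; apply: (eP _).1.
exists (\sum_(i < size P) 1 *: \sum_(j < size Q) (P`_i * Q`_j) *: map_poly io (T (i : nat, j : nat))).
move=> x; rewrite fspan_sum {2}/fspan mulr_suml; apply: eq_bigr => i _.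
rewrite rmorph1 mul1r fspan_sum [X in _ = _ * X]/fspan mulr_sumr; apply: eq_bigr => j _.
by rewrite /= (fspan_map (xi_const x)) -TE /= !rmorphM; ring.
Qed.

Lemma multiplication_op P : P \is monic -> exists M : {poly F} -> {poly F},
  graded_op (w (size P).-1) r0 M /\ forall x Q, ev x (M Q) = ev x P * ev x Q.
Proof.
move=> Pm; have P0 := monic_neq0 Pm.
have /choice [R RE] j := fspan_mul P 'X^j.
pose M (Q : {poly F}) := \sum_(j < size Q) Q`_j *: R j.
have ME n (Q : {poly F}) : (size Q <= n)%N -> M Q = \sum_(j < n) Q`_j *: R j.
  move=> Qn; rewrite /M (big_ord_widen n (fun i => Q`_i *: R i)) // big_mkcond /=.
  by apply: eq_bigr => i _; case: ltnP => // iP; rewrite nth_default // scale0r.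
have MX i : M 'X^i = R i.
  rewrite (@ME i.+1) ?size_polyXn // big_ord_recr /= coefXn eqxx scale1r big1 ?add0r // => j _.
  by rewrite coefXn ltn_eqF // scale0r.
have evX x i : ev x 'X^i = xi x (e i).
  rewrite (@fspanE _ i.+1) ?size_polyXn // big_ord_recr /= coefXn eqxx rmorph1 mul1r big1 ?add0r // => j _.
  by rewrite coefXn ltn_eqF // rmorph0 mul0r.
have Ro i : has_order (ev x0 (R i)) (- (w (size P).-1)%:Z + - (w i)%:Z) 1.
  rewrite RE evX; have := has_orderM (fspan_order xi0 P0) (xi0 i).
  by rewrite (monicP Pm) mulr1.
have R0 i : R i != 0.
  by apply/eqP => Ri; have := has_order_neq0 (Ro i); rewrite Ri fspan0 eqxx.
have RwP i : w (size (R i)).-1 = (w (size P).-1 + w i)%N /\ lead_coef (R i) = 1.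
  by have [? ?] := has_order_unique (fspan_order xi0 (R0 i)) (Ro i); split=> //; lia.
have Rsz i : size (R i) = (size (R i)).-1.+1 by rewrite prednK // size_poly_gt0.
exists M; split.
  split=> [Q Q'|c Q|i|i|r rr].
  - pose n := maxn (size Q) (size Q').
    rewrite !(@ME n) ?leq_maxl ?leq_maxr ?(leq_trans (size_polyD _ _)) // -big_split /=.
    by apply: eq_bigr => i _; rewrite coefD scalerDl.
  - rewrite !(@ME (size Q)) ?size_scale_leq // scaler_sumr.
    by apply: eq_bigr => i _; rewrite coefZ scalerA.
  - by rewrite MX monicE (RwP i).2.
  - rewrite !MX Rsz [X in (_ < X)%N]Rsz ltnS ltnNge; apply/negP => le.
    have : (w (size (R i.+1)).-1 <= w (size (R i)).-1)%N.
      by move: le; rewrite leq_eqVlt => /orP[/eqP -> //|/w_lt/ltnW].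
    by rewrite !(RwP _).1; have := w_incr i; lia.
  (* The product has pole order w (deg P) + r + ga at oo, which is the value of w at the index r + w
     (deg P). *)
  rewrite MX Rsz; congr _.+1; apply: w_inj.
  rewrite (RwP r).1 (w_stable rr) (@w_stable (r + _)); last exact: leq_trans rr (leq_addr _ _).
  by lia.
move=> x Q; rewrite /M fspan_sum [in RHS]/fspan mulr_sumr; apply: eq_bigr => j _.
by rewrite RE evX mulrCA.
Qed.
End Place.
End Coordinates.

(** * Weil reciprocity for regular functions *)

Section Shuffle.
Variables (F : fieldType) (X : eqType).
Local Notation V := {poly F}.

(** The number of transpositions that bring all A-blocks before all B-blocks when the blocks are
    sorted by points. *)
Fixpoint inversions (a b : X -> nat) (xs : seq X) : nat :=
  if xs is x :: xs' then (b x * \sum_(y <- xs') a y + inversions a b xs')%N else 0%N.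

(** This accounts for the signs in the reciprocity law: the inversions for both orders of the
    blocks, together with the local exponents a x b x, make up the product of the degrees, which is
    the exponent at oo. *)
Lemma inversions_sum a b xs :
  (inversions a b xs + inversions b a xs + \sum_(x <- xs) a x * b x =
   (\sum_(x <- xs) a x) * (\sum_(x <- xs) b x))%N.
Proof.
elim: xs => [|x xs IH]; first by rewrite !big_nil.
by rewrite !big_cons mulnDl !mulnDr -IH /=; ring.
Qed.

Lemma size_flatten_map (A : X -> seq V) xs :
  size (flatten (map A xs)) = (\sum_(x <- xs) size (A x))%N.
Proof. by elim: xs => [|x xs IH]; rewrite ?big_nil // big_cons /= size_cat IH. Qed.

Lemma seq_det_unshuffle n phi (A B : X -> seq V) xs s1 :
  n = size (s1 ++ flatten [seq A x ++ B x | x <- xs]) ->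
  seq_det n phi (s1 ++ flatten [seq A x ++ B x | x <- xs]) =
  (-1) ^+ inversions (size \o A) (size \o B) xs *
    seq_det n phi (s1 ++ flatten (map A xs) ++ flatten (map B xs)).
Proof.
elim: xs s1 => [|x xs IH] s1 nE; first by rewrite mul1r.
have szE : (size (flatten [seq A x ++ B x | x <- xs]) =
    size (flatten (map A xs)) + size (flatten (map B xs)))%N.
  rewrite !size_flatten_map -big_split /=.
  by apply: eq_bigr => y _; rewrite size_cat.
have -> : s1 ++ flatten [seq A x ++ B x | x <- x :: xs] =
    (s1 ++ A x ++ B x) ++ flatten [seq A x ++ B x | x <- xs] by rewrite /= !catA.
rewrite IH; last by rewrite nE /= !catA.
have -> : (s1 ++ A x ++ B x) ++ flatten (map A xs) ++ flatten (map B xs) =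
    (s1 ++ A x) ++ B x ++ flatten (map A xs) ++ flatten (map B xs) by rewrite !catA.
rewrite seq_det_cat_swap; last first.
  by rewrite nE; do 4 rewrite /= ?size_cat; rewrite szE; lia.
rewrite mulrA -exprD /= !catA addnC size_flatten_map.
by rewrite -!catA.
Qed.

Lemma seq_det_triangular n phi (s : seq V) :
  (forall i j, (j < i)%N -> (i < n)%N -> phi j s`_i = 0) ->
  seq_det n phi s = \prod_(i < n) phi i s`_i.
Proof.
move=> tri; rewrite /seq_det -det_tr det_trig.
  by apply: eq_bigr => i _; rewrite !mxE.
by apply/is_trig_mxP => i j ij; rewrite !mxE tri.
Qed.

Definition positions (N : X -> nat) (xs : seq X) : seq (X * nat) :=
  [seq (x, j) | x <- xs, j <- seq.iota 0 (N x)].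

Lemma positions_pairwise N xs : uniq xs ->
  pairwise (fun t t' : X * nat => (t.1 == t'.1) ==> (t.2 < t'.2)%N) (positions N xs).
Proof.
rewrite /positions; elim: xs => //= x xs IH /andP[xxs uxs].
rewrite pairwise_cat IH // andbT; apply/andP; split.
  apply/allrelP => _ _ /mapP [j _ ->] /allpairsPdep [y [l [yxs _ ->]]] /=.
  by apply/implyP => /eqP e; rewrite -e (negPf xxs) in yxs.
rewrite pairwise_map; have := iota_ltn_sorted 0 (N x).
rewrite sorted_pairwise; last exact: ltn_trans.
by apply: sub_pairwise => i j ij /=; rewrite eqxx.
Qed.

Lemma positionsP N xs x j : (x, j) \in positions N xs = (x \in xs) && (j < N x)%N.
Proof.
apply/allpairsPdep/andP => [[y [l [yxs]]]|[xxs jN]].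
  by rewrite mem_iota add0n => /= lN [-> ->].
by exists x, j; rewrite mem_iota add0n.
Qed.

Lemma size_positions N xs : size (positions N xs) = (\sum_(x <- xs) N x)%N.
Proof.
rewrite /positions; elim: xs => [|x xs IH]; first by rewrite big_nil.
by rewrite big_cons /= size_cat size_map size_iota IH.
Qed.

Lemma map_positions (row : X -> nat -> V) (a b : X -> nat) xs :
  [seq row t.1 t.2 | t <- positions (fun x => a x + b x)%N xs] =
  flatten [seq mkseq (row x) (a x) ++ mkseq (fun j => row x (a x + j)%N) (b x) | x <- xs].
Proof.
rewrite /positions; elim: xs => //= x xs IH; rewrite map_cat -IH; congr (_ ++ _).
rewrite -map_comp iotaD map_cat; congr (_ ++ _).
by rewrite add0n -[a x]addn0 iotaDl -map_comp addn0.
Qed.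

Lemma flatten_mkseq (row : X -> nat -> V) (a : X -> nat) xs :
  flatten [seq mkseq (row x) (a x) | x <- xs] = [seq row t.1 t.2 | t <- positions a xs].
Proof.
rewrite /positions; elim: xs => //= x xs ->; rewrite map_cat; congr (_ ++ _).
by rewrite -map_comp.
Qed.
End Shuffle.

Section GeometricPoints.
Variables (k : finFieldType) (C : curve k).
Local Notation K := (function_field C).
Local Notation s := (constants C).
Variable iota : forall p : closed_point C, {rmorphism K -> laurent (residue_field p)}.
Hypothesis iotaP : forall p : closed_point C, laurent_expansion (iota p).
Variable oo : closed_point C.
Hypothesis oo1 : degree oo = 1%N.
Variables (e : nat -> K) (w : nat -> nat) (ga r0 : nat).
Hypothesis eP : forall j, affine iota oo (e j) /\ has_order (iota oo (e j)) (- (w j)%:Z) 1.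
Hypothesis w_incr : forall j, (w j < w j.+1)%N.
Hypothesis w_stable : forall j, (r0 <= j)%N -> w j = (j + ga)%N.
Hypothesis w_onto : forall n, pole_number iota oo n -> exists j, w j = n.
Local Notation affine := (affine iota oo).
Local Notation vge := (vge iota).
Local Notation ord := (ord iota).

Variables (F : fieldType) (io : {rmorphism k -> F}).
Variable sig : forall p : closed_point C, nat -> {rmorphism residue_field p -> F}.
Hypothesis sig_const : forall p i c, sig p i c%:A = io c.
(** That is, the matrix of the embeddings on a basis of k(p) is invertible: constants in F separate
    the points over p. *)
Hypothesis sig_dual : forall p (i : 'I_(degree p)), exists c : 'I_(degree p) -> F,
  forall i' : 'I_(degree p), \sum_l c l * sig p i' (kbasis p l) = (i == i')%:R.

Local Notation X := (closed_point C * nat)%type.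
Definition xi (x : X) : {rmorphism K -> laurent F} := lmap (sig x.1 x.2) \o iota x.1.
Definition points (ps : seq (closed_point C)) : seq X := positions (@degree k C) ps.
Local Notation ev x P := (fspan e (xi x) P).
Local Notation x0 := ((oo, 0%N) : X).

Lemma xi_const x c : xi x (s c) = lconst (io c).
Proof. by rewrite /xi /= (iota_const iotaP) lmap_lconst sig_const. Qed.

Lemma xi_oo j : has_order (xi x0 (e j)) (- (w j)%:Z) 1.
Proof. by rewrite -(rmorph1 (sig oo 0)); apply: order_lmap; apply: (eP j).2. Qed.

Lemma ev_vge0 x P : x.1 != oo -> vanishes_below 0 (ev x P).
Proof.
move=> xo; apply: vb_sum => i _; rewrite -[0]addr0; apply: vbM; first exact: vb_lconst.
by apply: vb_lmap; apply: (eP i).1.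
Qed.

Lemma points_uniq ps : uniq ps -> uniq (points ps).
Proof.
move=> ups; apply: allpairs_uniq_dep => //; first by move=> p _; apply: iota_uniq.
by move=> [p i] [q j] _ _ /= [-> ->].
Qed.

(** Strong approximation over k prescribes the leading coefficients as basis elements of k(p);
    combining these functions with the dual coefficients isolates a single embedding. *)
Lemma geometric_approximation ps (n : nat) : uniq ps -> oo \notin ps ->
  exists gam : X -> nat -> {poly F}, forall x j y, x \in points ps -> y \in points ps ->
    (j < n)%N -> vanishes_below n%:Z (ev y (gam x j) - (if y == x then zpow F j%:Z else 0)).
Proof.
move=> ups oops.
pose H (p : closed_point C) (l j : nat) (q : closed_point C) : laurent (residue_field q) :=
  if q == p then lconst (kbasis q l) * zpow _ j%:Z else 0.
have H0 p l j q : q \in ps -> vanishes_below 0 (H p l j q).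
  move=> _; rewrite /H; case: ifP => _; last exact: vb0.
  rewrite -[0]addr0; apply: vbM; first exact: vb_lconst.
  by apply: (@vb_le _ 0 j%:Z) => //; apply: vb_zpow.
have /choice [R RP] (plj : closed_point C * nat * nat) : exists R : {poly k},
    forall q, q \in ps -> vanishes_below n%:Z (iota q (kspan e R) - H plj.1.1 plj.1.2 plj.2 q).
  have [a aA aH] := strong_approximation iotaP oo1 n ups oops (H0 plj.1.1 plj.1.2 plj.2).
  have [R RE] := kspan_onto iotaP oo1 eP w_onto aA.
  by exists R; rewrite -RE.
have /choice [c cP] (x : X) : exists c : nat -> F, forall i' : nat,
    (x.2 < degree x.1)%N -> (i' < degree x.1)%N ->
    \sum_(l < degree x.1) c l * sig x.1 i' (kbasis x.1 l) = (x.2 == i')%:R.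
  have [lt|ge] := ltnP x.2 (degree x.1); last by exists (fun=> 0).
  have [c cP] := sig_dual (Ordinal lt); pose c' l := if insub l is Some l' then c l' else 0.
  exists c' => i' _ i'd; rewrite -[_ == _]/(Ordinal lt == Ordinal i'd) -cP.
  by apply: eq_bigr => l _; rewrite /c' valK.
exists (fun x j => \sum_(l < degree x.1) c x l *: map_poly io (R (x.1, l : nat, j))).
move=> x j y; case: x => p i; case: y => q i'; rewrite !positionsP.
move=> /andP[pps id] /andP[qps i'd] jn /=.
rewrite fspan_sum.
under eq_bigr => l _ do rewrite (fspan_map e (xi_const _)) /xi /=.
have -> : (if (q, i') == (p, i) then zpow F j%:Z else 0) =
    \sum_(l < degree p) lconst (c (p, i) l) * lmap (sig q i') (H p l j q).
  rewrite xpair_eqE /H; case: eqP => [qp|_] /=; last first.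
    by rewrite big1 // => l _; rewrite rmorph0 mulr0.
  subst q.
  transitivity (lconst (\sum_(l < degree p) c (p, i) l * sig p i' (kbasis p l)) * zpow F j%:Z).
    by rewrite (cP (p, i)) // eq_sym; case: eqP => _; rewrite ?rmorph1 ?mul1r // rmorph0 mul0r.
  rewrite rmorph_sum mulr_suml; apply: eq_bigr => l _.
  by rewrite [in RHS]rmorphM /= lmap_lconst lmap_zpow mulrA -rmorphM.
move=> t tn; rewrite -lcoefB -sumrB; move: t tn; apply: vb_sum => l _.
rewrite -mulrBr -rmorphB -[n%:Z]add0r; apply: vbM; first exact: vb_lconst.
by apply: vb_lmap; apply: (RP (p, l : nat, j)).
Qed.

Lemma points_oo ps x : oo \notin ps -> x \in points ps -> x.1 != oo.
Proof.
case: x => p i oops; rewrite positionsP => /andP[pps _] /=.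
by apply: contraNneq oops => <-.
Qed.

Definition pointwise_coef (L : seq (X * nat)) (t : nat) (P : {poly F}) : F :=
  ev (nth (x0, 0%N) L t).1 P (nth (x0, 0%N) L t).2%:Z.

Lemma pointwise_coef_lin L t : lin_form (pointwise_coef L t).
Proof.
by split=> [P Q|c P]; rewrite /pointwise_coef ?fspanD // fspanZ lconst_mulE.
Qed.

Lemma seq_det_pointwise (N : X -> nat) ps (row : X -> nat -> {poly F}) (d : X -> nat -> F) :
  uniq ps -> (forall x j y l, x \in points ps -> y \in points ps -> (j < N x)%N -> (l < N y)%N ->
    x != y -> ev y (row x j) l%:Z = 0) ->
  (forall x j, x \in points ps -> (j < N x)%N ->
    vanishes_below j%:Z (ev x (row x j)) /\ ev x (row x j) j%:Z = d x j) ->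
  seq_det (\sum_(x <- points ps) N x) (pointwise_coef (positions N (points ps)))
    [seq row t.1 t.2 | t <- positions N (points ps)] =
  \prod_(x <- points ps) \prod_(0 <= j < N x) d x j.
Proof.
move=> ups off diag; set L := positions N (points ps).
have sL : size L = (\sum_(x <- points ps) N x)%N by apply: size_positions.
have nthP t : (t < size L)%N -> (nth (x0, 0%N) L t).1 \in points ps /\
    ((nth (x0, 0%N) L t).2 < N (nth (x0, 0%N) L t).1)%N.
  by move=> /(mem_nth (x0, 0%N)); case: nth => x j; rewrite positionsP => /andP[].
rewrite seq_det_triangular => [|i j ji]; rewrite -sL.
  transitivity (\prod_(t <- L) d t.1 t.2).
    rewrite (big_nth (x0, 0%N)) big_mkord; apply: eq_bigr => i _.
    have [xi_ ji] := nthP i (ltn_ord i).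
    by rewrite (nth_map (x0, 0%N)) //; apply: (diag _ _ xi_ ji).2.
  rewrite /L /positions big_allpairs_dep; apply: eq_bigr => x _.
  by rewrite /index_iota subn0.
move=> iL; have jL := ltn_trans ji iL.
rewrite (nth_map (x0, 0%N)) // /pointwise_coef.
have [xi_ ji_] := nthP i iL; have [xj_ jj_] := nthP j jL.
have /(pairwiseP (x0, 0%N))/(_ j i jL iL ji) := positions_pairwise N (points_uniq ups).
have [e_ /= lt|ne _] := eqVneq (nth (x0, 0%N) L j).1 (nth (x0, 0%N) L i).1.
  by rewrite e_; apply: (diag _ _ xi_ ji_).1.
by apply: off => //; rewrite eq_sym.
Qed.

Section Approximants.
Variables (ps : seq (closed_point C)) (n : nat) (gam : X -> nat -> {poly F}).
Hypothesis oops : oo \notin ps.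
Hypothesis gamP : forall x j y, x \in points ps -> y \in points ps -> (j < n)%N ->
  vanishes_below n%:Z (ev y (gam x j) - (if y == x then zpow F j%:Z else 0)).

Lemma gam_off x j y : x \in points ps -> y \in points ps -> (j < n)%N -> x != y ->
  vanishes_below n%:Z (ev y (gam x j)).
Proof.
move=> xps yps jn; rewrite eq_sym => /negPf xy.
by have := gamP xps yps jn; rewrite xy subr0.
Qed.

Lemma gam_diag x j : x \in points ps -> (j < n)%N -> has_order (ev x (gam x j)) j%:Z 1.
Proof.
move=> xps jn; have := gamP xps xps jn; rewrite eqxx => vz.
have E t : t < n%:Z -> ev x (gam x j) t = (t == j%:Z)%:R.
  by move=> /vz /eqP; rewrite lcoefB subr_eq0 => /eqP.
split; rewrite ?oner_eq0 ?E ?eqxx // => t tj.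
by rewrite E ?lt_eqF //; apply: lt_trans tj _.
Qed.
End Approximants.

Lemma sum_bound (T : eqType) (r : seq T) (f : T -> nat) x : x \in r -> (f x <= \sum_(y <- r) f y)%N.
Proof. by move=> xr; rewrite (big_rem x xr) leq_addr. Qed.

(** The expansion coefficients of index less than m x vanish on multiples of P and are independent
    on suitable approximants, while multiplication by P has an image of codimension at most the pole
    order. *)
Lemma affine_zeros_le P ps (m : X -> nat) : P \is monic -> uniq ps -> oo \notin ps ->
  (forall x, x \in points ps -> vanishes_below (m x)%:Z (ev x P)) ->
  (\sum_(x <- points ps) m x <= w (size P).-1)%N.
Proof.
move=> Pm ups oops Pv.
have [M [opM MP]] := multiplication_op iotaP oo1 eP w_incr w_stable w_onto xi_const xi_oo Pm.
pose n := (\sum_(x <- points ps) m x)%N.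
have [gam gamP] := geometric_approximation n ups oops.
have mn x j : x \in points ps -> (j < m x)%N -> (j < n)%N.
  by move=> /(sum_bound m) mx /leq_trans; apply.
pose L := positions m (points ps).
have sL : size L = n by apply: size_positions.
have nthP t : (t < n)%N -> (nth (x0, 0%N) L t).1 \in points ps /\
    ((nth (x0, 0%N) L t).2 < m (nth (x0, 0%N) L t).1)%N.
  by rewrite -sL => /(mem_nth (x0, 0%N)); case: nth => x j; rewrite positionsP => /andP[].
apply: (quotient_dim_le opM (pointwise_coef_lin L) (X := [seq gam t.1 t.2 | t <- L])).
- move=> j Q /nthP [xps jm]; rewrite /pointwise_coef MP -/L.
  have := vbM (Pv _ xps) (ev_vge0 Q (points_oo oops xps)); rewrite addr0; apply.
  by rewrite ltz_nat.
- by rewrite size_map sL.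
rewrite (seq_det_pointwise (d := fun _ _ => 1)) //.
- by rewrite big1 ?oner_eq0 // => x _; rewrite big1.
- move=> x j y l xps yps jm lm xy.
  by apply: (gam_off gamP) => //; [apply: mn jm | rewrite ltz_nat; apply: mn lm].
by move=> x j xps jm; have [? ? _] := gam_diag gamP xps (mn _ _ xps jm).
Qed.

Lemma kspan_order (P : {poly k}) : P != 0 ->
  has_order (iota oo (kspan e P)) (- (w (size P).-1)%:Z) (lead_coef P)%:A.
Proof.
move=> P0; rewrite -(fspan_map e (io := in_alg _) (iota_const iotaP oo)).
have := fspan_order oo1 w_incr (xi := iota oo) (P := map_poly (in_alg _) P) (fun j => (eP j).2).
by rewrite map_poly_eq0 size_map_poly lead_coef_map => /(_ P0).
Qed.

Lemma kspan_inj (P : {poly k}) : kspan e P = 0 -> P = 0.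
Proof.
move=> P0; apply/eqP/negPn/negP => /kspan_order /has_order_neq0.
by rewrite P0 rmorph0 eqxx.
Qed.

(** Divide by a the span of the first r + d basis functions. Elements with the same polar parts at
    the zeros of a differ by an affine function of small pole order, lying in the span of the first
    r basis functions. Hence at least #k^d polar parts occur. *)
Lemma affine_zeros_ge a (d : nat) c ps (m : closed_point C -> nat) : affine a ->
  has_order (iota oo a) (- d%:Z) c -> uniq ps -> oo \notin ps ->
  (forall p, p != oo -> p \notin ps -> ~ vge p 1 a) ->
  (forall p, p \in ps -> ord p a = (m p)%:Z) ->
  (d <= \sum_(p <- ps) m p * degree p)%N.
Proof.
move=> aA ao ups oops azero am.
have a0 : a != 0 by apply/eqP => a0; have := has_order_neq0 ao; rewrite a0 rmorph0 eqxx.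
have [T [loc [cT locP]]] := polar_parts iota oo1 m ups.
(* From r0 on w is a translation, so a pole of order d shifts indices by exactly d. *)
pose r := r0.
pose val (t : {ffun 'I_(r + d) -> k}) : K := \sum_i s (t i) * e i.
have valA t : affine (val t).
  move=> p po; apply: vge_sum => i _; apply: vgeMl; first exact: vge_const.
  exact: (eP i).1.
have valB t t' : val t - val t' = \sum_i s (t i - t' i) * e i.
  by rewrite /val -sumrB; apply: eq_bigr => i _; rewrite rmorphB mulrBl.
have kspan_poly n (t : 'I_n -> k) : \sum_i s (t i) * e i =
    kspan e (\sum_(i < n) t i *: 'X^i).
  elim: n t => [|n IH] t; first by rewrite !big_ord0 /kspan size_poly0 big_ord0.
  by rewrite !big_ord_recr /= kspanD kspan_monomial -IH.
have val_inj : injective val.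
  move=> t t' tt; have := valB t t'; rewrite tt subrr kspan_poly => /esym/kspan_inj.
  move=> /polyP P0; apply/ffunP => i; have := P0 i; rewrite coef_sum coef0 (bigD1 i) //=.
  rewrite coefZ coefXn eqxx mulr1 big1 ?addr0 => [/eqP|j ji]; first by rewrite subr_eq0 => /eqP.
  by rewrite coefZ coefXn eq_sym -[_ == _]/(j == i) (negPf ji) mulr0.
have ai p : p \in ps -> vge p (- (m p)%:Z) a^-1.
  by move=> pps; apply/vgeE; rewrite ?invr_eq0 // ordV // am.
have polar t p : p \in ps -> vge p (- (m p)%:Z) (val t / a).
  move=> pps; apply: vgeMl; last exact: ai.
  by apply: valA; apply: contraNneq oops => <-.
pose rep (tau : T) := xget [ffun=> 0] [set t | loc (val t / a) = tau].
have repP t : loc (val (rep (loc (val t / a))) / a) = loc (val t / a).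
  by rewrite /rep; case: xgetP => [t' -> //|/(_ t)]; case.
have /choice [G GP] t : exists c : {ffun 'I_r -> k},
    val t - val (rep (loc (val t / a))) = a * \sum_i s (c i) * e i.
  set t' := rep _; pose h := (val t - val t') / a.
  have hA : affine h.
    move=> p po; have [pps|pps] := boolP (p \in ps).
      rewrite /h mulrBl; apply: (locP (val t / a) (val t' / a)) => //; try by move=> q; apply: polar.
      by rewrite -repP.
    apply: vgeMl; first by apply: vgeB; apply: valA.
    apply/vgeE; rewrite ?invr_eq0 // ordV //.
    by have := azero p po pps; rewrite vgeE // => /negP; lia.
  have [P hP] := kspan_onto iotaP oo1 eP w_onto hA.
  have sP : (size P <= r)%N.
    have [->|P0] := eqVneq P 0; first by rewrite size_poly0.
    have ho := kspan_order P0; rewrite -hP in ho.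
    have := valB t t'; rewrite kspan_poly; set Q := \sum_(i < _) _ => dE.
    have Q0 : Q != 0.
      apply/eqP => Q0; have := has_order_neq0 ho.
      by rewrite /h dE Q0 /kspan size_poly0 big_ord0 mul0r rmorph0 eqxx.
    have sQ : (size Q <= r + d)%N.
      apply: leq_trans (size_sum _ _ _) _; apply/bigmax_leqP => i _.
      by apply: leq_trans (size_scale_leq _ _) _; rewrite size_polyXn.
    have := has_orderM ho ao; rewrite -rmorphM /h mulfVK // dE.
    move=> /(has_order_unique (kspan_order Q0)) [wE _].
    have wQ : (w (size Q).-1 < w (r + d))%N.
      by apply: (w_lt w_incr); rewrite prednK // size_poly_gt0.
    rewrite leqNgt; apply/negP => rP.
    have wr : (w r <= w (size P).-1)%N.
      have : (r <= (size P).-1)%N by lia.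
      by rewrite leq_eqVlt => /orP[/eqP -> //|/(w_lt w_incr)/ltnW].
    have w1 : w (r + d) = (r + d + ga)%N by apply: w_stable; apply: leq_addr.
    have w2 : w r = (r + ga)%N by apply: w_stable.
    by lia.
  exists [ffun i : 'I_r => P`_i].
  rewrite -(mulfVK a0 (val t - val t')) -/h mulrC; congr (a * _).
  by rewrite hP (kspanE e sP); apply: eq_bigr => i _; rewrite ffunE.
have inj : injective (fun t => (loc (val t / a), G t)).
  move=> t t' [lt gt]; apply: val_inj.
  by apply: (addIr (- val (rep (loc (val t / a))))); rewrite GP gt lt -GP.
have := leq_card _ inj; rewrite card_prod cT !card_ffun !card_ord -expnD leq_exp2l ?card_gt1 //.
by rewrite [(r + d)%N]addnC leq_add2r.
Qed.

Lemma sum_points ps (M : closed_point C -> nat) :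
  (\sum_(x <- points ps) M x.1 = \sum_(p <- ps) M p * degree p)%N.
Proof.
rewrite /points /positions big_allpairs_dep; apply: eq_bigr => p _ /=.
by rewrite big_const_seq count_predT size_iota iter_addn addn0.
Qed.

(** The bound from below is obtained by counting over k, hence for a only; the bound from above
    holds over F, for both factors P and Q of a. As zeros and pole orders add up, all bounds are
    equalities. *)
Lemma product_formula P Q a ps (m : X -> nat) (u : X -> F) :
  P \is monic -> affine a -> a != 0 -> (forall x, ev x P * ev x Q = xi x a) ->
  uniq ps -> oo \notin ps -> (forall p, p != oo -> vge p 1 a -> p \in ps) ->
  (forall x, x \in points ps -> has_order (ev x P) (m x)%:Z (u x)) ->
  (\sum_(x <- points ps) m x)%N = w (size P).-1.
Proof.
move=> Pm aA a0 PQ ups oops azero Po.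
have oP := fspan_order oo1 w_incr xi_oo (monic_neq0 Pm).
have Q0 : Q != 0.
  apply/eqP => Q0; have := PQ x0; rewrite Q0 fspan0 mulr0 => /esym/eqP.
  have [c ao] := ordP iota oo a0.
  by have := order_lmap (sig oo 0) ao => /has_order_neq0; rewrite /xi /= => /negPf ->.
pose Q1 := (lead_coef Q)^-1 *: Q.
have lQ : lead_coef Q != 0 by rewrite lead_coef_eq0.
have Q1m : Q1 \is monic by rewrite monicE lead_coefZ mulVf.
have sQ1 : size Q1 = size Q by rewrite size_scale // invr_eq0.
have oQ := fspan_order oo1 w_incr xi_oo Q0.
set wP := w (size P).-1 in oP *; set wQ := w (size Q).-1 in oQ.
have [c ao] := ordP iota oo a0.
have oE : ord oo a = - (wP + wQ)%N%:Z.
  have := has_orderM oP oQ; rewrite PQ => /(has_order_unique (order_lmap (sig oo 0) ao)) [-> _].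
  by lia.
rewrite oE in ao.
have [M MP] : exists M : closed_point C -> nat, forall p, p \in ps -> ord p a = (M p)%:Z.
  exists (fun p => `|ord p a|%N) => p pps.
  have po : p != oo by apply: contraNneq oops => <-.
  by move: ((vgeE iota p 0 a0).1 (aA p po)); clear; lia.
have Mge : (wP + wQ <= \sum_(x <- points ps) M x.1)%N.
  rewrite sum_points; apply: (affine_zeros_ge aA ao) => // p po pps a1.
  by rewrite azero in pps.
have Qo x : x \in points ps -> (m x <= M x.1)%N /\
    vanishes_below (M x.1 - m x)%N%:Z (ev x Q1).
  move=> xps; have xo := points_oo oops xps.
  have xp1 : x.1 \in ps by move: xps; case: (x) => p i; rewrite positionsP => /andP[].
  have [d ax] := ordP iota x.1 a0; rewrite MP // in ax.
  have := order_lmap (sig x.1 x.2) ax; rewrite -[lmap _ _]/(xi x a) -PQ => PQo.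
  have /order_exists [t [z Qt]] : ev x Q != 0.
    by apply/eqP => e0; have := has_order_neq0 PQo; rewrite e0 mulr0 eqxx.
  have [tE _] := has_order_unique (has_orderM (Po x xps) Qt) PQo.
  have t0 : 0 <= t by apply/(order_vb _ Qt); apply: ev_vge0.
  split; first by move: tE t0; clear; lia.
  rewrite fspanZ -[(_ - _)%N%:Z]add0r; apply: vbM; first exact: vb_lconst.
  by apply/(order_vb _ Qt); move: tE t0; clear; lia.
have leP : (\sum_(x <- points ps) m x <= wP)%N.
  by apply: affine_zeros_le => // x /Po [].
have leQ : (\sum_(x <- points ps) (M x.1 - m x) <= wQ)%N.
  by rewrite /wQ -sQ1; apply: affine_zeros_le => // x /Qo [].
have : (\sum_(x <- points ps) M x.1 = \sum_(x <- points ps) m x + \sum_(x <- points ps) (M x.1 - m x))%N.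
  rewrite -big_split /=; apply: eq_big_seq => x /Qo [le _]; by rewrite subnKC.
by lia.
Qed.

(** The two bases of V/fgV have equal determinants by [seq_det_reciprocity]; once sorted by points,
    each determinant is a product of leading coefficients. *)
Lemma affine_reciprocity P Q P' Q' a b ps (m n : X -> nat) (u v : X -> F) :
  P \is monic -> Q \is monic -> affine a -> affine b -> a != 0 -> b != 0 ->
  (forall x, ev x P * ev x P' = xi x a) -> (forall x, ev x Q * ev x Q' = xi x b) ->
  uniq ps -> oo \notin ps ->
  (forall p, p != oo -> vge p 1 a -> p \in ps) -> (forall p, p != oo -> vge p 1 b -> p \in ps) ->
  (forall x, x \in points ps -> has_order (ev x P) (m x)%:Z (u x)) ->
  (forall x, x \in points ps -> has_order (ev x Q) (n x)%:Z (v x)) ->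
  \prod_(x <- points ps) ((-1) ^+ (m x * n x) * u x ^+ n x / v x ^+ m x) =
  (-1) ^+ (w (size P).-1 * w (size Q).-1).
Proof.
move=> Pm Qm aA bA a0 b0 PP' QQ' ups oops az bz Po Qo.
have sm := product_formula Pm aA a0 PP' ups oops az Po.
have sn := product_formula Qm bA b0 QQ' ups oops bz Qo.
have [f [opf fE]] := multiplication_op iotaP oo1 eP w_incr w_stable w_onto xi_const xi_oo Pm.
have [g [opg gE]] := multiplication_op iotaP oo1 eP w_incr w_stable w_onto xi_const xi_oo Qm.
rewrite -sm -sn in opf opg *; set xs := points ps in opf opg *.
set A := (\sum_(x <- xs) m x)%N in opf *; set B := (\sum_(x <- xs) n x)%N in opg *.
pose N x := (m x + n x)%N.
have NE : (\sum_(x <- xs) N x = A + B)%N by rewrite /N big_split.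
have [gam gamP] := geometric_approximation (A + B) ups oops.
have Nn x j : x \in xs -> (j < N x)%N -> (j < A + B)%N.
  by move=> /(sum_bound N) mx /leq_trans; apply; rewrite -NE.
have Nm x j : x \in xs -> (j < m x)%N -> (j < A + B)%N.
  by move=> xxs jm; apply: (Nn x) => //; rewrite /N (leq_trans jm) // leq_addr.
have Nn' x j : x \in xs -> (j < n x)%N -> (j < A + B)%N.
  by move=> xxs jm; apply: (Nn x) => //; rewrite /N (leq_trans jm) // leq_addl.
pose al := [seq gam t.1 t.2 | t <- positions m xs].
pose be := [seq gam t.1 t.2 | t <- positions n xs].
pose phi := pointwise_coef (positions N xs).
have fgC R : f (g R) = g (f R).
  by apply: (fspan_inj oo1 w_incr xi_oo); rewrite !(fE, gE) mulrCA.
have phi0 j R : (j < A + B)%N -> phi j (f (g R)) = 0.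
  rewrite -NE -(size_positions N xs) => /(mem_nth (x0, 0%N)); rewrite /phi /pointwise_coef.
  case: nth => x l; rewrite positionsP /= => /andP[xxs lN].
  have [Pv _ _] := Po x xxs; have [Qv _ _] := Qo x xxs.
  rewrite fE gE; have := vbM Pv (vbM Qv (ev_vge0 R (points_oo oops xxs))).
  by apply; rewrite addr0 -PoszD ltz_nat.
have sal : size al = A by rewrite size_map size_positions.
have sbe : size be = B by rewrite size_map size_positions.
have rec := seq_det_reciprocity opf opg fgC (pointwise_coef_lin _) phi0 sal sbe.
(* At each point come c x approximants, with diagonal entries 1, then h times d x approximants,
   whose diagonal entries are the leading coefficient of h; the matrix is triangular at each point
   and zero between distinct points. *)
have block (h : {poly F} -> {poly F}) (S : {poly F}) (c d : X -> nat) (z : X -> F) :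
    (forall x R, ev x (h R) = ev x S * ev x R) ->
    (forall x, x \in xs -> has_order (ev x S) (c x)%:Z (z x)) ->
    (forall x, c x + d x = N x)%N ->
    seq_det (A + B) phi (flatten [seq mkseq (gam x) (c x) ++ mkseq (fun j => h (gam x j)) (d x) | x <- xs])
    = \prod_(x <- xs) z x ^+ d x.
  move=> hE So cd.
  pose row x j := if (j < c x)%N then gam x j else h (gam x (j - c x)%N).
  have -> : flatten [seq mkseq (gam x) (c x) ++ mkseq (fun j => h (gam x j)) (d x) | x <- xs] =
      [seq row t.1 t.2 | t <- positions N xs].
    have -> : positions N xs = positions (fun x => c x + d x)%N xs.
      by rewrite /positions; congr flatten; apply: eq_map => x; rewrite cd.
    rewrite map_positions; congr flatten; apply: eq_map => x; congr (_ ++ _).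
      by apply/eq_in_map => j; rewrite mem_iota add0n => /= jc; rewrite /row jc.
    by apply: eq_map => j; rewrite /row ltnNge leq_addr addKn.
  have cN x j : x \in xs -> (j < N x)%N -> (j - c x < A + B)%N.
    by move=> xxs /(Nn x j xxs); apply: leq_ltn_trans; apply: leq_subr.
  rewrite -NE (seq_det_pointwise (d := fun x j => if (j < c x)%N then 1 else z x)) //.
  - apply: eq_bigr => x _; rewrite -cd (big_cat_nat (n := c x)) ?leq_addr //=.
    rewrite big_nat_cond big1 ?mul1r => [|j /andP[/andP[_ ->]] //].
    rewrite big_nat_cond (eq_bigr (fun=> z x)); last first.
      by move=> j /andP[/andP[cj _] _]; rewrite ltnNge cj.
    by rewrite -big_nat_cond prodr_const_nat addKn.
  - move=> x j y l xxs yxs jN lN xy; rewrite /row; case: ifP => _.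
      by apply: (gam_off gamP) => //; [apply: Nn jN | rewrite ltz_nat; apply: Nn lN].
    rewrite hE; have := vbM (ev_vge0 S (points_oo oops yxs)) (gam_off gamP xxs yxs (cN _ _ xxs jN) xy).
    by apply; rewrite add0r ltz_nat; apply: Nn lN.
  move=> x j xxs jN; rewrite /row; case: ltnP => jc.
    by have [? ? _] := gam_diag gamP xxs (Nn _ _ xxs jN).
  have := has_orderM (So x xxs) (gam_diag gamP xxs (cN _ _ xxs jN)).
  by rewrite -hE mulr1 -PoszD subnKC // => -[].
have blockf := block f P m n u fE Po (fun x => erefl _).
have blockg := block g Q n m v gE Qo (fun x => addnC _ _).
have fl (c : X -> nat) (h : {poly F} -> {poly F}) :
    flatten [seq mkseq (fun j => h (gam x j)) (c x) | x <- xs] =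
    [seq h R | R <- [seq gam t.1 t.2 | t <- positions c xs]].
  by rewrite (flatten_mkseq (fun x j => h (gam x j))) -map_comp.
have szf (c d : X -> nat) (h h' : X -> nat -> {poly F}) : (forall x, c x + d x = N x)%N ->
    (A + B = size (flatten [seq mkseq (h x) (c x) ++ mkseq (h' x) (d x) | x <- xs]))%N.
  move=> cd; rewrite (size_flatten_map (fun x => mkseq (h x) (c x) ++ mkseq (h' x) (d x))) -NE.
  by apply: eq_bigr => x _; rewrite size_cat !size_mkseq cd.
have invE (c d : X -> nat) (h h' : X -> nat -> {poly F}) :
    inversions (size \o (fun x => mkseq (h x) (c x))) (size \o (fun x => mkseq (h' x) (d x))) xs =
    inversions c d xs.
  elim: (xs) => //= x ys ->; rewrite size_mkseq; congr (_ * _ + _)%N.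
  by apply: eq_bigr => y _; rewrite size_mkseq.
have uf := @seq_det_unshuffle F _ (A + B) phi (fun x => mkseq (gam x) (m x))
  (fun x => mkseq (fun j => f (gam x j)) (n x)) xs [::] (szf _ _ _ _ (fun x => erefl _)).
have ug := @seq_det_unshuffle F _ (A + B) phi (fun x => mkseq (gam x) (n x))
  (fun x => mkseq (fun j => g (gam x j)) (m x)) xs [::] (szf _ _ _ _ (fun x => addnC _ _)).
rewrite /= invE blockf fl (fl m id) map_id -/al -/be in uf.
rewrite /= invE blockg fl (fl n id) map_id -/al -/be in ug.
rewrite rec in uf.
set D := seq_det _ _ _ in uf ug.
have v0 : \prod_(x <- xs) v x ^+ m x != 0.
  rewrite prodf_seq_neq0; apply/allP => x xxs; apply/implyP => _.
  by rewrite expf_neq0 //; case: (Qo x xxs).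
have D0 : D != 0 by apply: contraNneq v0 => D0; rewrite ug D0 mulr0.
(* The products of the u^n and of the v^m are now D up to the signs of the two sortings. *)
rewrite prodf_div big_split /= uf ug prodrXr -(inversions_sum m n xs) !exprD.
rewrite invfM invr_sign; set s1 := (-1) ^+ inversions m n xs.
set s2 := (-1) ^+ inversions n m xs; set s3 := (-1) ^+ (\sum_(x <- xs) _).
have -> : s3 * (s1 * D) * (s2 / D) = s1 * s2 * s3 * (D / D) by ring.
by rewrite divff // mulr1.
Qed.

End GeometricPoints.

Lemma rmorphism_pack (R S : nzRingType) (f : R -> S) : nmod_morphism f -> monoid_morphism f ->
  exists g : {rmorphism R -> S}, forall x, g x = f x.
Proof.
move=> fN fM.
pose g : {rmorphism R -> S} := HB.pack f (GRing.isNmodMorphism.Build _ _ _ fN)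
  (GRing.isMonoidMorphism.Build _ _ _ fM).
by exists g.
Qed.

(** The factorial of #|T| is at least every preperiod and a multiple of every period. *)
Lemma iter_idempotent (T : finType) (f : T -> T) :
  exists2 i, (0 < i)%N & forall x, iter (i + i) f x = iter i f x.
Proof.
exists (factorial #|T|); first exact: fact_gt0.
move=> x; have [j jo jE] : exists2 j, (j < fingraph.order f x)%N & iter (fingraph.order f x) f x = iter j f x.
  by have /trajectP [j jo jE] := looping_order f x; exists j.
set n := fingraph.order f x in jo jE; pose d := (n - j)%N.
have nT : (n <= #|T|)%N by apply: max_card.
have per a : (j <= a)%N -> iter (a + d) f x = iter a f x.
  move=> ja; have -> : (a + d = (a - j) + n)%N by rewrite /d; lia.
  by rewrite iterD jE -iterD subnK.
have perM t a : (j <= a)%N -> iter (a + t * d) f x = iter a f x.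
  move=> ja; elim: t => [|t IH]; first by rewrite addn0.
  by rewrite mulSn [(d + _)%N]addnC addnA per ?IH // (leq_trans ja) ?leq_addr.
have /dvdnP [t tE] : (d %| factorial #|T|)%N.
  by apply: dvdn_fact; rewrite /d; lia.
rewrite {2}tE perM //; apply: leq_trans (ltnW jo) (leq_trans nT _).
by case: #|T| => // N; rewrite factS leq_pmulr // fact_gt0.
Qed.

(** * The reduction of the algebra of coefficients *)

Section FrobeniusPowers.
Variables (k : finFieldType).
Local Notation q := #|k|.

Lemma card_pnat : exists2 p, p \in [pchar k] & p.-nat q.
Proof.
have [p pr pk] := finPcharP k; exists p => //.
by rewrite (card_pprimeChar pk) pnatX pnat_id.
Qed.

Lemma exprD_card (R : comNzRingType) (f : {rmorphism k -> R}) i (x y : R) :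
  (x + y) ^+ (q ^ i) = x ^+ (q ^ i) + y ^+ (q ^ i).
Proof.
have [p pk pq] := card_pnat; apply: exprDn_pchar.
have pR : p \in [pchar R] by apply: rmorph_pchar pk.
by rewrite (eq_pnat _ (pcharf_eq pR)) pnatX pq.
Qed.

Lemma expf_card_iter (c : k) i : c ^+ (q ^ i) = c.
Proof. by elim: i => [|i IH]; rewrite ?expr1 // expnSr exprM IH expf_card. Qed.

Lemma card_exp_gt0 i : (0 < q ^ i)%N.
Proof. by rewrite expn_gt0 (ltnW (finNzRing_gt1 k)). Qed.

Lemma frobenius_morphism (R S : comNzRingType) (g : {rmorphism R -> S}) (f : {rmorphism k -> S}) i :
  exists h : {rmorphism R -> S}, forall x, h x = g x ^+ (q ^ i).
Proof.
apply: rmorphism_pack; split=> [|x y].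
- by rewrite rmorph0 expr0n gtn_eqF // card_exp_gt0.
- by rewrite rmorphD (exprD_card f).
- by rewrite rmorph1 expr1n.
- by rewrite rmorphM exprMn.
Qed.

(** This is the nonvanishing of the Moore determinant: a relation between the columns is a
    polynomial in the X^(q^i), i < n, of degree less than q^n, that vanishes on the q^n elements of
    the span of b. *)
Lemma finite_span_dual (R : comNzRingType) (F : fieldType) (io : {rmorphism k -> R})
    (f : {rmorphism k -> F}) (sg : {rmorphism R -> F}) n (b : 'I_n -> R) :
  (forall c, sg (io c) = f c) -> injective sg ->
  (forall c : 'I_n -> k, \sum_l io (c l) * b l = 0 -> forall l, c l = 0) ->
  (\matrix_(l, i) sg (b l) ^+ (q ^ (i : 'I_n))) \in unitmx.
Proof.
move=> sgc sgi bfree; set V := \matrix_(l, i) _.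
rewrite -unitmx_tr -row_free_unit; apply: inj_row_free => v vV.
pose val (t : {ffun 'I_n -> k}) : R := \sum_l io (t l) * b l.
have val_inj : injective val.
  move=> t t' tt; apply/ffunP => l; apply/eqP; rewrite -subr_eq0; apply/eqP.
  apply: (bfree (fun l => t l - t' l)).
  transitivity (val t - val t'); last by rewrite tt subrr.
  by rewrite /val -sumrB; apply: eq_bigr => i _; rewrite rmorphB mulrBl.
pose P : {poly F} := \sum_(i < n) v 0 i *: 'X^(q ^ i).
have Pval t : P.[sg (val t)] = 0.
  rewrite horner_sum.
  transitivity (\sum_l f (t l) * (v *m V^T) 0 l); last first.
    by rewrite vV big1 // => l _; rewrite mxE mulr0.
  under [RHS]eq_bigr => l _ do rewrite mxE mulr_sumr.
  rewrite exchange_big /=; apply: eq_bigr => i _; rewrite hornerZ hornerXn.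
  have -> : sg (val t) ^+ (q ^ i) = \sum_l f (t l) * sg (b l) ^+ (q ^ i).
    rewrite /val rmorph_sum; elim/big_ind2: _ => [|x x' y y' <- <-|l _].
    - by rewrite expr0n gtn_eqF // card_exp_gt0.
    - by rewrite (exprD_card f).
    have fx c : f c ^+ (q ^ i) = f c by rewrite -rmorphXn expf_card_iter.
    by rewrite rmorphM exprMn sgc fx.
  by rewrite mulr_sumr; apply: eq_bigr => l _; rewrite !mxE; ring.
have P0 : P = 0.
  apply: contrapT => /eqP Pn0.
  have /(max_poly_roots Pn0) : all (root P) [seq sg (val t) | t : {ffun 'I_n -> k}].
    by apply/allP => _ /mapP [t _ ->]; apply/eqP.
  rewrite map_inj_uniq ?enum_uniq => [/(_ isT)|t t' /sgi /val_inj //].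
  rewrite size_map -cardE card_ffun card_ord => lt.
  have : (size P <= q ^ n)%N.
    apply: leq_trans (size_sum _ _ _) _; apply/bigmax_leqP => i _.
    apply: leq_trans (size_scale_leq _ _) _; rewrite size_polyXn.
    by rewrite ltn_exp2l ?finNzRing_gt1.
  by rewrite leqNgt lt.
apply/rowP => i; rewrite mxE; have := congr1 (fun P : {poly F} => P`_(q ^ i)) P0.
rewrite coef_sum coef0 (bigD1 i) //= coefZ coefXn eqxx mulr1 big1 ?addr0 // => j ji.
rewrite coefZ coefXn eqn_exp2l ?finNzRing_gt1 // eq_sym -[_ == _ :> nat]/(j == i).
by rewrite (negPf ji) mulr0.
Qed.

End FrobeniusPowers.

Section Embedding.
Variables (k : finFieldType) (F : closedFieldType) (f : {rmorphism k -> F}).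

(** A primitive root of the finite field L serves as generator. *)
Lemma finite_ext_generator (L : fieldExtType k) :
  exists th : L, forall y, exists r : {poly k}, (map_poly (in_alg L) r).[th] = y.
Proof.
pose L' := FinFieldExtType L.
pose rs := [seq x <- enum L' | x != 0].
pose n := (size rs); have n0 : (0 < n)%N.
  by rewrite -has_predT; apply/hasP; exists (1 : L') => //; rewrite mem_filter oner_eq0 mem_enum.
have sz : #|L'| = n.+1.
  rewrite cardE -(count_predC (pred1 (0 : L'))) count_uniq_mem ?enum_uniq // mem_enum add1n.
  by rewrite /n size_filter.
have unity : all n.-unity_root rs.
  apply/allP => x; rewrite mem_filter => /andP[x0 _]; rewrite unity_rootE.
  apply/eqP; apply: (mulfI x0); rewrite mulr1 -exprS -sz.
  exact: (expf_card (x : L')).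
have /hasP [th _ prim] := has_prim_root n0 unity (filter_uniq _ (enum_uniq _)) (leqnn _).
exists (th : L) => y; have [->|y0] := eqVneq y 0.
  by exists 0; rewrite rmorph0 horner0.
have yn : y ^+ n = 1.
  by apply: (mulfI y0); rewrite mulr1 -exprS -sz; apply: (expf_card (y : L')).
have [i ->] := prim_rootP prim yn.
by exists 'X^i; rewrite map_polyXn hornerXn.
Qed.

(** The generator is sent to a root in F of the polynomial of least degree that annihilates it. *)
Lemma finite_ext_embedding (L : fieldExtType k) :
  exists sg : {rmorphism L -> F}, forall c, sg c%:A = f c.
Proof.
have [th thP] := finite_ext_generator L.
pose e (r : {poly k}) := (map_poly (in_alg L) r).[th].
have [P0 [P0n P00 P0min]] : exists P0 : {poly k}, [/\ P0 != 0, e P0 = 0 &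
    forall P, P != 0 -> e P = 0 -> (size P0 <= size P)%N].
  pose Q n := `[< exists P : {poly k}, [/\ P != 0, e P = 0 & size P = n] >].
  have exQ : exists n, Q n.
    have th_alg : th ^+ (#|k| ^ \dim {:L}) = th.
      by have := Fermat's_little_theorem {:L}%AS th; rewrite memvf => /esym/eqP.
    pose P : {poly k} := 'X^(#|k| ^ \dim {:L}) - 'X.
    exists (size P); apply/asboolP; exists P; split=> //.
      have N1 : (1 < #|k| ^ \dim {:L})%N.
        by rewrite -(expn0 #|k|) ltn_exp2l ?finNzRing_gt1 // adim_gt0.
      by rewrite -size_poly_eq0 size_polyDl ?size_polyXn // size_polyN size_polyX.
    by rewrite /e rmorphB /= map_polyXn map_polyX hornerD hornerN hornerXn hornerX th_alg subrr.
  have [n /asboolP [P0 [P0n P00 sP0]] min] := ex_minnP exQ.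
  by exists P0; split=> // P Pn P0_; rewrite sP0; apply: min; apply/asboolP; exists P.
have [rho rhoP] : exists rho, root (map_poly f P0) rho.
  apply/closed_rootP; rewrite size_map_poly; apply/negP => /size_poly1P [c c0 P0E].
  by move: P00; rewrite P0E /e map_polyC hornerC => /eqP; rewrite fmorph_eq0 (negPf c0).
pose ev r := (map_poly f r).[rho].
have evE r r' : e r = e r' -> ev r = ev r'.
  move=> err; apply/eqP; rewrite -subr_eq0; apply/eqP.
  have : e (r - r') = 0 by rewrite /e rmorphB hornerD hornerN -/(e r) err subrr.
  rewrite /ev -hornerN -hornerD -rmorphN -rmorphD.
  move: (r - r') => P; rewrite {1}(divp_eq P P0) /e rmorphD rmorphM hornerD hornerM.
  rewrite -/(e P0) P00 mulr0 add0r => rem0.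
  have rem : P %% P0 = 0.
    apply: contrapT => /eqP nz; have := P0min _ nz rem0.
    by rewrite leqNgt ltn_modp P0n.
  by rewrite (divp_eq P P0) rem addr0 rmorphM hornerM (eqP rhoP) mulr0.
have /choice [r rP] := thP.
have [sg sgE] : exists sg : {rmorphism L -> F}, forall y, sg y = ev (r y).
  apply: rmorphism_pack; split=> [|x y].
  - by rewrite -[RHS](horner0 rho) -(rmorph0 (map_poly f)); apply: evE; rewrite /e rP rmorph0 horner0.
  - rewrite -[RHS]hornerD -rmorphD; apply: evE; rewrite /e rP.
    by rewrite rmorphD hornerD -/(e _) -/(e _) /e !rP.
  - by rewrite -(hornerC 1 rho) polyC1 -(rmorph1 (map_poly f)); apply: evE; rewrite /e rP rmorph1 hornerC.
  - rewrite -[RHS]hornerM -rmorphM; apply: evE; rewrite /e rP.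
    by rewrite rmorphM hornerM !rP.
exists sg => c; rewrite sgE -(hornerC (f c) rho) -map_polyC; apply: evE.
by rewrite /e rP map_polyC hornerC.
Qed.
End Embedding.

Section FixedSubfield.
Variables (B : comUnitRingType) (M : nat).
(** For a suitable power M of #k, x |-> x^M is a ring morphism onto its fixed points. These form a
    copy of the residue field inside B, so that the reduction becomes a Frobenius power. *)
Definition fixed_pred : {pred B} := [pred b | b ^+ M == b].
Hypothesis fixed_closed : divring_closed fixed_pred.
Hypothesis fixed_unit : forall b : B, b ^+ M = b -> b != 0 -> b \is a GRing.unit.
Variables (T : countType) (enc : B -> T) (dec : T -> B).
Hypothesis encK : cancel enc dec.

Definition fixed_field : Type := {b : B | b \in fixed_pred}.
HB.instance Definition _ := SubChoice.on fixed_field.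
HB.instance Definition _ :=
  GRing.SubChoice_isSubComUnitRing.Build B fixed_pred fixed_field fixed_closed.

Fact fixed_field_axiom : GRing.field_axiom fixed_field.
Proof.
move=> x x0; have v0 : val x != 0.
  by apply: contraNneq x0 => v0; apply/eqP; apply: val_inj; rewrite v0.
have vx : val x ^+ M = val x by apply/eqP; apply: (valP x).
have ux : val x \is a GRing.unit by apply: fixed_unit.
have Px : (val x)^-1 \in fixed_pred by rewrite inE exprVn vx.
apply/unitrPr; exists (Sub (val x)^-1 Px : fixed_field); apply: val_inj.
by rewrite rmorphM SubK divrr // rmorph1.
Qed.
HB.instance Definition _ := GRing.ComUnitRing_isField.Build fixed_field fixed_field_axiom.

Let encE (x : fixed_field) : T := enc (val x).
Let decE (t : T) : option fixed_field := insub (dec t).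
Fact fixed_field_pcancel : pcancel encE decE.
Proof. by move=> x; rewrite /encE /decE encK valK. Qed.
HB.instance Definition _ := Choice_isCountable.Build fixed_field
  (@pcan_pickleK T fixed_field encE decE fixed_field_pcancel).

Lemma fixed_field_closure : (0 < M)%N -> (forall x y : B, (x + y) ^+ M = x ^+ M + y ^+ M) ->
  (forall x : B, (x ^+ M) ^+ M = x ^+ M) ->
  exists (F : closedFieldType) (pi : {rmorphism B -> F}), forall x, pi x = 0 -> x ^+ M = 0.
Proof.
move=> M0 MD MM.
have [F [g _]] := countable_algebraic_closure (fixed_field : countFieldType).
have Px (x : B) : x ^+ M \in fixed_pred by rewrite inE MM.
pose ph x : fixed_field := Sub (x ^+ M) (Px x).
have [pi piE] : exists pi : {rmorphism B -> F}, forall x, pi x = g (ph x).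
  apply: rmorphism_pack; split=> [|x y].
  - by rewrite -(rmorph0 g); congr (g _); apply: val_inj; rewrite SubK expr0n gtn_eqF // rmorph0.
  - by rewrite -rmorphD; congr (g _); apply: val_inj; rewrite rmorphD !SubK MD.
  - by rewrite -(rmorph1 g); congr (g _); apply: val_inj; rewrite SubK expr1n rmorph1.
  - by rewrite -rmorphM; congr (g _); apply: val_inj; rewrite rmorphM !SubK exprMn.
exists F, pi => x; rewrite piE => /eqP; rewrite fmorph_eq0 => /eqP.
by move/(congr1 val); rewrite SubK rmorph0.
Qed.
End FixedSubfield.

Section LocalAlgebra.
Variables (k : finFieldType) (B : comUnitAlgType k) (finB : finite_alg B) (locB : is_local B).
Local Notation q := #|k|.

(** B is finite, so some iterate of the Frobenius map is idempotent. *)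
Lemma frobenius_retraction : exists2 i, (0 < i)%N &
  forall b : B, (b ^+ (q ^ i)) ^+ (q ^ i) = b ^+ (q ^ i).
Proof.
pose T := {ffun 'I_(fdim finB) -> k}.
pose enc (b : B) : T := fcoord finB b.
pose dec (t : T) : B := \sum_i t i *: fbasis finB i.
have encK b : dec (enc b) = b by rewrite /dec -fcoordE.
have [i i0 iE] := iter_idempotent (fun t : T => enc (dec t ^+ q)).
have iterE j b : iter j (fun t : T => enc (dec t ^+ q)) (enc b) = enc (b ^+ (q ^ j)).
  by elim: j => [|j IH]; rewrite ?expr1 // iterS IH encK expnSr exprM.
exists i => // b; have := congr1 dec (iE (enc b)).
by rewrite !iterE !encK expnD exprM.
Qed.

(** The kernel of the idempotent Frobenius power consists of nilpotent elements, and its image is a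
    finite field, which has an algebraic closure. *)
Lemma residue_closure : exists (F : closedFieldType) (pi : {rmorphism B -> F}),
  forall b, pi b = 0 -> exists n, b ^+ n = 0.
Proof.
have [i i0 iE] := frobenius_retraction.
pose M := (q ^ i)%N; have M0 : (0 < M)%N by apply: card_exp_gt0.
have M1 : (1 < M)%N by rewrite /M -{1}(expn0 q) ltn_exp2l ?finNzRing_gt1.
have MD (x y : B) : (x + y) ^+ M = x ^+ M + y ^+ M by apply: (exprD_card (in_alg B)).
have MN (x : B) : (- x) ^+ M = - x ^+ M.
  by apply/eqP; rewrite -addr_eq0 addrC -MD subrr expr0n gtn_eqF.
have closed : divring_closed (@fixed_pred B M).
  split=> [|x y|x y]; rewrite !inE ?expr1n // => /eqP xE /eqP yE.
    by rewrite MD MN xE yE.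
  by rewrite exprMn exprVn xE yE.
(* If c is fixed and not a unit, then 1 - c^(M-1) is a unit because B is local, and it kills c. *)
have unit (c : B) : c ^+ M = c -> c != 0 -> c \is a GRing.unit.
  move=> cM c0; apply: contrapT => /negP cu.
  have cu' : c ^+ M.-1 \isn't a GRing.unit.
    by rewrite unitrX_pos // -ltnS prednK.
  have : 1 - c ^+ M.-1 \is a GRing.unit.
    apply: contrapT => /negP nu; have := locB nu cu'; rewrite subrK unitr1.
    by [].
  move=> /mulrI /(_ c 0); rewrite mulr0 mulrBl mul1r -exprSr prednK // cM subrr => /(_ erefl).
  by move/eqP; rewrite (negPf c0).
have encK : cancel (fcoord finB) (fun t => \sum_i t i *: fbasis finB i).
  by move=> b; rewrite -fcoordE.
have [F [pi piP]] := fixed_field_closure closed unit encK M0 MD iE.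
by exists F, pi => b /piP bM; exists M.
Qed.
End LocalAlgebra.

Section TensorLift.
Variables (k : fieldType) (A : comNzRingType) (s : {rmorphism k -> A}).
Variables (L : comUnitAlgType k) (hL : finite_alg L).
Variables (T : comNzRingType) (a : {rmorphism A -> T}) (b : {rmorphism L -> T}).
Hypothesis ab : forall c, a (s c) = b c%:A.

Lemma tens_lift : exists h : {rmorphism tens s hL -> T},
  forall x : tens s hL, h x = \sum_i a (x i) * b (fbasis hL i).
Proof.
have bZ c y : b (c *: y) = a (s c) * b y by rewrite ab -rmorphM mulr_algl.
have bsum y : \sum_i a (s (fcoord hL y i)) * b (fbasis hL i) = b y.
  rewrite [in RHS](fcoordE hL y) rmorph_sum; apply: eq_bigr => i _.
  by rewrite -bZ.
apply: rmorphism_pack; split=> [|x y].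
- by rewrite big1 // => i _; rewrite ffunE rmorph0 mul0r.
- rewrite -big_split; apply: eq_bigr => i _ /=.
  by rewrite ffunE rmorphD mulrDl.
- transitivity (\sum_i a (s (fcoord hL 1 i)) * b (fbasis hL i)); last by rewrite bsum rmorph1.
  by apply: eq_bigr => i _; rewrite ffunE mul1r.
- transitivity (\sum_i \sum_j a (x i) * a (y j) * b (fbasis hL i * fbasis hL j)).
    under [RHS]eq_bigr => i _ do under eq_bigr => j _ do rewrite -bsum mulr_sumr.
    under [RHS]eq_bigr => i _ do rewrite exchange_big.
    rewrite [RHS]exchange_big; apply: eq_bigr => l _ /=; rewrite ffunE rmorph_sum mulr_suml.
    apply: eq_bigr => i _; rewrite rmorph_sum mulr_suml; apply: eq_bigr => j _.
    by rewrite /tstruct !rmorphM !mulrA.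
  rewrite mulr_suml; apply: eq_bigr => i _; rewrite mulr_sumr; apply: eq_bigr => j _.
  by rewrite rmorphM; ring.
Qed.
End TensorLift.

(** * Norms and tame symbols *)

Section NormFormula.
Variables (k : fieldType) (B : comUnitRingType) (s : {rmorphism k -> B}).
Variables (L : comUnitAlgType k) (hL : finite_alg L).
Variables (F : fieldType) (pi : {rmorphism B -> F}) (sg : nat -> {rmorphism L -> F}).
Hypothesis sg_const : forall i c, sg i c%:A = pi (s c).
Hypothesis sg_unit : \matrix_(l < fdim hL, i < fdim hL) sg i (fbasis hL l) \in unitmx.
Variable th : nat -> {rmorphism tens s hL -> F}.
Hypothesis thE : forall i x, th i x = \sum_l pi (x l) * sg i (fbasis hL l).

Lemma tens_lift_tinr i y : th i (tinr s hL y) = sg i y.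
Proof.
rewrite thE [in RHS](fcoordE hL y) rmorph_sum; apply: eq_bigr => l _.
by rewrite ffunE -(sg_const i) -rmorphM mulr_algl.
Qed.

(** The matrix of the embeddings diagonalizes multiplication by x, with eigenvalues the [th i x]. *)
Lemma norm_product x : pi (tnorm x) = \prod_(i < fdim hL) th i x.
Proof.
pose V : 'M[F]_(fdim hL) := \matrix_(l, i) sg i (fbasis hL l).
have Vu : \det V != 0 by rewrite -unitfE; apply: sg_unit.
have VE : map_mx pi (tmulmx x) *m V = V *m diag_mx (\row_i th i x).
  apply/matrixP => l i; rewrite mul_mx_diag !mxE.
  rewrite -(tens_lift_tinr i (fbasis hL l)) mulrC -rmorphM thE.
  by apply: eq_bigr => j _; rewrite !mxE.
have := congr1 determinant VE; rewrite !det_mulmx det_map_mx det_diag mulrC.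
move/(mulfI Vu) => ->.
by apply: eq_bigr => i _; rewrite mxE.
Qed.
End NormFormula.

Section Tame.
Variable F : fieldType.
Implicit Types f g : laurent F.

Definition lorder f : int := xget 0 [set n | exists c, has_order f n c].
Definition llead f : F := f (lorder f).
Definition tame f g : F :=
  (-1) ^ (lorder f * lorder g) * (llead f ^ lorder g / llead g ^ lorder f).

Lemma lorderE f n c : has_order f n c -> lorder f = n /\ llead f = c.
Proof.
move=> fo; have nE : lorder f = n.
  rewrite /lorder; case: xgetP => [m _ [d fo']|/(_ n)]; last by case; exists c.
  by have [] := has_order_unique fo' fo.
by rewrite /llead nE; case: fo.
Qed.

Lemma has_lorder f : f != 0 -> has_order f (lorder f) (llead f) /\ llead f != 0.
Proof.
by move=> /order_exists [n [c fo]]; have [-> ->] := lorderE fo; case: (fo).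
Qed.

Lemma tameE f g n c m d : has_order f n c -> has_order g m d ->
  tame f g = (-1) ^ (n * m) * (c ^ m / d ^ n).
Proof. by move=> /lorderE [fn fc] /lorderE [gm gd]; rewrite /tame fn fc gm gd. Qed.

Lemma tameMl f f' g : f != 0 -> f' != 0 -> g != 0 -> tame (f * f') g = tame f g * tame f' g.
Proof.
move=> /has_lorder [fo f0] /has_lorder [fo' f0'] /has_lorder [go g0].
rewrite (tameE (has_orderM fo fo') go) (tameE fo go) (tameE fo' go).
have s0 : (-1 : F) != 0 by rewrite oppr_eq0 oner_eq0.
by rewrite mulrDl (expfzDr _ _ s0) (expfzDr _ _ g0) exprzMl ?unitfE // invfM; ring.
Qed.

Lemma tameV f g : f != 0 -> g != 0 -> tame g f = (tame f g)^-1.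
Proof.
move=> /has_lorder [fo f0] /has_lorder [go g0].
rewrite (tameE fo go) (tameE go fo) invfM invf_div [lorder g * _]mulrC; congr (_ * _).
set t := (-1) ^ _; have t0 : t != 0 by rewrite expfz_neq0 // oppr_eq0 oner_eq0.
have tt : t * t = 1 by rewrite -exprzMl ?unitfE ?oppr_eq0 ?oner_eq0 // mulrNN mulr1 exp1rz.
by apply: (mulfI t0); rewrite divff.
Qed.

Lemma tameMr f g g' : f != 0 -> g != 0 -> g' != 0 -> tame f (g * g') = tame f g * tame f g'.
Proof.
move=> f0 g0 g0'.
have gg0 : g * g' != 0 by apply/eqP => /laurent_mulf_eq0 [] /eqP; apply/negP.
by rewrite tameV // tameMl // invfM -!tameV.
Qed.

Lemma tame_unramified f g c d : has_order f 0 c -> has_order g 0 d -> tame f g = 1.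
Proof. by move=> fo go; rewrite (tameE fo go) mul0r !expr0z mul1r divr1. Qed.
End Tame.

Lemma unit_1Bnil (R : comUnitRingType) (x : R) n : x ^+ n = 0 -> 1 - x \is a GRing.unit.
Proof.
move=> xn; apply/unitrPr; exists (\sum_(i < n) x ^+ i).
by have := subrX1 x n; rewrite xn sub0r => /eqP; rewrite eqr_oppLR -mulNr opprB => /eqP <-.
Qed.

Section GammaImage.
Variables (R : comUnitRingType) (F : fieldType) (th : {rmorphism R -> F}).
Implicit Types u w : gamma R.

Lemma rmorph_nil x n : x ^+ n = 0 -> th x = 0.
Proof.
by move/(congr1 th); rewrite rmorphXn rmorph0 => /eqP; rewrite expf_eq0 => /andP[_ /eqP].
Qed.

(** In a field the nilpotent a_{-i} become 0, so the order at the image is [g_ord u]. *)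
Lemma gamma_order u : has_order (lmap th (gamma_series u)) (g_ord u) (th (g_lead u)).
Proof.
have negE : lmap th (\prod_(1 <= i < (g_len u).+1) (1 - lconst (g_neg u i) * zpow R (- i%:Z))) = 1.
  rewrite rmorph_prod big_nat big1 // => i ilen.
  have [n /rmorph_nil ni] := @g_negP _ u i ilen.
  by rewrite rmorphB rmorph1 rmorphM /= lmap_lconst ni rmorph0 mul0r subr0.
have posE : has_order (lmap th (lprod (g_pos u))) 0 1.
  split; rewrite ?oner_eq0 //; first by apply: vb_lmap; case.
  by rewrite /= big_geq // coef1 rmorph1.
have leadE : has_order (lconst (th (g_lead u))) 0 (th (g_lead u)).
  split=> //; first exact: vb_lconst.
  by rewrite -unitfE; apply: rmorph_unit; apply: g_leadP.
have zE : has_order (zpow F (g_ord u)) (g_ord u) 1.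
  by split; rewrite ?oner_eq0 //=; [apply: vb_zpow | rewrite eqxx].
rewrite /gamma_series 3!rmorphM /= negE mulr1 lmap_lconst lmap_zpow.
by have := has_orderM (has_orderM leadE zE) posE; rewrite add0r addr0 !mulr1.
Qed.

Section Cross.
Variables (a : nat -> R) (h : nat) (b : nat -> R).
Hypothesis bnil : forall j, (0 < j <= h)%N -> exists e : nat, b j ^+ e = 0.

Let factor i := \prod_(1 <= j < h.+1)
  (1 - a i ^+ (j %/ gcdn i j) * b j ^+ (i %/ gcdn i j)) ^+ gcdn i j.

Let factor_nil i j : (0 < i)%N -> (0 < j <= h)%N ->
  exists e : nat, (a i ^+ (j %/ gcdn i j) * b j ^+ (i %/ gcdn i j)) ^+ e = 0.
Proof.
move=> i0 jh; have [e be] := bnil jh; exists e.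
have [t ->] : exists t, (i %/ gcdn i j)%N = t.+1.
  exists (i %/ gcdn i j).-1; rewrite prednK // divn_gt0 ?gcdn_gt0 ?i0 //.
  by rewrite dvdn_leq // dvdn_gcdl.
by rewrite exprMn exprSr exprMn -[b j ^+ t ^+ e * _]mulrC be mul0r mulr0.
Qed.

(** An infinite support would give the default value 1, which is the product over the empty list; so
    the result is a finite product of factors in every case. *)
Lemma cross_product_seq : exists r : seq nat, (forall i, i \in r -> (0 < i)%N) /\
  cross_product a h b = \prod_(i <- r) factor i.
Proof.
rewrite /cross_product; case: finite_supportP => [_|r rP _ _]; first by exists [::]; rewrite big_nil.
by exists (finmap.enum_fset r); split=> // i ir; apply: rP.
Qed.

Lemma cross_product_unit : cross_product a h b \is a GRing.unit.
Proof.
have [r [r0 ->]] := cross_product_seq; rewrite big_seq; apply: rpred_prod => i /r0 i0.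
rewrite /factor big_nat; apply: rpred_prod => j jh; apply: rpredX.
by have [e he] := factor_nil i0 jh; apply: unit_1Bnil he.
Qed.

Lemma cross_product_image : th (cross_product a h b) = 1.
Proof.
have [r [r0 ->]] := cross_product_seq; rewrite rmorph_prod big_seq big1 // => i /r0 i0.
rewrite /factor rmorph_prod big_nat big1 // => j jh.
by have [e /rmorph_nil he] := factor_nil i0 jh; rewrite rmorphXn rmorphB rmorph1 he subr0 expr1n.
Qed.
End Cross.

Lemma rmorph_expz (x : R) (n : int) : x \is a GRing.unit -> th (x ^ n) = th x ^ n.
Proof. by move=> xu; rewrite rmorphXz. Qed.

Lemma symbol_ratio_image u w :
  th (symbol_ratio u w) = th (g_lead u) ^ g_ord w / th (g_lead w) ^ g_ord u.
Proof.
have cu := cross_product_unit (g_pos u) (@g_negP _ w).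
have cw := cross_product_unit (g_pos w) (@g_negP _ u).
rewrite /symbol_ratio rmorphM rmorphV ?unitrM ?unitrXz ?g_leadP ?cw //; last first.
rewrite !rmorphM !rmorph_expz ?g_leadP // !cross_product_image ?mulr1 //; exact: g_negP.
Qed.

(** A morphism to a field sends exactly one idempotent of the partition to 1 and the others to 0,
    and so selects one piece. *)
Lemma glue_tame r (e : 'I_r -> R) (u w : 'I_r -> gamma R) : idempotent_partition e ->
  th (\sum_i e i * ((-1) ^ (g_ord (u i) * g_ord (w i)) * symbol_ratio (u i) (w i))) =
  tame (lmap th (Defs.glue e u)) (lmap th (Defs.glue e w)).
Proof.
move=> [eI e1].
have [i0 ei0] : exists i, th (e i) != 0.
  apply: contrapT => none; have /eqP := congr1 th e1; rewrite rmorph1 rmorph_sum big1.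
    by rewrite eq_sym oner_eq0.
  by move=> i _; apply/eqP/negPn/negP => ei; apply: none; exists i.
have ei1 : th (e i0) = 1.
  have := congr1 th (eI i0 i0); rewrite eqxx mulr1n rmorphM => h.
  by apply: (mulfI ei0); rewrite h mulr1.
have ei i : i != i0 -> th (e i) = 0.
  move=> ii; have := congr1 th (eI i i0); rewrite (negPf ii) mulr0n rmorphM ei1 mulr1 => ->.
  exact: rmorph0.
have gE (d : 'I_r -> gamma R) : lmap th (Defs.glue e d) = lmap th (gamma_series (d i0)).
  rewrite /Defs.glue rmorph_sum (bigD1 i0) //= big1 ?addr0 => [|i ii].
    by rewrite rmorphM /= lmap_lconst ei1 rmorph1 mul1r.
  by rewrite rmorphM /= lmap_lconst ei // rmorph0 mul0r.
rewrite !gE (tameE (gamma_order _) (gamma_order _)) rmorph_sum (bigD1 i0) //= big1 ?addr0.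
  rewrite rmorphM ei1 mul1r rmorphM rmorph_expz ?unitrN ?unitr1 // rmorphN rmorph1.
  by rewrite symbol_ratio_image.
by move=> i ii; rewrite rmorphM ei // mul0r.
Qed.
End GammaImage.

Section GeometricData.
Variables (k : finFieldType) (C : curve k) (B : comUnitAlgType k).
Variables (F : closedFieldType) (pi : {rmorphism B -> F}).

(** The embeddings of k(p) are one of them followed by the powers of Frobenius; they are indexed by
    all integers, but only those below the degree are used as points. *)
Lemma geometric_points : exists sg : forall p : closed_point C, nat -> {rmorphism residue_field p -> F},
  [/\ forall p i c, sg p i c%:A = pi (in_alg B c),
      forall p n (b : 'I_n -> residue_field p),
        (forall c : 'I_n -> k, \sum_l c l *: b l = 0 -> forall l, c l = 0) ->
        \matrix_(l < n, i < n) sg p i (b l) \in unitmx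
    & forall p, exists th : nat -> {rmorphism residue_tensor B p -> F},
      (forall i x, th i x = \sum_l pi (x l) * sg p i (fbasis (finite_alg_ext (residue_field p)) l)) /\
      forall x, pi (residue_norm x) = \prod_(i < degree p) th i x].
Proof.
pose f : {rmorphism k -> F} := pi \o in_alg B.
have sgP (p : closed_point C) : exists sg : nat -> {rmorphism residue_field p -> F},
   (forall i c, sg i c%:A = f c) /\
   forall n (b : 'I_n -> residue_field p),
        (forall c : 'I_n -> k, \sum_l c l *: b l = 0 -> forall l, c l = 0) ->
        \matrix_(l < n, i < n) sg i (b l) \in unitmx.
  have [s0 s0c] := finite_ext_embedding f (residue_field p).
  have /choice [sg sgE] i := frobenius_morphism s0 f i.
  exists sg; split=> [i c|n b bfree]; first by rewrite sgE s0c -rmorphXn expf_card_iter.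
  have := @finite_span_dual k _ _ (in_alg (residue_field p)) f s0 n b s0c (fmorph_inj s0).
  rewrite (_ : \matrix_(l, i) sg i (b l) = \matrix_(l, i) s0 (b l) ^+ (#|k| ^ i)); last first.
    by apply/matrixP => l i; rewrite !mxE sgE.
  apply=> c c0; apply: bfree; rewrite -[RHS]c0.
  by apply: eq_bigr => l _; rewrite mulr_algl.
exists (fun p => projT1 (cid (sgP p))); split=> [p i c|p n b bfree|p].
- by case: (projT2 (cid (sgP p))) => -> _.
- by case: (projT2 (cid (sgP p))) => _; apply.
move: (projT1 (cid (sgP p))) (projT2 (cid (sgP p))) => sg [sgc sgu].
have /choice [th thE] i : exists h : {rmorphism residue_tensor B p -> F}, forall x,
    h x = \sum_l pi (x l) * sg i (fbasis (finite_alg_ext (residue_field p)) l).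
  have [h hE] := @tens_lift _ _ (in_alg B) _ (finite_alg_ext (residue_field p)) _ pi (sg i)
    (fun c => esym (sgc i c)).
  by exists h.
exists th; split=> // x.
have su : \matrix_(l < fdim (finite_alg_ext (residue_field p)),
    i < fdim (finite_alg_ext (residue_field p))) sg i (fbasis (finite_alg_ext (residue_field p)) l) \in unitmx.
  apply: sgu => c c0 l.
  have := fcoord_uniq (hF := finite_alg_ext (residue_field p)) (esym c0) l => <-.
  by apply: (fcoord_uniq (c := fun=> 0)); rewrite big1 // => i _; rewrite scale0r.
have := norm_product sgc su thE x; rewrite -/(residue_norm x) => ->.
by rewrite fdim_ext.
Qed.
End GeometricData.

(** * Factorization of invertible Laurent series *)

Section NilradicalPowers.
Variable R : comUnitRingType.

Definition nilpotent_elt (x : R) := exists n : nat, x ^+ n = 0.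

(** The powers of the nilradical, generated by products and sums; the power 0 is the whole ring. *)
Inductive nilpow : nat -> R -> Prop :=
| Nilpow0 x : nilpow 0 x
| NilpowM n x y : nilpotent_elt x -> nilpow n y -> nilpow n.+1 (x * y)
| NilpowD n x y : nilpow n x -> nilpow n y -> nilpow n (x + y).

Lemma nilpow_0 n : nilpow n 0.
Proof.
elim: n => [|n IH]; first exact: Nilpow0.
by rewrite -[0](mulr0 0); apply: NilpowM => //; exists 1; rewrite expr1.
Qed.

Lemma nilpow_scale n r x : nilpow n x -> nilpow n (r * x).
Proof.
elim=> [y|m y z yn _ IH|m y z _ IHy _ IHz]; first exact: Nilpow0.
  by rewrite mulrCA; apply: NilpowM.
by rewrite mulrDr; apply: NilpowD.
Qed.

Lemma nilpowN n x : nilpow n x -> nilpow n (- x).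
Proof. by rewrite -mulN1r; apply: nilpow_scale. Qed.

Lemma nilpowB n x y : nilpow n x -> nilpow n y -> nilpow n (x - y).
Proof. by move=> xn yn; apply: NilpowD => //; apply: nilpowN. Qed.

Lemma nilpow_mul m n x y : nilpow m x -> nilpow n y -> nilpow (m + n) (x * y).
Proof.
move=> xm yn; elim: xm => [z|i z t zn _ IH|i z t _ IHz _ IHt].
- exact: nilpow_scale.
- by rewrite -mulrA addSn; apply: NilpowM.
- by rewrite mulrDl; apply: NilpowD.
Qed.

Lemma nilpowS n x : nilpow n.+1 x -> nilpow n x.
Proof.
move=> h; have [m mE] : exists m, m = n.+1 by exists n.+1.
move: h; rewrite -mE => h; elim: h n mE => // [i y z _ zi _ n [<-]|i y z _ IHy _ IHz n iE].
  exact: nilpow_scale.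
by apply: NilpowD; [apply: IHy | apply: IHz].
Qed.

Lemma nilpow_le m n x : (m <= n)%N -> nilpow n x -> nilpow m x.
Proof.
move=> /subnK <-; elim: (n - m)%N => // d IH h; apply: IH; exact: nilpowS.
Qed.

Lemma nilpow_sum n (I : Type) (r : seq I) (P : pred I) (f : I -> R) :
  (forall i, P i -> nilpow n (f i)) -> nilpow n (\sum_(i <- r | P i) f i).
Proof.
move=> h; elim/big_rec: _ => [|i x Pi xn]; first exact: nilpow_0.
by apply: NilpowD => //; apply: h.
Qed.

Lemma nilpowX n x j : nilpow n x -> nilpow (j * n) (x ^+ j).
Proof.
move=> xn; elim: j => [|j IH]; first exact: Nilpow0.
by rewrite exprS mulSn; apply: nilpow_mul.
Qed.

Lemma nilpow_nil x : nilpotent_elt x -> nilpow 1 x.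
Proof. by move=> xn; rewrite -[x]mulr1; apply: NilpowM => //; apply: Nilpow0. Qed.

Variable s0 : seq R.
Hypothesis s0P : forall x, x \in s0.

Lemma nilpotent_prod_seq (r : seq R) : exists e : nat, forall s : seq R,
  (forall x, x \in s -> x \in r /\ nilpotent_elt x) -> (e <= size s)%N -> \prod_(x <- s) x = 0.
Proof.
elim: r => [|y r [e IH]].
  by exists 1%N => -[|x s] // /(_ x); rewrite mem_head => /(_ isT) [].
have [[E yE]|ny] := pselect (nilpotent_elt y); last first.
  exists e => s sr es; apply: IH => // x xs; have [+ xn] := sr x xs.
  by rewrite inE => /orP [/eqP xy|//]; case: ny; rewrite -xy.
exists (e + E)%N => s sr es.
have cs : (count_mem y s + count (predC1 y) s = size s)%N by apply: count_predC.
rewrite (bigID (pred1 y)) /=; have [Ec|cE] := leqP E (count_mem y s).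
  rewrite (eq_bigr (fun=> y)) => [|x /eqP //].
  by rewrite big_const_seq iter_mulr_1 -(subnK Ec) exprD yE mulr0 mul0r.
rewrite -[X in _ * X]big_filter [X in _ * X]IH ?mulr0 //; last first.
  by rewrite size_filter; move: cE cs es; set u := count _ s; set v := count _ s; clear; lia.
move=> x; rewrite mem_filter => /andP[xy xs]; have [+ xn] := sr x xs.
by rewrite inE (negPf xy).
Qed.

Lemma nilradical_nilpotent : exists e : nat, forall x, nilpow e x -> x = 0.
Proof.
have [e eP] := nilpotent_prod_seq s0; exists e => x xe.
suff h n : nilpow n x -> forall s : seq R, (forall y, y \in s -> nilpotent_elt y) ->
    (n + size s = e)%N -> x * \prod_(y <- s) y = 0.
  by have := h e xe [::]; rewrite big_nil mulr1; apply=> //; rewrite addn0.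
move: x {xe} => x; elim=> [y|i y z yn _ IH|i y z _ IHy _ IHz] s sn se.
- by rewrite eP ?mulr0 // => [u us|]; [split; [exact: s0P | exact: sn] | rewrite -se].
- rewrite [y * z]mulrC -mulrA -(big_cons _ _ y s xpredT id) IH //; last by rewrite -se /= addnS.
  by move=> u; rewrite inE => /orP [/eqP -> | /sn].
- by rewrite mulrDl IHy ?IHz ?addr0.
Qed.

Lemma nilpow_nilpotent x : nilpow 1 x -> nilpotent_elt x.
Proof.
have [e eP] := nilradical_nilpotent => xn; exists e; apply: eP.
by have := nilpowX e xn; rewrite muln1.
Qed.

(** Iterating (x, y) |-> (x, x y) on the finite set of pairs treats all x at once. *)
Lemma idempotent_power : exists2 M : nat, (0 < M)%N & forall x : R, x ^+ M * x ^+ M = x ^+ M.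
Proof.
pose T := seq_sub s0; pose enc x : T := SeqSub (s0P x).
have [M M0 ME] := iter_idempotent (fun t : T * T => (t.1, enc (val t.1 * val t.2))).
have iterE x y j : iter j (fun t : T * T => (t.1, enc (val t.1 * val t.2))) (enc x, enc y) =
    (enc x, enc (x ^+ j * y)).
  by elim: j => [|j IH]; rewrite ?mul1r // iterS IH /= exprS mulrA.
exists M => // x; have := congr1 (fun t : T * T => val t.2) (ME (enc x, enc 1)).
by rewrite !iterE /= !mulr1 -exprD.
Qed.

(* The pieces are the products of c^M or 1 - c^M over all elements c of R, where
   c^M is idempotent for every c. *)
Lemma spectrum_partition : exists (r : nat) (e : 'I_r -> R), idempotent_partition e /\
  forall i c, (exists d, e i * (c * d) = e i) \/ exists n : nat, e i * c ^+ n = 0.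
Proof.
have [M M0 MI] := idempotent_power.
pose S := {ffun 'I_(size s0) -> bool}.
pose ep (j : 'I_(size s0)) : R := s0`_j ^+ M.
have epI j : ep j * ep j = ep j by apply: MI.
pose fac j (b : bool) := if b then ep j else 1 - ep j.
have facI j b : fac j b * fac j b = fac j b.
  case: b; rewrite /= ?epI //.
  by transitivity (1 - ep j - (ep j - ep j * ep j)); [ring | rewrite epI subrr subr0].
have fac0 j b : fac j b * fac j (~~ b) = 0.
  by case: b; rewrite /= ?mulrBr ?mulrBl ?mul1r ?mulr1 epI subrr.
pose E (f : S) := \prod_j fac j (f j).
have EI f : E f * E f = E f.
  by rewrite -big_split; apply: eq_bigr => j _; apply: facI.
have E0 f g : f != g -> E f * E g = 0.
  move=> fg; have [j fj] : exists j, f j != g j.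
    apply/existsP; rewrite -negb_forall; apply: contraNN fg => /forallP h.
    by apply/eqP/ffunP => j; apply/eqP.
  rewrite -big_split (bigD1 j) //= (_ : g j = ~~ f j) ?fac0 ?mul0r //.
  by move: fj; case: (f j) (g j) => [] [].
have E1 : \sum_f E f = 1.
  rewrite /E -(bigA_distr_bigA fac); apply: big1 => j _.
  by rewrite big_bool /= addrCA subrr addr0.
exists #|S|, (fun i => E (enum_val i)); split; first split.
- move=> i j; have [->|ij] := eqVneq i j; first by rewrite EI mulr1n.
  by rewrite mulr0n E0 // (inj_eq enum_val_inj).
- by rewrite -E1 (reindex (enum_val (A := S))) //=; apply/onW_bij/enum_val_bij.
move=> i c; set f := enum_val i.
have cs : (index c s0 < size s0)%N by rewrite index_mem.
pose j := Ordinal cs; have cE : s0`_j = c by rewrite nth_index.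
have Ej : E f * fac j (f j) = E f.
  by rewrite /E (bigD1 j) //= mulrAC facI.
have Ej0 : E f * fac j (~~ f j) = 0.
  by rewrite /E (bigD1 j) //= mulrAC fac0 mul0r.
case: (f j) Ej Ej0; rewrite /= /ep cE => h h0; [left|right; by exists M].
by exists (c ^+ M.-1); rewrite -exprS prednK.
Qed.
End NilradicalPowers.

Section ProductExpansion.
Variable R : comUnitRingType.
Local Notation factors a n := (\prod_(1 <= i < n) (1 - (a i)%:P * 'X^i) : {poly R}).

Lemma factors0 (a : nat -> R) n : (factors a n)`_0 = 1.
Proof.
elim: n => [|[|n] IH]; [by rewrite big_geq // coef1 | by rewrite big_geq // coef1 |].
by rewrite big_nat_recr //= coefM big_ord1 IH coefB coef1 coefCM coefXn mulr0 subr0 mulr1.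
Qed.

Lemma factors_recr (a : nat -> R) n d : (d <= n.+1)%N ->
  (factors a n.+2)`_d = (factors a n.+1)`_d - a n.+1 *+ (d == n.+1).
Proof.
move=> dn; rewrite big_nat_recr //= mulrBr mulr1 coefB; congr (_ - _).
rewrite mulrA coefMXn; case: ltngtP dn => // -> _.
by rewrite subnn coefMC factors0 mul1r mulr1n.
Qed.

Lemma factors_stable (a : nat -> R) n d : (d < n)%N -> (factors a n)`_d = (factors a d.+1)`_d.
Proof.
move=> /subnK <-; elim: (n - d.+1)%N => // j IH.
have dj : (d < (j + d).+1)%N by rewrite ltnS leq_addl.
by rewrite addSn addnS factors_recr 1?ltnW // ltn_eqF // mulr0n subr0 -addnS.
Qed.

(** The factor 1 - a_d X^d is the first to involve a_d and changes the coefficient of X^d by -a_d,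
    which determines a recursively. *)
Lemma product_expansion (c : nat -> R) : c 0%N = 1 ->
  exists a : nat -> R, forall d, (factors a d.+1)`_d = c d.
Proof.
move=> c0; have [a aE] := strong_recursion (fun s : seq R =>
  (\prod_(1 <= i < size s) (1 - (nth 0 s i)%:P * 'X^i))`_(size s) - c (size s)).
exists a => -[|d]; first by rewrite factors0.
rewrite factors_recr // eqxx mulr1n aE size_mkseq opprB addrCA.
rewrite (_ : \prod_(1 <= i < d.+1) _ = \prod_(1 <= i < d.+1) (1 - (nth 0 (mkseq a d.+1) i)%:P * 'X^i)).
  by rewrite subrr addr0.
by apply: eq_big_nat => i /andP[_ id]; rewrite nth_mkseq.
Qed.

Definition weighted (wt : nat -> nat) (p : {poly R}) := forall d, nilpow (wt d) p`_d.

Lemma weightedM wt p q : (forall i j, wt (i + j) <= wt i + wt j)%N ->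
  weighted wt p -> weighted wt q -> weighted wt (p * q).
Proof.
move=> wtD pw qw d; rewrite coefM; apply: nilpow_sum => i _.
apply: (@nilpow_le _ _ (wt i + wt (d - i))%N); last by apply: nilpow_mul.
by rewrite -{1}(subnKC (ltnSE (ltn_ord i))).
Qed.

(** By subadditivity, the polynomials with d-th coefficient in the power [wt d] of the nilradical
    are closed under products, so the recursion for a stays within these powers. *)
Lemma product_expansion_weight wt (c a : nat -> R) : wt 0%N = 0%N ->
  (forall i j, wt (i + j) <= wt i + wt j)%N -> (forall d, nilpow (wt d) (c d)) ->
  (forall d, (factors a d.+1)`_d = c d) -> forall i, (0 < i)%N -> nilpow (wt i) (a i).
Proof.
move=> w0 wtD cw aE; elim/ltn_ind => -[|i] // IH _.
have fw : weighted wt (factors a i.+1).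
  rewrite big_nat; elim/big_rec: _ => [|j x /andP[j0 ji] xw].
    by move=> d; rewrite coef1; case: d => [|d]; [rewrite w0; apply: Nilpow0 | apply: nilpow_0].
  apply: weightedM => // d; rewrite coefB coef1 coefCM coefXn; apply: nilpowB.
    by case: d => [|d]; [rewrite w0; apply: Nilpow0 | apply: nilpow_0].
  by have [->|_] := eqVneq d j; rewrite ?mulr1 ?mulr0; [apply: IH | apply: nilpow_0].
have -> : a i.+1 = (factors a i.+1)`_i.+1 - c i.+1.
  by rewrite -aE factors_recr // eqxx mulr1n opprB addrCA subrr addr0.
by apply: nilpowB.
Qed.
End ProductExpansion.

Section LaurentIdeals.
Variable R : comUnitRingType.
Implicit Types f g : laurent R.

Definition lnilpow t f := forall i, nilpow t (f i).
Definition vanishes_from (b : int) f := forall i, b <= i -> f i = 0.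

Lemma lnilpowD t f g : lnilpow t f -> lnilpow t g -> lnilpow t (f + g).
Proof. by move=> ft gt i; apply: NilpowD. Qed.
Lemma lnilpowN t f : lnilpow t f -> lnilpow t (- f).
Proof. by move=> ft i; apply: nilpowN. Qed.
Lemma lnilpowM s t f g : lnilpow s f -> lnilpow t g -> lnilpow (s + t) (f * g).
Proof.
move=> fs gt n; have [[a fa] [b gb]] := (lcoef_bounded f, lcoef_bounded g).
have [nab|abn] := ltP n (a + b); first by rewrite (vbM fa gb nab); apply: nilpow_0.
have -> : n = a + b + `|(n - (a + b))%R|%N%:Z by lia.
rewrite (lcoefM fa gb (ltnSn _)) coefM; apply: nilpow_sum => i _.
apply: nilpow_mul; rewrite coef_poly; case: ifP => _ //; exact: nilpow_0.
Qed.
Lemma lnilpow0 f : lnilpow 0 f. Proof. by move=> i; apply: Nilpow0. Qed.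
Lemma lnilpow_scale t f g : lnilpow t g -> lnilpow t (f * g).
Proof. by move=> gt; have := lnilpowM (lnilpow0 f) gt. Qed.
Lemma lnilpowX t f n : lnilpow t f -> lnilpow (n * t) (f ^+ n).
Proof.
move=> ft; elim: n => [|n IH]; first exact: lnilpow0.
by rewrite exprS mulSn; apply: lnilpowM.
Qed.

Lemma vanishes_fromM f g : vanishes_from 0 f -> vanishes_from 0 g -> vanishes_from 0 (f * g).
Proof.
move=> f0 g0 n n0; apply: fsbig1 => i _; have [i0|i0] := leP 0 i; first by rewrite f0 ?mul0r.
by rewrite g0 ?mulr0 //; lia.
Qed.

Variable s0 : seq R.
Hypothesis s0P : forall x, x \in s0.

Lemma lnilpow_inverse f : lnilpow 1 f -> exists g, (1 + f) * g = 1.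
Proof.
have [e eP] := nilradical_nilpotent s0P => f1; exists (\sum_(i < e) (- f) ^+ i).
have fe : (- f) ^+ e = 0.
  apply: laurentP => i; apply: eP; have := lnilpowX e (lnilpowN f1) i; by rewrite muln1.
by have := subrX1 (- f) e; rewrite fe sub0r => /eqP; rewrite eqr_oppLR -mulNr opprB opprK => /eqP <-.
Qed.

Definition neg_part (f : laurent R) : exists a, vanishes_below a (fun i : int => if i < 0 then f i else 0).
Proof. by have [a fa] := lcoef_bounded f; exists a => i /fa ->; case: ifP. Qed.

Definition lneg f : laurent R := Laurent (neg_part f).

(* The error n is improved by splitting it into its negative part a and its
   remaining part b: (1 + a) (1 + b) = 1 + n + a b. *)
Lemma splitting f : (forall i, i < 0 -> nilpotent_elt (f i)) -> f 0 \is a GRing.unit ->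
  exists Q P : laurent R, [/\ f = (1 + Q) * P, vanishes_from 0 Q, lnilpow 1 Q,
    vanishes_below 0 P & P 0 \is a GRing.unit].
Proof.
move=> fneg f0; have [e eP] := nilradical_nilpotent s0P.
suff [Q [P [n [fE [Q0 Q1 P0 Pu] n1]]]] : exists Q P n : laurent R, [/\ f = (1 + Q) * P * (1 + n),
    [/\ vanishes_from 0 Q, lnilpow 1 Q, vanishes_below 0 P & P 0 \is a GRing.unit] & lnilpow e n].
  exists Q, P; split=> //; rewrite fE (_ : n = 0) ?addr0 ?mulr1 //.
  by apply: laurentP => i; apply: eP.
have negP g : vanishes_from 0 (lneg g) by move=> i i0 /=; rewrite ltNge i0.
have posP g : vanishes_below 0 (g - lneg g) by move=> i i0; rewrite lcoefB /= i0 subrr.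
have neg_nil g t : lnilpow t g -> lnilpow t (lneg g).
  by move=> gt i /=; case: ifP => _ //; exact: nilpow_0.
suff ind t : exists Q P n : laurent R, [/\ f = (1 + Q) * P * (1 + n),
    [/\ vanishes_from 0 Q, lnilpow 1 Q, vanishes_below 0 P & P 0 \is a GRing.unit] & lnilpow t.+1 n].
  have [Q [P [n [fE h n1]]]] := ind e; exists Q, P, n; split=> // i; exact/nilpowS/n1.
elim: t => [|t [Q [P [n [fE [Q0 Q1 P0 Pu] nt]]]]].
  have Pu : (f - lneg f) 0 \is a GRing.unit by rewrite lcoefB /= subr0.
  have [|g g0 Pg] := @laurent_inverse _ (f - lneg f) (posP f).
    by exists ((f - lneg f) 0)^-1; rewrite divrr.
  exists 0, (f - lneg f), (g * lneg f); split.
  - by rewrite addr0 mul1r mulrDr mulr1 mulrA Pg mul1r subrK.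
  - by split=> // i; exact: nilpow_0.
  - apply: lnilpow_scale => i /=; case: ifP => [i0|_]; last exact: nilpow_0.
    by apply: nilpow_nil; apply: fneg.
pose a := lneg n; pose b := n - lneg n.
have at1 : lnilpow t.+1 a by apply: neg_nil.
have bt1 : lnilpow t.+1 b by apply: lnilpowD => //; apply: lnilpowN.
have le1 g : lnilpow t.+1 g -> lnilpow 1 g by move=> gt i; apply: nilpow_le (gt i).
have nE : n = a + b by rewrite /a /b addrC subrK.
have [g gE] : exists g, (1 + (a + b + a * b)) * g = 1.
  apply: lnilpow_inverse; apply: lnilpowD; first by rewrite -nE; apply: le1.
  by apply: le1; apply: lnilpow_scale.
exists (Q + a + Q * a), (P * (1 + b)), (- (g * (a * b))); split.
- rewrite fE nE; have -> : (1 + (a + b)) = (1 + (a + b + a * b)) * (1 - g * (a * b)).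
    by rewrite mulrBr mulr1 [(_ * (g * _))]mulrA gE mul1r; ring.
  by ring.
- have b0 : vanishes_below 0 (1 + b) by apply: vbD; [exact: vb1 | exact: posP].
  split.
  + move=> i i0; rewrite !lcoefD Q0 // negP // vanishes_fromM ?addr0 //; exact: negP.
  + apply: lnilpowD; [apply: lnilpowD => //; exact: le1 | by apply: lnilpow_scale; apply: le1].
  + by rewrite -[0]addr0; apply: vbM.
  + rewrite -[0]addr0 lead_mul // unitrM Pu lcoefD lcoef1 eqxx -[_ 0]opprK.
    have [u uE] := nilpow_nilpotent s0P (nilpowN (le1 _ bt1 0)).
    exact: unit_1Bnil uE.
- apply: lnilpowN; rewrite (_ : t.+2 = 0 + (1 + t.+1))%N //; apply: lnilpowM; first exact: lnilpow0.
  by apply: lnilpowM => //; apply: le1.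
Qed.

Lemma horner_zpowV (p : {poly R}) j :
  (map_poly (@lconst R) p).[zpow R (-1)] j = if j <= 0 then p`_`|j|%N else 0.
Proof.
elim/poly_ind: p j => [|p c IH] j; first by rewrite rmorph0 horner0 coef0; case: ifP.
rewrite rmorphD rmorphM /= map_polyX map_polyC /= hornerD hornerMX hornerC lcoefD.
rewrite mulrC zpow_mulE IH coefD coefMX coefC opprK /=.
have [j0|j0|->] := ltgtP j 0; rewrite ?addr0 ?add0r //.
- rewrite (_ : (`|j|%N == 0)%N = false) 1?(_ : j + 1 <= 0) ?addr0; [|lia|lia].
  by congr (_`_ _)%R; lia.
- by rewrite (_ : (j + 1 <= 0) = false) //; lia.
Qed.

(* The i-th factor of a product expansion in 1/z lies in a power of the
   nilradical that grows with i, so the expansion is finite. *)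
Lemma negative_product Q : vanishes_from 0 Q -> lnilpow 1 Q ->
  exists (l : nat) (a : nat -> R), (forall i, (0 < i <= l)%N -> nilpotent_elt (a i)) /\
    1 + Q = \prod_(1 <= i < l.+1) (1 - lconst (a i) * zpow R (- i%:Z)).
Proof.
move=> Q0 Q1; have [e eP] := nilradical_nilpotent s0P.
have [L QL] : exists L : nat, vanishes_below (- L.+1%:Z) Q.
  have [b Qb] := lcoef_bounded Q; exists `|b|%N; apply: vb_le Qb; lia.
pose c d := (1 + Q) (- d%:Z).
have c0 : c 0%N = 1 by rewrite /c lcoefD lcoef1 Q0 // addr0 oppr0 eqxx.
have [a aE] := product_expansion c0.
(* The ceiling of d / (L + 1): c d is nilpotent for 0 < d <= L + 1 and zero beyond, hence lies in
   the power [wt d]; and a i vanishes once [wt i] reaches the nilpotency index e. *)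
pose wt d := ((d + L) %/ L.+1)%N.
have wtD i j : (wt (i + j) <= wt i + wt j)%N.
  rewrite /wt -ltnS ltn_divLR //.
  have := ltn_ceil (i + L) (ltn0Sn L); have := ltn_ceil (j + L) (ltn0Sn L).
  by set x := (_ %/ _)%N; set y := (_ %/ _)%N; clear; nia.
have wt0 : wt 0%N = 0%N by rewrite /wt divn_small.
have cw d : nilpow (wt d) (c d).
  case: d => [|d]; first by rewrite wt0; apply: Nilpow0.
  rewrite /c lcoefD lcoef1 (_ : (- d.+1%:Z == 0 :> int) = false) ?add0r; last by lia.
  have [dL|Ld] := leqP d.+1 L.+1; last by rewrite QL; [apply: nilpow_0 | lia].
  by apply: nilpow_le (Q1 _); rewrite /wt -ltnS ltn_divLR //; lia.
have aw := product_expansion_weight wt0 wtD cw aE.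
have a0 i : (0 < i)%N -> (e * L.+1 <= i)%N -> a i = 0.
  move=> i0 ei; apply: eP; apply: nilpow_le (aw i i0).
  by rewrite /wt leq_divRL //; apply: leq_trans ei (leq_addr _ _).
pose l := (e * L.+1)%N.
exists l, a; split=> [i /andP[i0 _]|].
  apply: (nilpow_nilpotent s0P); apply: nilpow_le (aw i i0).
  by rewrite /wt leq_divRL //; lia.
pose q : {poly R} := \prod_(1 <= i < l.+1) (1 - (a i)%:P * 'X^i).
have qE d : q`_d = c d.
  rewrite -aE /q; have [dl|ld] := leqP d l; first by apply: factors_stable.
  rewrite (big_cat_nat (n := l.+1) _ _ (m := 1%N) (p := d.+1)) //=; last exact: ltnW.
  rewrite [X in _ * X]big_nat [X in _ * X]big1 ?mulr1 // => i /andP[li _].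
  by rewrite a0 ?polyC0 ?mul0r ?subr0 //; [apply: leq_ltn_trans li | apply: ltnW].
transitivity (map_poly (@lconst R) q).[zpow R (-1)].
  apply: laurentP => j; rewrite horner_zpowV qE /c; case: ifPn => j0.
    by congr ((1 + Q) _); lia.
  by rewrite lcoefD lcoef1 Q0 ?addr0; [case: eqP => // j1; move: j0; rewrite j1 | lia].
rewrite /q rmorph_prod horner_prod; apply: eq_bigr => i _.
rewrite rmorphB rmorph1 rmorphM /= map_polyC map_polyXn !hornerE zpowX /=.
by rewrite mulN1r.
Qed.

(** After division by f n z^n, [splitting] separates the part in 1/z from a power series; each has a
    product expansion. *)
Lemma gamma_factorization f n : (forall i, i < n -> nilpotent_elt (f i)) ->
  f n \is a GRing.unit -> exists u : gamma R, f = gamma_series u.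
Proof.
move=> fn fu; pose g := lconst (f n)^-1 * (zpow R (- n) * f).
have gE i : g i = (f n)^-1 * f (i + n) by rewrite lconst_mulE zpow_mulE opprK.
have [||Q [P [gQP Q0 Q1 P0 Pu]]] := @splitting g.
- move=> i i0; have [|e fe] := fn (i + n); first by lia.
  by exists e; rewrite gE exprMn fe mulr0.
- by rewrite gE add0r mulVr // unitr1.
have [l [a [an aE]]] := negative_product Q0 Q1.
pose P1 := lconst (P 0)^-1 * P.
have P1E i : P1 i = (P 0)^-1 * P i by rewrite lconst_mulE.
have [|b bE] := @product_expansion R (fun d => P1 d%:Z); first by rewrite P1E mulVr.
have lu : f n * P 0 \is a GRing.unit by rewrite unitrM fu.
exists (@Gamma R n (f n * P 0) l a b lu an); rewrite /gamma_series /= -aE.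
have -> : lprod b = P1.
  apply: laurentP => -[d|d]; first exact: bE.
  by rewrite [RHS]P1E [P (Negz d)]P0 ?mulr0.
transitivity (lconst (f n) * zpow R n * g).
  rewrite /g mulrACA -rmorphM divrr // rmorph1 mul1r mulrA zpowD subrr zpow0 mul1r.
  by [].
rewrite gQP /P1; have cP : lconst (P 0) * lconst (P 0)^-1 = 1 by rewrite -rmorphM divrr ?rmorph1.
rewrite rmorphM /=.
transitivity (lconst (f n) * zpow R n * ((1 + Q) * P) * (lconst (P 0) * lconst (P 0)^-1)).
  by rewrite cP mulr1.
by move: (lconst _) (lconst _) (lconst _) => x y z; ring.
Qed.

End LaurentIdeals.

Section GluedSymbol.
Variables (R : comUnitRingType) (s0 : seq R).
Hypothesis s0P : forall x, x \in s0.

(** Let n be the least index at which e U has a coefficient that is not nilpotent. It exists unless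
    e is nilpotent, hence 0, because e = e U V; on the piece e that coefficient is invertible. *)
Lemma local_gamma (e : R) (U V : laurent R) : e * e = e -> U * V = 1 ->
  (forall c, (exists d, e * (c * d) = e) \/ exists n : nat, e * c ^+ n = 0) ->
  exists u, lconst e * U = lconst e * gamma_series u.
Proof.
move=> ee UV dich.
have eX n : (0 < n)%N -> e ^+ n = e.
  by case: n => // n _; elim: n => // n IH; rewrite exprS IH ee.
have nilE c : (exists n : nat, e * c ^+ n = 0) -> nilpotent_elt (e * c).
  by case=> n ec; exists n.+1; rewrite exprMn eX // exprSr mulrA ec mul0r.
have [e0|e0] := eqVneq e 0.
  have un : (1 : R) \is a GRing.unit := unitr1 R.
  have ng i : (0 < i <= 0)%N -> exists n : nat, (0 : R) ^+ n = 0 by lia.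
  by exists (@Gamma R 0 1 0 (fun=> 0) (fun=> 0) un ng); rewrite e0 rmorph0 !mul0r.
have [||n Un Umin] := @least_nonzero R U (fun c => ~~ `[< nilpotent_elt (e * c) >]).
- by rewrite negbK; apply/asboolP; rewrite mulr0; exists 1%N; rewrite expr1.
- apply: contrapT => none; case/eqP: e0.
  have Unil i : nilpow 1 (e * U i).
    apply: nilpow_nil; apply: contrapT => h; apply: none; exists i; exact/asboolPn.
  have eU : lnilpow 1 (lconst e * U) by move=> i; rewrite lconst_mulE.
  have : nilpow 1 ((lconst e * U * V) 0) by rewrite mulrC; apply: lnilpow_scale.
  rewrite -mulrA UV mulr1 /= => /(nilpow_nilpotent s0P) [j ej].
  by case: j ej => [|j]; [move/eqP; rewrite expr0 oner_eq0 | rewrite eX].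
have [d ed] : exists d, e * (U n * d) = e.
  by case: (dich (U n)) => // /nilE h; move/asboolPn: Un.
(* The term (1 - e) z^n makes the coefficient of index n a unit of R and keeps the lower ones
   nilpotent; multiplication by e removes it again. *)
pose U' := lconst e * U + lconst (1 - e) * zpow R n.
have U'E i : U' i = e * U i + (1 - e) * (i == n)%:R by rewrite lcoefD !lconst_mulE.
have [||u uE] := @gamma_factorization R s0 s0P U' n.
- move=> i i_n; rewrite U'E lt_eqF // mulr0 addr0.
  by have := Umin i i_n; rewrite negbK => /asboolP.
- apply/unitrPr; exists (e * d + (1 - e)); rewrite U'E eqxx mulr1.
  transitivity (e * e * (U n * d) + (1 - e * e) + (U n + d - 2%:R) * (e - e * e)); first by ring.
  by rewrite ee subrr mulr0 addr0 ed addrCA subrr addr0.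
exists u; rewrite -uE /U' mulrDr !mulrA -!rmorphM ee mulrBr mulr1 ee subrr rmorph0 mul0r.
by rewrite addr0.
Qed.

Lemma glue_units (U U' W W' : laurent R) : U * U' = 1 -> W * W' = 1 ->
  exists (r : nat) (e : 'I_r -> R) (u w : 'I_r -> gamma R),
    [/\ idempotent_partition e, U = Defs.glue e u & W = Defs.glue e w].
Proof.
move=> UU WW; have [r [e [[ei e1] dich]]] := spectrum_partition s0P.
have glueE V V' : V * V' = 1 -> exists u : 'I_r -> gamma R, V = Defs.glue e u.
  move=> VV; have /choice [u uE] i : exists u, lconst (e i) * V = lconst (e i) * gamma_series u.
    by apply: local_gamma VV (dich i); rewrite ei eqxx.
  exists u; rewrite /Defs.glue; under eq_bigr => i _ do rewrite -uE.
  by rewrite -mulr_suml -rmorph_sum e1 rmorph1 mul1r.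
have [[u uE] [w wE]] := (glueE _ _ UU, glueE _ _ WW).
by exists r, e, u, w.
Qed.
End GluedSymbol.

Lemma order_scale (F : fieldType) (a : F) f n c : a != 0 -> has_order f n c ->
  has_order (lconst a * f) n (a * c).
Proof.
move=> a0 fo; rewrite -[n]add0r; apply: has_orderM fo.
by split=> //; apply: vb_lconst.
Qed.

(** * Reciprocity on the tensor product *)

Section TameReciprocity.
Variables (k : finFieldType) (C : curve k).
Local Notation K := (function_field C).
Local Notation s := (constants C).
Variable iota : forall p : closed_point C, {rmorphism K -> laurent (residue_field p)}.
Hypothesis iotaP : forall p : closed_point C, laurent_expansion (iota p).
Variable oo : closed_point C.
Hypothesis oo1 : degree oo = 1%N.
Variables (F : fieldType) (io : {rmorphism k -> F}).
Variable sig : forall p : closed_point C, nat -> {rmorphism residue_field p -> F}.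
Hypothesis sig_const : forall p i c, sig p i c%:A = io c.
Hypothesis sig_dual : forall p (i : 'I_(degree p)), exists c : 'I_(degree p) -> F,
  forall i' : 'I_(degree p), \sum_l c l * sig p i' (kbasis p l) = (i == i')%:R.
Local Notation X := (closed_point C * nat)%type.
Local Notation xi := (xi iota sig).
Local Notation x0 := ((oo, 0%N) : X).

Section Basis.
Variables (e : nat -> K) (w : nat -> nat) (ga r0 : nat).
Hypothesis eP : forall j, affine iota oo (e j) /\ has_order (iota oo (e j)) (- (w j)%:Z) 1.
Hypothesis w_incr : forall j, (w j < w j.+1)%N.
Hypothesis w_stable : forall j, (r0 <= j)%N -> w j = (j + ga)%N.
Hypothesis w_onto : forall n, pole_number iota oo n -> exists j, w j = n.
Local Notation ev x P := (fspan e (xi x) P).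

(* The family G is given by an element of the ring of functions with constant  *)
(* field F that are regular away from oo, and this element divides a.         *)
Definition regular_divisor (a : K) (G : X -> laurent F) := exists P P' : {poly F},
  (forall x, ev x P = G x) /\ forall x, ev x P * ev x P' = xi x a.

Lemma regular_divisor_mul a b G : affine iota oo b -> regular_divisor a G ->
  regular_divisor (a * b) G.
Proof.
move=> bA [P [P' [PG PP]]].
have [Q QE] := kspan_onto iotaP oo1 eP w_onto bA.
have [R RE] := fspan_mul iotaP oo1 eP w_onto (xi_const iotaP sig_const) P' (map_poly io Q).
exists P, R; split=> // x; rewrite RE mulrA PP (fspan_map _ (xi_const iotaP sig_const x)).
by rewrite -QE rmorphM.
Qed.

Lemma points_cons ps : points (oo :: ps) = x0 :: points ps.
Proof. by rewrite /points /positions /= oo1. Qed.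

Lemma regular_order a G x : affine iota oo a -> a != 0 -> regular_divisor a G -> x.1 != oo ->
  exists (m : nat) c, has_order (G x) m%:Z c /\ (~ vge iota x.1 1 a -> m = 0%N).
Proof.
move=> aA a0 [P [P' [PG PP]]] xo; have [c ao] := ordP iota x.1 a0.
have := order_lmap (sig x.1 x.2) ao; rewrite -[lmap _ _]/(xi x a) -PP => PPo.
have [t [d Po]] : exists t d, has_order (ev x P) t d.
  by apply: order_exists; apply/eqP => P0; have := has_order_neq0 PPo; rewrite P0 mul0r eqxx.
have [t' [d' Po']] : exists t d, has_order (ev x P') t d.
  by apply: order_exists; apply/eqP => P0; have := has_order_neq0 PPo; rewrite P0 mulr0 eqxx.
have tge : 0 <= t by apply/(order_vb _ Po)/(ev_vge0 eP).
have tge' : 0 <= t' by apply/(order_vb _ Po')/(ev_vge0 eP).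
have [tE _] := has_order_unique (has_orderM Po Po') PPo.
exists `|t|%N, d; rewrite -PG; split; first by rewrite gez0_abs.
move=> a1; have : ~ 1 <= ord iota x.1 a by move=> /(vgeE iota x.1 1 a0).2.
by move: tge tge' tE; clear; lia.
Qed.

(** After G and H are made monic, the extracted constants c and d contribute powers whose exponents
    are the total numbers of zeros; the symbol at oo cancels them and the sign, by
    [product_formula]. *)
Lemma regular_reciprocity a ps G H : affine iota oo a -> a != 0 ->
  regular_divisor a G -> regular_divisor a H -> uniq ps -> oo \notin ps ->
  (forall p, p != oo -> vge iota p 1 a -> p \in ps) ->
  \prod_(x <- points (oo :: ps)) tame (G x) (H x) = 1.
Proof.
move=> aA a0 Ga Ha ups oops az.
have normal G' : regular_divisor a G' -> exists (c : F) (P P' : {poly F}) (m : X -> nat) (u : X -> F),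
    [/\ c != 0, P \is monic, forall x, G' x = lconst c * ev x P,
        forall x, ev x P * ev x P' = xi x a
      & forall x, x \in points ps -> has_order (ev x P) (m x)%:Z (u x)].
  move=> Ga'; have [P [P' [PG PP]]] := Ga'.
  have P0 : P != 0.
    apply/eqP => P0; have := PP x0; rewrite P0 fspan0 mul0r => /esym/eqP.
    have [d ao] := ordP iota oo a0.
    by have := order_lmap (sig oo 0) ao => /has_order_neq0; rewrite /xi /= => /negPf ->.
  have l0 : lead_coef P != 0 by rewrite lead_coef_eq0.
  pose c := lead_coef P; pose P1 := c^-1 *: P.
  have lc : lconst c * lconst c^-1 = 1 by rewrite -rmorphM divff ?rmorph1.
  have /choice [mu muE] x : exists mu : nat * F, x \in points ps ->
      has_order (ev x P1) mu.1%:Z mu.2.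
    have [xps|xps] := boolP (x \in points ps); last by exists (0%N, 0).
    have [m [d [xo _]]] := regular_order aA a0 Ga' (points_oo oops xps).
    by exists (m, c^-1 * d) => _; rewrite fspanZ PG; apply: order_scale; rewrite ?invr_neq0.
  exists c, P1, (c *: P'), (fun x => (mu x).1), (fun x => (mu x).2); split=> //.
  - by rewrite monicE lead_coefZ mulVf.
  - by move=> x; rewrite fspanZ mulrA lc mul1r PG.
  - by move=> x; rewrite !fspanZ mulrACA [lconst _ * lconst _]mulrC lc mul1r PP.
have [c [P [P' [m [u [c0 Pm PG PP Po]]]]]] := normal G Ga.
have [d [Q [Q' [n [v [d0 Qm QH QQ Qo]]]]]] := normal H Ha.
have sm := product_formula iotaP oo1 eP w_incr w_stable w_onto sig_const sig_dual Pm aA a0 PP ups oops az Po.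
have sn := product_formula iotaP oo1 eP w_incr w_stable w_onto sig_const sig_dual Qm aA a0 QQ ups oops az Qo.
have rec := affine_reciprocity iotaP oo1 eP w_incr w_stable w_onto sig_const sig_dual Pm Qm aA aA a0 a0 PP QQ ups oops az az Po Qo.
rewrite points_cons big_cons big_seq.
rewrite (eq_bigr (fun x => (-1) ^+ (m x * n x) * u x ^+ n x / v x ^+ m x *
    (c ^+ n x / d ^+ m x))) => [|x xps]; last first.
  rewrite PG QH (tameE (order_scale c0 (Po x xps)) (order_scale d0 (Qo x xps))).
  rewrite -PoszM -!exprnP !exprMn invfM.
  by ring.
rewrite -big_seq big_split /= rec prodf_div !prodrXr sm sn.
have oP := order_scale c0 (fspan_order oo1 w_incr (xi_oo eP sig) (monic_neq0 Pm)).
have oQ := order_scale d0 (fspan_order oo1 w_incr (xi_oo eP sig) (monic_neq0 Qm)).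
rewrite PG QH (tameE oP oQ) !(monicP _) // !mulr1 mulrNN -PoszM -!exprnN -!exprnP.
rewrite invrK mulrACA -expr2 -exprM mulnC exprM sqrrN !expr1n mul1r.
rewrite mulrACA mulVf ?expf_neq0 // mul1r divff ?expf_neq0 //.
Qed.
End Basis.

Section Tensor.
Variables (B : comUnitAlgType k) (finB : finite_alg B) (pi : {rmorphism B -> F}).
Hypothesis ioE : forall c, io c = pi c%:A.
Local Notation T := (function_tensor C finB).

Lemma tensor_place x : exists h : {rmorphism T -> laurent F},
  forall f, h f = \sum_i xi x (f i) * lconst (pi (fbasis finB i)).
Proof.
have [|h hE] := @tens_lift _ _ s _ finB _ (xi x) (@lconst F \o pi).
  by move=> c; rewrite (xi_const iotaP sig_const) ioE.
by exists h.
Qed.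

Variable Xi : X -> {rmorphism T -> laurent F}.
Hypothesis XiE : forall x f, Xi x f = \sum_i xi x (f i) * lconst (pi (fbasis finB i)).

Section Numerator.
Variables (e : nat -> K) (w : nat -> nat).
Hypothesis eP : forall j, affine iota oo (e j) /\ has_order (iota oo (e j)) (- (w j)%:Z) 1.
Hypothesis w_onto : forall n, pole_number iota oo n -> exists j, w j = n.

Lemma tensor_numerator f : exists (a : K) (P : {poly F}), [/\ a != 0, affine iota oo a
  & forall x, fspan e (xi x) P = xi x a * Xi x f].
Proof.
have /choice [a aP] i := denominator iotaP oo1 (f i).
have dvd i : affine iota oo ((\prod_j a j) * f i).
  rewrite (bigD1 i) //= mulrC mulrA [f i * _]mulrC; apply: affineM; first by case: (aP i).
  by rewrite -big_filter; apply: (@affine_prod _ _ iota oo) => j _; case: (aP j).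
have /choice [R RE] i := kspan_onto iotaP oo1 eP w_onto (dvd i).
exists (\prod_j a j), (\sum_i pi (fbasis finB i) *: map_poly io (R i)); split.
- by rewrite prodf_seq_neq0; apply/allP => i _; apply/implyP => _; case: (aP i).
- by apply: (@affine_prod _ _ iota oo) => i _; case: (aP i).
move=> x; rewrite fspan_sum XiE mulr_sumr; apply: eq_bigr => i _.
by rewrite (fspan_map _ (xi_const iotaP sig_const x)) -RE rmorphM mulrC mulrA.
Qed.
End Numerator.

(** Invertible elements are quotients of regular ones by affine functions. All of these divide a
    single affine function c, so that away from oo and the zeros of c the orders are 0 and the tame
    symbol is 1. *)
Lemma tensor_reciprocity f f' g g' : f * f' = 1 -> g * g' = 1 ->
  exists ps, [/\ uniq ps, oo \notin ps,
    \prod_(x <- points (oo :: ps)) tame (Xi x f) (Xi x g) = 1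
  & forall x, x.1 \notin oo :: ps -> tame (Xi x f) (Xi x g) = 1].
Proof.
move=> ff gg; have [e [w [ga [r0 [eP w_incr w_stable w_onto]]]]] := affine_basis iotaP oo1.
have num h := tensor_numerator eP w_onto h.
(* If a h and b h' are regular, their product is a b; so both a h and a divide a b. *)
have frac h h' : h * h' = 1 -> exists (a b : K), [/\ a != 0, b != 0, affine iota oo a,
    affine iota oo b & regular_divisor e (a * b) (fun x => xi x a * Xi x h) /\
    regular_divisor e (a * b) (fun x => xi x a)].
  move=> hh; have [a [P [a0 aA PE]]] := num h; have [b [Q [b0 bA QE]]] := num h'.
  exists a, b; split=> //; split.
    exists P, Q; split=> // x.
    by rewrite PE QE mulrACA -!rmorphM hh rmorph1 mulr1.
  apply: (regular_divisor_mul eP w_onto) => //.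
  have [R RE] := kspan_onto iotaP oo1 eP w_onto aA.
  have [R1 R1E] := kspan_onto iotaP oo1 eP w_onto (@affine1 _ _ iota oo).
  exists (map_poly io R), (map_poly io R1); split=> x.
    by rewrite (fspan_map _ (xi_const iotaP sig_const x)) -RE.
  by rewrite !(fspan_map _ (xi_const iotaP sig_const x)) -RE -R1E rmorph1 mulr1.
have [a [b [a0 b0 aA bA [Fa Fa1]]]] := frac _ _ ff.
have [a' [b' [a0' b0' aA' bA' [Ga Ga1]]]] := frac _ _ gg.
pose c := a * b * (a' * b'); have c0 : c != 0 by rewrite !mulf_neq0.
have abA : affine iota oo (a * b) by apply: affineM.
have abA' : affine iota oo (a' * b') by apply: affineM.
have cA : affine iota oo c by apply: affineM.
have mulL G : regular_divisor e (a * b) G -> regular_divisor e c G.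
  exact: (regular_divisor_mul eP w_onto).
have mulR G : regular_divisor e (a' * b') G -> regular_divisor e c G.
  by rewrite /c [a * b * _]mulrC; apply: (regular_divisor_mul eP w_onto).
move/mulL in Fa; move/mulL in Fa1; move/mulR in Ga; move/mulR in Ga1.
have [Z [uZ ZP]] := finite_poles iotaP c^-1.
exists (rem oo Z).
have oops : oo \notin rem oo Z by rewrite mem_rem_uniqF.
have ups : uniq (rem oo Z) by apply: rem_uniq.
have cz p : p != oo -> vge iota p 1 c -> p \in rem oo Z.
  move=> po cp; rewrite mem_rem_uniq // inE po; apply/ZP => /vgeE.
  rewrite invr_eq0 ordV // => /(_ c0).
  by have := (vgeE iota p 1 c0).1 cp; clear; lia.
have rec G H Gc Hc := @regular_reciprocity e w ga r0 eP w_incr w_stable w_onto c _ G H cA c0 Gc Hc ups oops cz.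
have unit_neq0 x h h' : h * h' = 1 -> Xi x h != 0.
  move=> hh; apply/eqP => h0; have := congr1 (Xi x) hh.
  by rewrite rmorphM h0 mul0r rmorph1 => /esym/eqP; rewrite oner_eq0.
have xi_neq0 x z : z != 0 -> xi x z != 0.
  move=> z0; apply/eqP => h0; have := congr1 (xi x) (divff z0).
  by rewrite rmorphM h0 mul0r rmorph1 => /esym/eqP; rewrite oner_eq0.
have f0 x := unit_neq0 x _ _ ff; have g0 x := unit_neq0 x _ _ gg.
split=> //.
  (* Reciprocity for the pairs (a, a'), (a, a' g), (a f, a') and (a f, a' g) gives it for (f, g) by
     bimultiplicativity. *)
  have r1 := rec _ _ Fa1 Ga1; have r2 := rec _ _ Fa1 Ga; have r3 := rec _ _ Fa Ga1.
  have af x : xi x a * Xi x f != 0 by apply/eqP => /laurent_mulf_eq0 [] /eqP; apply/negP; auto.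
  have := rec _ _ Fa Ga.
  under eq_bigr => x _ do rewrite tameMr ?af ?f0 ?g0 ?xi_neq0 //.
  rewrite big_split /= r3 mul1r.
  under eq_bigr => x _ do rewrite tameMl ?f0 ?g0 ?xi_neq0 //.
  rewrite big_split /=; move: r2.
  under eq_bigr => x _ do rewrite tameMr ?f0 ?g0 ?xi_neq0 //.
  by rewrite big_split /= r1 mul1r => ->; rewrite mul1r.
move=> x; rewrite inE negb_or => /andP[xo xps].
have unram h z : z != 0 -> regular_divisor e c (fun x => xi x z * Xi x h) ->
    regular_divisor e c (fun x => xi x z) -> exists d, has_order (Xi x h) 0 d.
  move=> z0 hr zr.
  have [m [d [mo m0]]] := regular_order eP cA c0 hr xo.
  have [n [d' [no n0]]] := regular_order eP cA c0 zr xo.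
  have nz : ~ vge iota x.1 1 c by move/(cz _ xo); apply/negP.
  rewrite m0 // in mo; rewrite n0 // in no.
  have h0 : Xi x h != 0 by apply/eqP => h0; have := has_order_neq0 mo; rewrite h0 mulr0 eqxx.
  have [t [d1 ho]] := order_exists h0.
  have [tE _] := has_order_unique (has_orderM no ho) mo.
  by exists d1; rewrite (_ : 0 = t) //; move: tE; clear; lia.
have [d fo] := unram f a a0 Fa Fa1.
have [d' go] := unram g a' a0' Ga Ga1.
exact: tame_unramified fo go.
Qed.
End Tensor.
End TameReciprocity.

(** * Expansions of tensors and the end of the proof *)

Lemma tinr_scalar (k : fieldType) (A : comNzRingType) (s : {rmorphism k -> A})
  (L : comUnitAlgType k) (hL : finite_alg L) c : tinr s hL c%:A = tinl s hL (s c).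
Proof.
apply/ffunP => l; rewrite !ffunE -rmorphM; congr (s _).
apply: (fcoord_uniq (hF := hL) (c := fun l => c * fcoord hL 1 l)).
rewrite {1}(fcoordE hL 1) scaler_sumr.
by apply: eq_bigr => i _; rewrite scalerA.
Qed.

Section Expansion.
Variables (k : finFieldType) (C : curve k).
Variables (B : comUnitAlgType k) (finB : finite_alg B) (p : closed_point C).
Variable iota : {rmorphism function_field C -> laurent (residue_field p)}.
Hypothesis iota_scalar : forall c, iota (constants C c) = lconst c%:A.

Lemma expand_morphism : exists h : {rmorphism function_tensor C finB -> laurent (residue_tensor B p)},
  forall f, h f = expand iota f.
Proof.
have [c|h hE] := @tens_lift _ _ (constants C) _ finB _
    (lmap (tinr (in_alg B) (finite_alg_ext (residue_field p))) \o iota)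
    (@lconst _ \o tinl (in_alg B) (finite_alg_ext (residue_field p))).
  by rewrite /= iota_scalar lmap_lconst; congr lconst; apply: tinr_scalar.
by exists h => f; rewrite hE /expand; apply: eq_bigr => i _; rewrite mulrC.
Qed.

(** The factorization of series was established over rings whose elements can be listed. *)
Lemma residue_tensor_enum : exists s0 : seq (residue_tensor B p), forall x, x \in s0.
Proof.
pose hL := finite_alg_ext (residue_field p).
pose dec (t : {ffun 'I_(fdim hL) -> {ffun 'I_(fdim finB) -> k}}) : residue_tensor B p :=
  [ffun l => \sum_i t l i *: fbasis finB i].
exists [seq dec t | t <- enum {: {ffun 'I_(fdim hL) -> {ffun 'I_(fdim finB) -> k}}}] => x.
apply/mapP; exists [ffun l => fcoord finB (x l)]; first by rewrite mem_enum.
by apply/ffunP => l; rewrite !ffunE -fcoordE.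
Qed.

Variables (F : fieldType) (pi : {rmorphism B -> F}).
Variables (sg : {rmorphism residue_field p -> F}) (th : {rmorphism residue_tensor B p -> F}).
Hypothesis sg_const : forall c, sg c%:A = pi (in_alg B c).
Hypothesis thE : forall x, th x = \sum_l pi (x l) * sg (fbasis (finite_alg_ext (residue_field p)) l).

Lemma expand_place f : lmap th (expand iota f) =
  \sum_i lmap sg (iota (f i)) * lconst (pi (fbasis finB i)).
Proof.
have thr y : th (tinr (in_alg B) (finite_alg_ext (residue_field p)) y) = sg y.
  exact: (@tens_lift_tinr _ _ (in_alg B) _ _ _ pi (fun=> sg) (fun=> sg_const) (fun=> th) (fun=> thE) 0).
have thl b : th (tinl (in_alg B) (finite_alg_ext (residue_field p)) b) = pi b.
  rewrite thE; transitivity (pi b * sg 1); last by rewrite rmorph1 mulr1.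
  rewrite [in RHS](fcoordE (finite_alg_ext (residue_field p)) 1) rmorph_sum mulr_sumr.
  by apply: eq_bigr => l _; rewrite ffunE rmorphM -sg_const -mulrA -rmorphM mulr_algl.
rewrite /expand rmorph_sum; apply: eq_bigr => i _.
rewrite rmorphM /= lmap_lconst thl mulrC; congr (_ * _).
by apply: laurentP => j /=; rewrite thr.
Qed.
End Expansion.

Lemma tame_norm (k : finFieldType) (C : curve k) (B : comUnitAlgType k) (p : closed_point C)
  (F : fieldType) (pi : {rmorphism B -> F}) (th : nat -> {rmorphism residue_tensor B p -> F}) U W b :
  (forall x, pi (residue_norm x) = \prod_(i < degree p) th i x) -> glued_symbol U W b ->
  pi b = \prod_(i < degree p) tame (lmap (th i) U) (lmap (th i) W).
Proof.
move=> piN [r [e [u [w [eP -> -> ->]]]]]; rewrite piN; apply: eq_bigr => i _.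
exact: glue_tame.
Qed.

Section RootsOfUnity.
Variables (k : finFieldType) (m : nat) (k_roots : (m %| #|k|.-1)%N).
Variables (C : curve k) (oo : closed_point C) (oo1 : degree oo = 1%N).
Variables (B : comUnitAlgType k) (F : fieldType) (pi : {rmorphism B -> F}).
Hypothesis pi_nil : forall b, pi b = 0 -> exists n : nat, b ^+ n = 0.

Lemma pi_unit b : pi b = 1 -> b \is a GRing.unit.
Proof.
move=> b1; have [|n bn] := @pi_nil (1 - b); first by rewrite rmorphB rmorph1 b1 subrr.
by rewrite -[b](subKr 1); apply: unit_1Bnil bn.
Qed.

Variable N : nat.
Hypothesis symbol_mu : forall u w : gamma (residue_tensor B oo), mu m (symbol u w ^+ N).

(* The symbol of the constant b and of the coordinate z at oo is b. *)
Lemma unit_mu (b : B) : b \is a GRing.unit -> (b ^+ N) ^+ m = 1.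
Proof.
move=> bu; pose hL := finite_alg_ext (residue_field oo).
have tu : (tinl (in_alg B) hL b : residue_tensor B oo) \is a GRing.unit by apply: rmorph_unit.
have ng i : (0 < i <= 0)%N -> exists n : nat, (0 : residue_tensor B oo) ^+ n = 0 by lia.
have c1 a h : cross_product (R := residue_tensor B oo) a 0 h = 1.
  by rewrite /cross_product fsbig1 // => i _; apply: big_geq.
pose u := @Gamma (residue_tensor B oo) 0 _ 0 (fun=> 0) (fun=> 0) tu ng.
pose w := @Gamma (residue_tensor B oo) 1 1 0 (fun=> 0) (fun=> 0) (unitr1 _) ng.
have := symbol_mu u w; rewrite /mu /= /symbol /symbol_ratio /= !c1 expr1z expr0z !mulr1 divr1 mul0r.
by rewrite ?mul0r ?expr0z mul1r /residue_norm tnorm_tinl fdim_ext -/(degree oo) oo1 expr1.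
Qed.

(** Put y = b^N, so y^m = 1. In y^m - 1 = (y - 1)(1 + ... + y^(m-1)) the second factor has image m
    in F, which is nonzero because m divides #k - 1; being then a unit, it forces y = 1. *)
Lemma unipotent_power b : pi b = 1 -> b ^+ N = 1.
Proof.
move=> b1; have bm := unit_mu (pi_unit b1).
set y := b ^+ N in bm *; have y1 : pi y = 1 by rewrite rmorphXn b1 expr1n.
have mk : (m%:R : k) != 0.
  have /dvdnP [d dE] := k_roots; apply/eqP => m0.
  have [p pk pq] := card_pnat k; have q1 := card_gt1 k.
  have q0 : (#|k|%:R : k) == 0.
    rewrite -(dvdn_pcharf pk); case/p_natP: pq q1 => j ->.
    by case: j => // j _; rewrite expnS dvdn_mulr.
  by move: q0; rewrite -(prednK (ltnW q1)) dE -[_.+1]addn1 natrD natrM m0 mulr0 add0r oner_eq0.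
have mF : (m%:R : F) != 0 by rewrite -(rmorph_nat (pi \o in_alg B)) fmorph_eq0.
have su : \sum_(i < m) y ^+ i \is a GRing.unit.
  have mu' : (m%:R : B) \is a GRing.unit.
    by rewrite -(rmorph_nat (in_alg B)); apply: rmorph_unit; rewrite unitfE.
  rewrite -(mulVKr mu' (\sum_(i < m) _)) unitrM mu' pi_unit // rmorphM rmorphV // rmorph_sum.
  rewrite (eq_bigr (fun=> 1)) => [|i _]; last by rewrite rmorphXn y1 expr1n.
  by rewrite sumr_const card_ord rmorph_nat mulVf.
have := subrX1 y m; rewrite bm subrr => /esym/(congr1 ( *%R^~ (\sum_(i < m) y ^+ i)^-1)).
by rewrite mulrK // mul0r => /eqP; rewrite subr_eq0 => /eqP.
Qed.
End RootsOfUnity.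

Theorem corollary4p16 (k : finFieldType) (m : nat) (k_roots : (m %| #|k|.-1)%N)
  (C : curve k) (rational_point : exists p : closed_point C, degree p = 1%N)
  (B : comUnitAlgType k) (finB : finite_alg B) (locB : is_local B)
  (iota : forall p : closed_point C,
    {rmorphism function_field C -> laurent (residue_field p)})
  (iotaP : forall p : closed_point C, laurent_expansion (iota p))
  (N : nat) (N_gt0 : (0 < N)%N)
  (symbol_mu : forall (p : closed_point C) (u w : gamma (residue_tensor B p)),
    mu m (symbol u w ^+ N))
  (f g : function_tensor C finB)
  (f_unit : f \is a GRing.unit) (g_unit : g \is a GRing.unit) :
  finite_set [set p : closed_point C | curve_symbol (iota p) N f g != 1] /\
  \big[*%R/1]_(p \in [set: closed_point C]) curve_symbol (iota p) N f g = 1.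
Proof.
have [oo oo1] := rational_point.
have [F [pi pi_nil]] := residue_closure finB locB.
have [sg [sg_const sg_unit thP]] := geometric_points C pi.
pose th p := projT1 (cid (thP p)); have thE p := projT2 (cid (thP p)).
have sg_dual p (i : 'I_(degree p)) : exists c : 'I_(degree p) -> F,
    forall i' : 'I_(degree p), \sum_l c l * sg p i' (kbasis p l) = (i == i')%:R.
  have Vu := sg_unit p _ _ (@kbasis_free _ _ p).
  exists (fun l => invmx (\matrix_(l < degree p, i < degree p) sg p i (kbasis p l)) i l) => i'.
  have := congr1 (fun A : 'M[F]_(degree p) => A i i') (mulVmx Vu).
  by rewrite !mxE => <-; apply: eq_bigr => l _; rewrite !mxE.
have unipotent := unipotent_power k_roots oo1 pi_nil (@symbol_mu oo).
pose io : {rmorphism k -> F} := pi \o in_alg B.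
have sg_io p i c : sg p i c%:A = io c by apply: sg_const.
have ioE c : io c = pi c%:A by [].
have /choice [Xi XiE] (x : closed_point C * nat) := tensor_place iotaP sg_io finB ioE x.
have [ps [ups oops rec unram]] := tensor_reciprocity iotaP oo1 sg_io sg_dual XiE
  (divrr f_unit) (divrr g_unit).
(* The series are invertible, so [glue_units] provides a value of the glued symbol, and the element
   that [xget] picks satisfies the relation; nothing else is used about the choice. *)
have /choice [b bE] p : exists b : B, glued_symbol (expand (iota p) f) (expand (iota p) g) b /\
    curve_symbol (iota p) N f g = b ^+ N.
  have [s0 s0P] := residue_tensor_enum finB p.
  have [h hE] := expand_morphism finB (iota_const iotaP p).
  have hV (z : function_tensor C finB) : z \is a GRing.unit -> expand (iota p) z * expand (iota p) z^-1 = 1.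
    by move=> zu; rewrite -!hE -rmorphM divrr ?rmorph1.
  have [r [e [u [w [eP uE wE]]]]] := glue_units s0P (hV _ f_unit) (hV _ g_unit).
  exists (xget 1 [set b | glued_symbol (expand (iota p) f) (expand (iota p) g) b]).
  split=> //; apply: (@xgetPex _ 1 [set b | glued_symbol (expand (iota p) f) (expand (iota p) g) b]).
  by eexists; exists r, e, u, w; split.
have pib p : pi (b p) = \prod_(i < degree p) tame (Xi (p, i : nat) f) (Xi (p, i : nat) g).
  have [thpE thpN] := thE p.
  rewrite (tame_norm thpN (bE p).1); apply: eq_bigr => i _.
  have ex z : lmap (th p i) (expand (iota p) z) = Xi (p, i : nat) z.
    by rewrite XiE (expand_place _ (sg_const p i) (thpE i)).
  by rewrite !ex.
have trivial p : p \notin oo :: ps -> curve_symbol (iota p) N f g = 1.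
  move=> pps; rewrite (bE p).2 unipotent // pib big1 // => i _; exact: unram.
split.
  apply: (@sub_finite_set _ _ [set` oo :: ps]); last exact: finite_seq.
  move=> p /= cp; apply: contraNT cp => /trivial ->; exact: eqxx.
rewrite (fsbigE (oo :: ps)) //=; last 2 first.
- by rewrite oops ups.
- by move=> p _; apply: trivial.
under eq_bigl => p do rewrite in_setT.
under eq_bigr => p _ do rewrite (bE p).2.
(* The product of all the [b p] maps to 1 by reciprocity, so its N-th power is 1. *)
rewrite prodrXl unipotent // rmorph_prod -[RHS]rec /points /positions big_allpairs_dep.
apply: eq_bigr => p _; rewrite pib -(big_mkord xpredT (fun i => tame (Xi (p, i) f) (Xi (p, i) g))).
by rewrite /index_iota subn0.
Qed.
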